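(* Let $X$ be a metric space homeomorphic to $\overline{D}$ such that, for some $L>0$, $\mathcal{H}^2(B(x,r))\le L\cdot r^2$ for every $x\in X$ and $r>0$. Let $Q\ge1$ and let $u\colon\overline{D}\to X$ be a homeomorphism satisfying $\operatorname{MOD}(\Gamma)\le Q\cdot\operatorname{MOD}(u\circ\Gamma)$ for every family $\Gamma$ of curves in $\overline{D}$. Then $u$ is quasisymmetric if and only if $X$ is doubling and linearly locally connected.
   Context: $\overline{D}$ is the closed unit disc in $\mathbb{R}^2$ (with Lebesgue measure). For a family $\Gamma$ of curves in a metric space $Y$ (with reference measure the Hausdorff $2$-measure $\mathcal{H}^2$, normalized as Lebesgue measure on $\mathbb{R}^2$), $\operatorname{MOD}(\Gamma)=\inf_\rho\int_Y\rho^2\,d\mathcal{H}^2$, the infimum over Borel $\rho\colon Y\to[0,\infty]$ with $\int_\gamma\rho\ge1$ for every locally rectifiable $\gamma\in\Gamma$. $u\circ\Gamma=\{u\circ\gamma:\gamma\in\Gamma\}$. $X$ is doubling if there is $N$ such that every ball of radius $2r$ is covered by $N$ balls of radius $r$. Linearly locally connected: there is $\lambda\ge1$ such that for all $x$, $r>0$, any two points of $B(x,r)$ can be joined by a continuum in $B(x,\lambda r)$ and any two points of $X\setminus B(x,r)$ by a continuum in $X\setminus B(x,r/\lambda)$. A homeomorphism $\varphi$ is quasisymmetric if there is a homeomorphism $\eta$ of $[0,\infty)$ with $d(\varphi(z),\varphi(a))\le\eta(t)d(\varphi(z),\varphi(b))$ whenever $d(z,a)\le t\,d(z,b)$. *)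

(* Defs.v *)
From HB Require Import structures.
From mathcomp Require Import all_boot all_order all_algebra.
From mathcomp Require Import all_classical all_reals all_analysis measurable_realfun.
Set Implicit Arguments. Unset Strict Implicit. Unset Printing Implicit Defensive.
Import Order.TTheory GRing.Theory Num.Theory.
Local Open Scope classical_set_scope.
Local Open Scope ring_scope.

Section MetricDefs.
Variable R : realType.

Definition is_metric (T : Type) (d : T -> T -> R) : Prop :=
  (forall x y, 0 <= d x y) /\ (forall x y, d x y = 0 <-> x = y) /\
  (forall x y, d x y = d y x) /\ (forall x y z, d x z <= d x y + d y z).

Variables (T : Type) (d : T -> T -> R).

Definition mball (x : T) (r : R) : set T := [set y | d x y < r].

Definition mopen (A : set T) : Prop :=
  forall x, A x -> exists2 r : R, 0 < r & mball x r `<=` A.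

Definition mborel (A : set T) : Prop :=
  forall S : set (set T), sigma_algebra setT S -> (forall U, mopen U -> S U) -> S A.

Definition mborel_fun (f : T -> \bar R) : Prop :=
  forall B : set (\bar R), measurable B -> mborel (f @^-1` B).

(* diameter, with diam(empty) = 0 *)
Definition mdiam (A : set T) : \bar R :=
  ereal_sup ([set 0%E] `|` [set (d x y)%:E | x in A & y in A]).

(* Hausdorff 2-measure, normalized so that it agrees with Lebesgue measure on R^2 *)
Definition H2_delta (delta : R) (A : set T) : \bar R :=
  ereal_inf [set (\sum_(i <oo) ((pi / 4)%:E * (mdiam (U i) * mdiam (U i))))%E
            | U in [set U : nat -> set T |
                     A `<=` \bigcup_i U i /\ forall i, (mdiam (U i) <= delta%:E)%E]].

Definition H2 (A : set T) : \bar R :=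
  ereal_sup [set H2_delta delta A | delta in [set delta : R | 0 < delta]].

(* Lebesgue integral of a nonnegative Borel function w.r.t. H2 (restricted to
   Borel sets): supremum of the integrals of the simple functions below f *)
Definition int_H2 (f : T -> \bar R) : \bar R :=
  ereal_sup [set v | exists (n : nat) (E : nat -> set T),
     [/\ forall i, (i < n)%N -> mborel (E i),
          forall i j, (i < n)%N -> (j < n)%N -> i <> j -> E i `&` E j = set0 &
          v = (\sum_(i < n) (ereal_inf (f @` E i) * H2 (E i)))%E]].

Record curve := Curve { cdom : interval R; cmap : R -> T }.

Definition is_curve (g : curve) : Prop :=
  (exists t, t \in cdom g) /\
  forall t, t \in cdom g -> forall e : R, 0 < e ->
    exists2 del : R, 0 < del & forall s, s \in cdom g -> `|s - t| < del ->
      d (cmap g t) (cmap g s) < e.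

Definition clength (g : R -> T) (a b : R) : \bar R :=
  ereal_sup [set v | exists (n : nat) (tt : nat -> R),
     [/\ tt 0%N = a, tt n = b, (forall i, (i < n)%N -> tt i <= tt i.+1) &
          v = (\sum_(i < n) d (g (tt i)) (g (tt i.+1)))%:E]].

Definition locally_rectifiable (g : curve) : Prop :=
  forall a b, a <= b -> a \in cdom g -> b \in cdom g -> (clength (cmap g) a b < +oo)%E.

(* arc-length parametrization of g on [a,b]: sigma |-> g(t) with s_g(t) = sigma *)
Definition arclength_param (g : R -> T) (a b : R) (sigma : R) : T :=
  g (inf [set t | a <= t <= b /\ (sigma%:E <= clength g a t)%E]).

Definition cline_int (rho : T -> \bar R) (g : R -> T) (a b : R) : \bar R :=
  (\int[lebesgue_measure]_(s in [set s : R | (0 <= s <= fine (clength g a b))%R]) rho (arclength_param g a b s))%E.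

Definition line_int (rho : T -> \bar R) (g : curve) : \bar R :=
  ereal_sup [set cline_int rho (cmap g) ab.1 ab.2
            | ab in [set ab : R * R | ab.1 <= ab.2 /\ ab.1 \in cdom g /\ ab.2 \in cdom g]].

Definition admissible (Gam : set curve) (rho : T -> \bar R) : Prop :=
  (forall x, (0 <= rho x)%E) /\ mborel_fun rho /\
  forall g, Gam g -> locally_rectifiable g -> (1 <= line_int rho g)%E.

Definition MOD (Gam : set curve) : \bar R :=
  ereal_inf [set int_H2 (fun x => rho x * rho x)%E | rho in admissible Gam].

Definition doubling : Prop :=
  exists N : nat, forall (x : T) (r : R), 0 < r ->
    exists c : 'I_N -> T,
      mball x (2 * r) `<=` [set y | exists i, mball (c i) r y].

Definition mcompact (K : set T) : Prop :=
  forall F : set (set T), (forall U, F U -> mopen U) -> K `<=` \bigcup_(U in F) U ->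
    exists (n : nat) (V : 'I_n -> set T), (forall i, F (V i)) /\
      K `<=` [set y | exists i, V i y].

Definition mconnected (K : set T) : Prop :=
  forall U V, mopen U -> mopen V -> K `<=` U `|` V -> K `&` U `&` V = set0 ->
    K `&` U = set0 \/ K `&` V = set0.

Definition continuum (K : set T) : Prop := mcompact K /\ mconnected K /\ K !=set0.

Definition LLC : Prop :=
  exists2 lam : R, 1 <= lam & forall (x : T) (r : R), 0 < r ->
    (forall y z, mball x r y -> mball x r z ->
       exists K, [/\ continuum K, K `<=` mball x (lam * r), K y & K z]) /\
    (forall y z, ~ mball x r y -> ~ mball x r z ->
       exists K, [/\ continuum K, K `<=` ~` mball x (r / lam), K y & K z]).

End MetricDefs.

Arguments Curve {R T}.

Definition comp_family (R : realType) (T1 T2 : Type) (u : T1 -> T2)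
  (Gam : set (curve R T1)) : set (curve R T2) :=
  [set Curve (cdom g) (u \o cmap g) | g in Gam].

Definition mcontinuous (R : realType) (T1 T2 : Type) (d1 : T1 -> T1 -> R)
  (d2 : T2 -> T2 -> R) (f : T1 -> T2) : Prop :=
  forall x (e : R), 0 < e -> exists2 del : R, 0 < del &
    forall y, d1 x y < del -> d2 (f x) (f y) < e.

Definition homeomorphism (R : realType) (T1 T2 : Type) (d1 : T1 -> T1 -> R)
  (d2 : T2 -> T2 -> R) (f : T1 -> T2) : Prop :=
  exists g : T2 -> T1, [/\ cancel f g, cancel g f,
    mcontinuous d1 d2 f & mcontinuous d2 d1 g].

Definition homeo_halfline (R : realType) (eta : R -> R) : Prop :=
  exists etainv : R -> R,
    (forall t, 0 <= t -> [/\ 0 <= eta t, 0 <= etainv t, etainv (eta t) = t & eta (etainv t) = t]) /\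
    (forall t, 0 <= t -> forall e : R, 0 < e -> exists2 del : R, 0 < del &
        forall s, 0 <= s -> `|s - t| < del -> `|eta s - eta t| < e) /\
    (forall t, 0 <= t -> forall e : R, 0 < e -> exists2 del : R, 0 < del &
        forall s, 0 <= s -> `|s - t| < del -> `|etainv s - etainv t| < e).

Definition quasisymmetric (R : realType) (T1 T2 : Type) (d1 : T1 -> T1 -> R)
  (d2 : T2 -> T2 -> R) (f : T1 -> T2) : Prop :=
  homeomorphism d1 d2 f /\
  exists eta : R -> R, homeo_halfline eta /\
    forall z a b (t : R), 0 <= t -> d1 z a <= t * d1 z b ->
      d2 (f z) (f a) <= eta t * d2 (f z) (f b).

Definition cdisc (R : realType) := {p : R * R | p.1 ^+ 2 + p.2 ^+ 2 <= 1}.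

Definition ddisc (R : realType) (p q : cdisc R) : R :=
  Num.sqrt (((val p).1 - (val q).1) ^+ 2 + ((val p).2 - (val q).2) ^+ 2).

(* Main.v *)
(* If [u] is quasisymmetric, doubling and linear local connectivity are pulled back from the disc, where
   points are joined by segments and by arcs of circles.

   Conversely, let [X] be doubling and linearly locally connected.  If [|z - a| <= |z - b| / 16] but
   [d (u z) (u a)] were much larger than [d (u z) (u b)], linear local connectivity would give continua
   through [u z, u b] and through [u a, u w], with [w] far from [a], on the two sides of a thick annulus
   centred at [u z].  By the quadratic volume bound the curves joining them have modulus [O(1 / n)], where
   [2 ^ n] is the ratio of the radii.  Their preimages both meet every circle of radius between [|z - a|]
   and [2 |z - a|] about [z]; integrating over the arcs of these circles inside the disc, the curves
   joining them have modulus at least [1 / 1024].  This bounds [n], so [u] is weakly quasisymmetric.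
   Chaining along segments and the doubling property then give a power-type distortion function.
   The distortion may depend on [u], which allows the use of crude compactness constants. *)

From HB Require Import structures.
Require Import Defs.
From mathcomp Require Import all_boot all_order all_algebra.
From mathcomp Require Import all_classical all_reals all_analysis measurable_realfun.
From mathcomp Require Import ring lra.
Set Implicit Arguments.
Unset Strict Implicit.
Unset Printing Implicit Defensive.
Import Order.TTheory GRing.Theory Num.Theory.
Import numFieldNormedType.Exports.
Local Open Scope classical_set_scope.
Local Open Scope ring_scope.

(** * Hausdorff measure *)

(** [int_H2] is a supremum over Borel simple functions against what is a priori only an outer
    measure, and the two modulus bounds ask different things of it. Bounding the energy of a test
    function on [X] from above requires superadditivity over disjoint Borel pieces, hence
    Caratheodory's criterion. On the disc the energy is bounded from below through a one-sided
    comparison: polar coordinates pull a Borel set back to a set of Lebesgue measure at most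
    [64 / (pi * rad)] times its [H2], as is seen on covers. For each radius the two points where the
    continua meet the circle are only known to exist. The line integral is therefore enlarged to the
    whole part of the circle inside the disc before the radius is integrated, so that nothing has to
    depend measurably on their choice. The factor 16 leaves room for [w]: the disc has diameter at
    most 2, so [|z - a| <= 1 / 8], and a point at distance at least [7 / 10] from [a] lies beyond
    the circle of radius [2 |z - a|] about [z]. *)

Section HausdorffOuterMeasure.
Context {R : realType} {T : Type}.
Variable d : T -> T -> R.
Local Open Scope ereal_scope.

Lemma mdiam_ge0 (A : set T) : 0 <= mdiam d A.
Proof. by apply: ereal_sup_ubound; left. Qed.

Lemma mdiam_ub (A : set T) x y : A x -> A y -> (d x y)%:E <= mdiam d A.
Proof. by move=> Ax Ay; apply: ereal_sup_ubound; right; exists x => //; exists y. Qed.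

Lemma mdiam0 : mdiam d set0 = 0.
Proof.
apply/eqP; rewrite eq_le mdiam_ge0 andbT; apply: ge_ereal_sup => v.
by case=> [->//|[x []]].
Qed.

(* Charging [+oo] to sets of large diameter makes [H2_delta] an outer measure generated by an unrestricted gauge. *)
Definition H2_gauge (delta : R) (A : set T) : \bar R :=
  if mdiam d A <= delta%:E then (pi / 4)%:E * (mdiam d A * mdiam d A) else +oo.

Let gauge_ge0 (A : set T) : 0 <= (pi / 4 : R)%:E * (mdiam d A * mdiam d A).
Proof.
rewrite mule_ge0 ?mule_ge0 ?mdiam_ge0 // lee_fin divr_ge0 ?pi_ge0 //.
Qed.

Lemma H2_gauge_ge0 delta A : 0 <= H2_gauge delta A.
Proof. by rewrite /H2_gauge; case: ifP. Qed.

Lemma H2_delta_gauge delta A :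
  H2_delta d delta A =
  ereal_inf [set \sum_(i <oo) H2_gauge delta (U i) | U in
    [set U : nat -> set T | A `<=` \bigcup_i U i]].
Proof.
apply/eqP; rewrite eq_le; apply/andP; split.
  apply: le_ereal_inf_tmp => _ [U AU <-].
  have [Ud|/existsNP[i]] := pselect (forall i, mdiam d (U i) <= delta%:E).
    apply: ereal_inf_lbound; exists U => //.
    by apply: eq_eseriesr => i _; rewrite /H2_gauge Ud.
  move=> /negP /negbTE Ui.
  rewrite (@nneseries_pinfty _ _ xpredT i) ?leey//.
  - by move=> n _; exact: H2_gauge_ge0.
  - by rewrite /H2_gauge Ui.
apply: le_ereal_inf_tmp => _ [U [AU Ud] <-].
apply: ereal_inf_lbound; exists U => //.
by apply: eq_eseriesr => i _; rewrite /H2_gauge Ud.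
Qed.

Lemma H2_delta_ge0 delta A : 0 <= H2_delta d delta A.
Proof.
rewrite H2_delta_gauge; apply: le_ereal_inf_tmp => _ [U AU <-].
by apply: nneseries_ge0 => n _ _; exact: H2_gauge_ge0.
Qed.

Lemma le_H2_delta delta A B : A `<=` B -> H2_delta d delta A <= H2_delta d delta B.
Proof.
move=> AB; apply: ereal_inf_le_tmp => _ [U [BU Ud] <-].
by exists U => //; split => //; exact: subset_trans BU.
Qed.

Lemma H2_delta0 delta : (0 < delta)%R -> H2_delta d delta set0 = 0.
Proof.
move=> d0; apply/eqP; rewrite eq_le H2_delta_ge0 andbT.
apply: ereal_inf_lbound; exists (fun=> set0).
  by split => // i; rewrite mdiam0 lee_fin ltW.
by rewrite eseries0// => i _ _; rewrite mdiam0 mule0 mule0.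
Qed.

Lemma H2_delta_sigma_subadditive delta : (0 < delta)%R -> sigma_subadditive (H2_delta d delta).
Proof.
move=> d0 F; have [[x0 _]|T0] := pselect (exists x : T, True); last first.
  have e0 (A : set T) : A = set0 by apply/seteqP; split => // x; case: T0; exists x.
  rewrite (e0 (\bigcup_n F n)) H2_delta0//.
  by apply: nneseries_ge0 => n _ _; exact: H2_delta_ge0.
(* [mu_ext] lives on a pointed measurable type; the sigma-algebra generated by all subsets makes
   every cover a cover by measurable sets. *)
pose Tp : pointedType := HB.pack T (gen_eqMixin T) (gen_choiceMixin T) (isPointed.Build T x0).
pose Td := g_sigma_algebraType ([set: set Tp]).
have E A : H2_delta d delta A = @mu_ext _ Td R (H2_gauge delta) A.
  rewrite H2_delta_gauge /mu_ext; congr ereal_inf; apply/seteqP; split.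
    by move=> _ [U AU <-]; exists U => //; split => // i; exact: sub_gen_smallest.
  by move=> _ [U [_ AU] <-]; exists U.
rewrite E (eq_eseriesr (fun n _ => E (F n))).
apply: mu_ext_sigma_subadditive => X; exact: H2_gauge_ge0.
Qed.

Lemma H2_delta_le delta A : (0 < delta)%R -> H2_delta d delta A <= H2 d A.
Proof. by move=> d0; apply: ereal_sup_ubound; exists delta. Qed.

Lemma H2_ge0 A : 0 <= H2 d A.
Proof. by apply: (le_trans (H2_delta_ge0 1 A)); exact: H2_delta_le. Qed.

Lemma H2_set0 : H2 d set0 = 0.
Proof.
apply/eqP; rewrite eq_le H2_ge0 andbT.
by apply: ge_ereal_sup => _ [e /= e0 <-]; rewrite H2_delta0.
Qed.

Lemma le_H2 : {homo H2 d : A B / A `<=` B >-> A <= B}.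
Proof.
move=> A B AB; apply: ge_ereal_sup => _ [e /= e0 <-].
exact: le_trans (le_H2_delta _ AB) (H2_delta_le _ e0).
Qed.

Lemma H2_sigma_subadditive : sigma_subadditive (H2 d).
Proof.
move=> F; apply: ge_ereal_sup => _ [e /= e0 <-].
apply: (le_trans (H2_delta_sigma_subadditive e0 F)).
apply: lee_nneseries => n _; first by move=> _; exact: H2_delta_ge0.
exact: H2_delta_le.
Qed.

HB.instance Definition _ := isOuterMeasure.Build R T (H2 d)
  H2_set0 H2_ge0 le_H2 H2_sigma_subadditive.

End HausdorffOuterMeasure.

(** * Caratheodory's criterion for the Hausdorff measure *)

Section MetricOuterMeasure.
Context {R : realType} {T : Type}.
Variable d : T -> T -> R.
Hypothesis d_tri : forall x y z, d x z <= d x y + d y z.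
Local Open Scope ereal_scope.

Definition separated (A B : set T) :=
  exists2 e : R, (0 < e)%R & forall x y, A x -> B y -> (e <= d x y)%R.

Lemma H2_delta_anti e1 e2 A : (e1 <= e2)%R -> H2_delta d e2 A <= H2_delta d e1 A.
Proof.
move=> e12; apply: ereal_inf_le_tmp => _ [U [AU Ud] <-]; exists U => //; split => // i.
by rewrite (le_trans (Ud i)) ?lee_fin.
Qed.

(** A set of diameter at most [delta] cannot meet both [A] and [B], so a cover of the union splits
    into a cover of each. *)
Lemma H2_delta_separated (A B : set T) (e delta : R) : (delta < e)%R ->
  (forall x y, A x -> B y -> (e <= d x y)%R) ->
  H2_delta d delta A + H2_delta d delta B <= H2_delta d delta (A `|` B).
Proof.
move=> de AB; rewrite !H2_delta_gauge; apply: le_ereal_inf_tmp => _ [U /= ABU <-].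
have [[i Ui]|nU] := pselect (exists i, H2_gauge d delta (U i) = +oo).
  rewrite (@nneseries_pinfty _ _ xpredT i) ?leey//.
  by move=> n _; exact: H2_gauge_ge0.
pose V C i := if pselect (U i `&` C !=set0) then U i else set0.
have VC C : C `<=` A `|` B -> C `<=` \bigcup_i V C i.
  move=> CAB x Cx; have [i _ Uix] := ABU _ (CAB _ Cx); exists i => //.
  by rewrite /V; case: pselect => // -[]; exists x.
have gd i : mdiam d (U i) <= delta%:E.
  by move: nU => /forallNP/(_ i); rewrite /H2_gauge; case: ifP.
(* No sign is assumed on [delta]; it is nonnegative because it bounds the diameter of a member of
   the cover. *)
have g0 : H2_gauge d delta set0 <= 0.
  rewrite /H2_gauge mdiam0; case: ifPn => [_|/negP[]]; first by rewrite !mule0.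
  by apply: le_trans (gd 0%N); exact: mdiam_ge0.
apply: (@le_trans _ _ (\sum_(i <oo) H2_gauge d delta (V A i) + \sum_(i <oo) H2_gauge d delta (V B i))).
  apply: leeD; apply: ereal_inf_lbound.
    by exists (V A) => //; apply: VC => x; left.
  by exists (V B) => //; apply: VC => x; right.
rewrite -nneseriesD; try by move=> *; exact: H2_gauge_ge0.
apply: lee_nneseries => n _; first by move=> _; rewrite adde_ge0// H2_gauge_ge0.
rewrite /V; case: (pselect (U n `&` A !=set0)) => [[x [Ux Ax]]|?] /=;
  case: (pselect (U n `&` B !=set0)) => [[y [Uy By]]|?] /=.
- have := le_trans (mdiam_ub d Ux Uy) (gd n); rewrite lee_fin.
  by move=> /(le_trans (AB _ _ Ax By)); rewrite leNgt de.
- by rewrite -[leRHS]adde0 leeD.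
- by rewrite -[leRHS]add0e leeD.
- by apply: (@le_trans _ _ (0 + 0)); rewrite ?leeD// adde0 H2_gauge_ge0.
Qed.

(** [H2_delta] grows as the scale shrinks, so the scales of [A] and of [B] can be lowered to a
    common one below the separation. The two suprema are then taken one after the other, by
    subtraction of finite values. *)
Lemma H2_separated (A B : set T) : separated A B ->
  H2 d A + H2 d B <= H2 d (A `|` B).
Proof.
move=> [e e0 AB].
have key d1 d2 : (0 < d1)%R -> (0 < d2)%R ->
    H2_delta d d1 A + H2_delta d d2 B <= H2 d (A `|` B).
  move=> d10 d20; pose dl := Num.min (Num.min d1 d2) (e / 2)%R.
  have dl0 : (0 < dl)%R by rewrite !lt_min d10 d20 divr_gt0.
  have dle : (dl < e)%R by rewrite /dl gt_min; apply/orP; right; lra.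
  apply: le_trans (H2_delta_le _ _ dl0).
  apply: le_trans (H2_delta_separated dle AB).
  by apply: leeD; apply: H2_delta_anti; rewrite ge_min; apply/orP; left;
    rewrite ge_min lexx ?orbT.
have [->|fin] := eqVneq (H2 d (A `|` B)) +oo; first by rewrite leey.
have finR : H2 d (A `|` B) \is a fin_num by rewrite ge0_fin_numE ?H2_ge0// ltey.
have fA (C : set T) dl : C `<=` A `|` B -> (0 < dl)%R -> H2_delta d dl C \is a fin_num.
  move=> CAB dl0; rewrite ge0_fin_numE ?H2_delta_ge0//.
  apply: le_lt_trans (H2_delta_le _ _ dl0) _; apply: le_lt_trans (le_H2 d CAB) _.
  by rewrite ltey.
have step d2 : (0 < d2)%R -> H2 d A + H2_delta d d2 B <= H2 d (A `|` B).
  move=> d20; have fB : H2_delta d d2 B \is a fin_num by apply: fA => // x; right.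
  rewrite -leeBrDr//; apply: ge_ereal_sup => _ [d1 /= d10 <-].
  by rewrite leeBrDr// key.
have fHA : H2 d A \is a fin_num.
  rewrite ge0_fin_numE ?H2_ge0//; apply: (@le_lt_trans _ _ (H2 d (A `|` B))).
    by apply: le_H2 => x; left.
  by rewrite ltey.
rewrite addeC -leeBrDr//; apply: ge_ereal_sup => _ [d2 /= d20 <-].
by rewrite leeBrDr// addeC step.
Qed.

Section OpenSet.
Variable U : set T.
Hypothesis oU : mopen d U.

Let inner (n : nat) : set T := [set x | U x /\ forall y, ~ U y -> (n.+1%:R^-1 <= d x y)%R].

Let ler_inv (m n : nat) : (m <= n)%N -> ((n.+1%:R^-1 : R) <= m.+1%:R^-1)%R.
Proof. by move=> mn; rewrite lef_pV2 ?posrE// ler_nat. Qed.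

Let inner_sub m n : (m <= n)%N -> inner m `<=` inner n.
Proof.
move=> mn x [Ux h]; split => // y /h; apply: le_trans; exact: ler_inv.
Qed.

Let inner_cover x : U x -> exists n, inner n x.
Proof.
move=> Ux; have [r r0 rU] := oU Ux.
have [n _ nr] := near_infty_natSinv_lt (PosNum r0).
exists n; split => // y nUy; rewrite leNgt; apply/negP => lt.
apply: nUy; apply: rU; rewrite /mball/=; apply: (lt_trans lt).
exact: (nr n (leqnn n)).
Qed.

Let inner_separated n (A B : set T) : A `<=` inner n.+1 -> B `<=` U `\` inner n.+2 ->
  separated A B.
Proof.
move=> An Bn; exists (n.+2%:R^-1 - n.+3%:R^-1)%R.
  by rewrite subr_gt0 ltf_pV2 ?posrE// ltr_nat.
move=> x y /An[_ Ax] /Bn[Uy] /not_andP[//|/existsNP[z /not_implyP[nUz /negP]]].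
rewrite -ltNge => yz; have xz := Ax _ nUz; have xyz := d_tri x y z; 
move: (n.+2%:R^-1)%R (n.+3%:R^-1)%R yz xz xyz => p q *; lra.
Qed.

(* Rings whose indices differ by at least two are separated, so the ones of equal parity have summable measure. *)
Let ring n := inner n.+1 `\` inner n.

Let ring_sum (X : set T) (b : nat) N :
  \sum_(k < N) H2 d (X `&` ring (b + k.*2)) <= H2 d X.
Proof.
suff : \sum_(k < N) H2 d (X `&` ring (b + k.*2)) <=
    H2 d (X `&` \big[setU/set0]_(k < N) ring (b + k.*2)).
  by move=> /le_trans; apply; apply: le_H2 => x [].
elim: N => [|N IH]; first by rewrite !big_ord0 H2_ge0.
rewrite !big_ord_recr/= setIUr.
apply: (@le_trans _ _ (H2 d (X `&` \big[setU/set0]_(k < N) ring (b + k.*2)) +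
   H2 d (X `&` ring (b + N.*2)))); first by rewrite leeD2r.
apply: H2_separated; case: N {IH} => [|N].
  by exists 1%R => // x y; rewrite big_ord0 setI0.
apply: (@inner_separated (b + N.*2)).
  move=> x [_]; rewrite -(bigcup_mkord _ (fun k => ring (b + k.*2))) => -[k/= kN [h _]]; move: h.
  by apply: inner_sub; rewrite ltnS leq_add2l leq_double.
move=> x [_ [[Ux _] h]]; split => //.
by move: h; rewrite doubleS !addnS.
Qed.

Let ring_series (X : set T) : H2 d X < +oo -> \sum_(k <oo) H2 d (X `&` ring k) < +oo.
Proof.
move=> Xoo; apply: (@le_lt_trans _ _ (H2 d X + H2 d X)); last by rewrite lte_add_pinfty.
apply: lime_le; first by apply: is_cvg_nneseries => n _ _; exact: H2_ge0.
apply: nearW => n; rewrite /= big_mkord.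
have le2 : \sum_(i < n) H2 d (X `&` ring i) <= \sum_(i < n.*2) H2 d (X `&` ring i).
  rewrite -addnn big_split_ord/= leeDl// sume_ge0// => i _; exact: H2_ge0.
apply: (le_trans le2).
have -> : \sum_(i < n.*2) H2 d (X `&` ring i) =
    \sum_(k < n) H2 d (X `&` ring (0 + k.*2)) + \sum_(k < n) H2 d (X `&` ring (1 + k.*2)).
  elim: n {le2} => [|n IH]; first by rewrite !big_ord0 adde0.
  by rewrite doubleS !big_ord_recr/= IH add0n add1n addeACA -!addeA.
by apply: leeD; exact: ring_sum.
Qed.

(** The part of [X] in [U] exceeds its part in [inner n] by at most the tail of a convergent series
    of rings, and [inner n] lies at distance at least [1 / (n + 1)] from the complement of [U],
    where [H2_separated] applies. *)
Lemma mopen_caratheodory : (H2 d).-caratheodory U.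
Proof.
apply: le_caratheodory_measurable => X.
change (H2 d (X `&` U) + H2 d (X `&` ~` U) <= H2 d X).
have [->|Xfin] := eqVneq (H2 d X) +oo; first by rewrite leey.
have Xoo : H2 d X < +oo by rewrite ltey.
apply/lee_addgt0Pr => e e0.
have /fine_cvgP[_ /cvgrPdist_lt] := nneseries_tail_cvg (P := xpredT) (ring_series Xoo)
   (fun n _ => H2_ge0 d (X `&` ring n)).
move=> /(_ _ e0)[n _ /(_ n (leqnn n))/=]; rewrite sub0r normrN => tl.
have tlf : \sum_(n <= k <oo) H2 d (X `&` ring k) \is a fin_num.
  rewrite ge0_fin_numE; last by apply: nneseries_ge0 => *; exact: H2_ge0.
  apply: le_lt_trans (ring_series Xoo).
  rewrite (nneseries_split 0 n); last by move=> k _; exact: H2_ge0.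
  by rewrite add0n leeDr// sume_ge0// => i _; exact: H2_ge0.
have tle : \sum_(n <= k <oo) H2 d (X `&` ring k) <= e%:E.
  rewrite -(fineK tlf) lee_fin; apply: ltW; apply: le_lt_trans tl; exact: ler_norm.
have XU : H2 d (X `&` U) <= H2 d (X `&` inner n) + \sum_(n <= k <oo) H2 d (X `&` ring k).
  have sub : X `&` U `<=` (X `&` inner n) `|` \bigcup_k (X `&` ring (n + k)).
    move=> x [Xx Ux]; have [xn|xn] := pselect (inner n x); first by left.
    right; have [m xm] := inner_cover Ux.
    have nm : (n <= m)%N.
      by rewrite leqNgt; apply/negP => /ltnW/inner_sub/(_ _ xm).
    move: xm; rewrite -(subnKC nm); elim: (m - n)%N => [|k IH]; first by rewrite addn0.
    rewrite addnS => xk.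
    have [/IH//|xk'] := pselect (inner (n + k) x).
    by exists k.
  apply: (le_trans (le_H2 d sub)); apply: (le_trans (outer_measureU2 _ _ _)).
  apply: leeD => //.
  apply: (le_trans (H2_sigma_subadditive _ _)).
  rewrite -nneseries_addn; last by move=> k; exact: H2_ge0.
  by apply: lee_nneseries => k _; [move=> _; exact: H2_ge0|rewrite addnC].
apply: (@le_trans _ _ (H2 d (X `&` inner n) + H2 d (X `&` ~` U) + e%:E)).
  rewrite -addeA [H2 d (X `&` ~` U) + _]addeC addeA leeD2r//.
  by apply: (le_trans XU); rewrite leeD2l.
rewrite leeD2r//; apply: (le_trans (H2_separated _)).
  exists n.+1%:R^-1%R; first by rewrite invr_gt0.
  by move=> x y [_ [_ h]] [_ /h].
by apply: le_H2 => x [[]|[]].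
Qed.

End OpenSet.

Lemma mborel_caratheodory (A : set T) : mborel d A -> (H2 d).-caratheodory A.
Proof.
move=> /(_ (H2 d).-caratheodory); apply; last exact: mopen_caratheodory.
split; first exact: caratheodory_measurable_set0.
  by move=> B mB; rewrite setTD; exact: caratheodory_measurable_setC.
by move=> F mF; exact: caratheodory_measurable_bigcup.
Qed.

(** [X] is arbitrary: in the energy estimate it is a dyadic annulus, and [E] is the family of sets
    underlying a simple function. *)
Lemma H2_mborel_superadditive (n : nat) (E : nat -> set T) (X : set T) :
  (forall i, (i < n)%N -> mborel d (E i)) ->
  (forall i j, (i < n)%N -> (j < n)%N -> i <> j -> E i `&` E j = set0) ->
  \sum_(i < n) H2 d (X `&` E i) <= H2 d X.
Proof.
move=> mE tE; pose F i := if (i < n)%N then E i else set0.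
have -> : \sum_(i < n) H2 d (X `&` E i) = \sum_(i < n) H2 d (X `&` F i).
  by apply: eq_bigr => i _; rewrite /F ltn_ord.
have mF i : (H2 d).-caratheodory (F i).
  rewrite /F; case: ifPn => [/mE|_]; first exact: mborel_caratheodory.
  exact: caratheodory_measurable_set0.
rewrite -caratheodory_additive//; first by apply: le_H2 => x [].
apply/trivIsetP => i j _ _ /eqP ij; rewrite /F; case: ifPn => [im|_]; last by rewrite set0I.
by case: ifPn => [jm|_]; [exact: tE|rewrite setI0].
Qed.

End MetricOuterMeasure.

(** * Curves and the modulus of thick annuli *)

(* Monotonicity needs no measurability: the integral of a nonnegative function is a supremum over simple functions. *)
Lemma ge0_le_integral_nomeas (disp : measure_display) (T : measurableType disp) (R : realType)
    (mu : {measure set T -> \bar R}) (D : set T) (f g : T -> \bar R) :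
  (forall x, D x -> (0 <= f x)%E) -> (forall x, D x -> (f x <= g x)%E) ->
  (\int[mu]_(x in D) f x <= \int[mu]_(x in D) g x)%E.
Proof.
move=> f0 fg; rewrite !ge0_integralE//; last by move=> x Dx; exact: le_trans (f0 _ Dx) (fg _ Dx).
apply: ereal_sup_le => _ [h /= hf <-]; exists h => // x; apply: (le_trans (hf x)).
by rewrite /patch; case: ifPn => // /set_mem; exact: fg.
Qed.

(** * Length and arc-length parametrization *)

Section CurveLength.
Context {R : realType} {T : Type}.
Variable d : T -> T -> R.
Hypothesis hd : is_metric d.

Let d_ge0 x y : 0 <= d x y. Proof. by case: hd. Qed.
Let d_xx x : d x x = 0. Proof. by case: hd => _ [/(_ x x)[_ ->]]. Qed.
Let d_sym x y : d x y = d y x. Proof. by case: hd => _ [_ []]. Qed.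
Let d_tri x y z : d x z <= d x y + d y z. Proof. by case: hd => _ [_ []]. Qed.

Definition continuous_on (g : R -> T) (a b : R) :=
  forall t, a <= t <= b -> forall e, 0 < e -> exists2 del, 0 < del &
    forall s, a <= s <= b -> `|s - t| < del -> d (g t) (g s) < e.

Lemma is_curve_continuous_on (g : curve R T) a b :
  is_curve d g -> a \in cdom g -> b \in cdom g -> continuous_on (cmap g) a b.
Proof.
move=> [_ gc] ag bg t tab e e0.
have sub s : a <= s <= b -> s \in cdom g.
  by move=> sab; exact: (interval_is_interval ag bg sab).
have [del del0 h] := gc t (sub _ tab) e e0.
by exists del => // s sab; apply: h; exact: sub.
Qed.

Lemma clength_ge_dist (g : R -> T) a b : a <= b -> ((d (g a) (g b))%:E <= clength d g a b)%E.
Proof.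
move=> ab; apply: ereal_sup_ubound; exists 1%N, (fun i => if i is 0%N then a else b).
by split => //; [case|rewrite big_ord_recl big_ord0 addr0].
Qed.

Lemma clength_ge0 (g : R -> T) a b : a <= b -> (0 <= clength d g a b)%E.
Proof. by move=> ab; apply: le_trans (clength_ge_dist g ab); rewrite lee_fin. Qed.

Lemma clength_superadd (g : R -> T) a p q : p <= q ->
  (clength d g a p + (d (g p) (g q))%:E <= clength d g a q)%E.
Proof.
move=> pq; rewrite -leeBrDr//; apply: ge_ereal_sup => _ [n [tt [t0 tn tm ->]]].
rewrite leeBrDr//; apply: ereal_sup_ubound.
exists n.+1, (fun i => if (i <= n)%N then tt i else q); split => //.
- by rewrite ltnn.
- move=> i; rewrite ltnS => iln; rewrite iln; case: ltnP => [|ni]; first exact: tm.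
  by have -> : i = n by [apply/eqP; rewrite eqn_leq iln]; rewrite tn.
- rewrite big_ord_recr/= leqnn ltnn tn EFinD; congr (_%:E + _)%E.
  by apply: eq_bigr => i _; rewrite (ltnW (ltn_ord i)) ltn_ord.
Qed.

Section ArclengthParam.
Variables (g : R -> T) (a b : R).
Hypothesis ab : a <= b.
Hypothesis gc : continuous_on g a b.
Hypothesis fin_len : (clength d g a b < +oo)%E.

Let ell := fine (clength d g a b).
Let S sigma := [set t | a <= t <= b /\ (sigma%:E <= clength d g a t)%E].

Let lenE : clength d g a b = ell%:E.
Proof. by rewrite fineK// ge0_fin_numE// clength_ge0. Qed.

Lemma fine_clength_ge0 : 0 <= fine (clength d g a b).
Proof. by rewrite fine_ge0// clength_ge0. Qed.

Let Sb sigma : sigma <= ell -> S sigma b.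
Proof. by move=> sl; split; [rewrite ab lexx|rewrite lenE lee_fin]. Qed.

Let S_lb sigma : has_lbound (S sigma).
Proof. by exists a => t [/andP[]]. Qed.

Let S_inf sigma : sigma <= ell -> has_inf (S sigma).
Proof. by move=> /Sb Sb'; split => //; exists b. Qed.

Let infS_in sigma : sigma <= ell -> a <= inf (S sigma) <= b.
Proof.
move=> sl; apply/andP; split.
  by apply: lb_le_inf; [exists b; exact: Sb|move=> t [/andP[]]].
by apply: ge_inf => //; exact: Sb.
Qed.

Let approx_right sigma e t' : sigma <= ell -> 0 < e -> inf (S sigma) < t' ->
  exists t, [/\ S sigma t, t < t' & d (g (inf (S sigma))) (g t) < e].
Proof.
move=> sl e0 st.
have [del del0 hdel] := gc (infS_in sl) e0.
have m0 : 0 < Num.min del (t' - inf (S sigma)) by rewrite lt_min del0 subr_gt0.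
have [t St] := inf_adherent m0 (S_inf sl).
rewrite -ltrBlDl lt_min => /andP[t1 t2]; exists t; split => //.
  by rewrite ltrD2r in t2.
apply: hdel; first by case: St.
by rewrite ger0_norm ?subr_ge0 ?ge_inf.
Qed.

(** Take [t] just after the first time of length [s1] and [w] just before that of length [s2]. The
    length up to [t] is at least [s1] and up to [w] less than [s2], so superadditivity bounds
    [d (g t) (g w)] by [s2 - s1]; continuity of [g] closes both gaps. *)
Lemma arclength_param_lipschitz (s1 s2 : R) : s1 <= s2 -> s2 <= ell ->
  d (arclength_param d g a b s1) (arclength_param d g a b s2) <= s2 - s1.
Proof.
move=> s12 s2l; have s1l := le_trans s12 s2l.
rewrite /arclength_param -/(S s1) -/(S s2).
have le12 : inf (S s1) <= inf (S s2).
  apply: lb_le_inf; first by exists b; exact: Sb.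
  move=> t [tab st]; apply: ge_inf => //; split => //.
  by apply: le_trans st; rewrite lee_fin.
have [->|ne12] := eqVneq (inf (S s1)) (inf (S s2)); first by rewrite d_xx subr_ge0.
have lt12 : inf (S s1) < inf (S s2) by rewrite lt_neqAle ne12.
apply/ler_addgt0Pr => e e0.
have e20 : 0 < e / 2 by rewrite divr_gt0.
have [t [St tlt dt]] := approx_right s1l e20 lt12.
have [del del0 hdel] := gc (infS_in s2l) e20.
pose m := Num.max t (inf (S s2) - del / 2).
have mlt : m < inf (S s2).
  by rewrite /m gt_max tlt/=; lra.
pose w := (m + inf (S s2)) / 2.
have wlt : w < inf (S s2) by rewrite /w; lra.
have tw : t <= w.
  have : t <= m by rewrite /m le_max lexx.
  rewrite /w; lra.
have wdel : inf (S s2) - del / 2 <= w.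
  have : inf (S s2) - del / 2 <= m by rewrite /m le_max lexx orbT.
  rewrite /w; lra.
have /andP[i2a i2b] := infS_in s2l.
have wab : a <= w <= b.
  rewrite (le_trans _ tw) ?(le_trans (ltW wlt))//.
  by case: St => /andP[].
have dw : d (g (inf (S s2))) (g w) < e / 2.
  by apply: hdel => //; rewrite ltr_norml; apply/andP; split; lra.
have lw : (clength d g a w < s2%:E)%E.
  rewrite ltNge; apply/negP => h.
  have : inf (S s2) <= w by apply: ge_inf.
  by rewrite leNgt wlt.
have h1 := clength_superadd g a tw.
have h2 : (s1%:E + (d (g t) (g w))%:E < s2%:E)%E.
  apply: le_lt_trans lw; apply: le_trans h1; rewrite leeD2r//.
  by case: St.
rewrite -EFinD lte_fin in h2.
have := d_tri (g (inf (S s1))) (g t) (g (inf (S s2))).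
have := d_tri (g t) (g w) (g (inf (S s2))).
rewrite (d_sym (g w)).
lra.
Qed.

Lemma arclength_param0 : arclength_param d g a b 0 = g a.
Proof.
rewrite /arclength_param -/(S 0); congr g; apply/eqP; rewrite eq_le; apply/andP; split.
  by apply: ge_inf => //; split; [rewrite lexx|rewrite clength_ge0].
by have /andP[] := infS_in fine_clength_ge0.
Qed.

(** The infimum can be smaller than [b] when [g] is constant on a final interval: once the whole
    length is spent, [g] no longer moves. *)
Lemma arclength_param_end : d (arclength_param d g a b ell) (g b) = 0.
Proof.
apply/eqP; rewrite eq_le d_ge0 andbT; apply/ler_addgt0Pr => e e0; rewrite add0r.
rewrite /arclength_param -/(S ell).
have [ib|ib] := eqVneq (inf (S ell)) b; first by rewrite ib d_xx ltW.
have lt : inf (S ell) < b.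
  by rewrite lt_neqAle ib; have /andP[] := infS_in (lexx ell).
have [t [St tlt dt]] := approx_right (lexx _) e0 lt.
have := clength_superadd g a (ltW tlt).
rewrite lenE => h.
have : (ell%:E + (d (g t) (g b))%:E <= ell%:E)%E.
  by apply: le_trans h; rewrite leeD2r//; case: St.
rewrite -EFinD lee_fin.
have := d_tri (g (inf (S ell))) (g t) (g b).
lra.
Qed.

End ArclengthParam.

End CurveLength.

(* [s2] is the first time at which [f] reaches [be], and [s1] the last time before [s2] with [f <= al]. *)
Lemma lipschitz_crossing (R : realType) (f : R -> R) (ell al be : R) :
  0 <= ell -> al < be ->
  (forall s t, 0 <= s -> s <= t -> t <= ell -> `|f t - f s| <= t - s) ->
  f 0 <= al -> be <= f ell ->
  exists s1 s2, [/\ 0 <= s1, s2 <= ell, s1 <= s2, be - al <= s2 - s1 &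
    forall s, s1 < s < s2 -> al <= f s < be].
Proof.
move=> l0 albe lip f0 fl.
pose A := [set s | 0 <= s <= ell /\ be <= f s].
have Al : A ell by split => //; rewrite l0 lexx.
have lbA : has_lbound A by exists 0 => s [/andP[]].
pose s2 := inf A.
have s20 : 0 <= s2 by apply: lb_le_inf; [exists ell|move=> s [/andP[]]].
have s2l : s2 <= ell by apply: ge_inf.
have fs2 : be <= f s2.
  apply/ler_addgt0Pr => e e0.
  have [s [/andP[s0' sl] fs] slt] := inf_adherent e0 (conj (ex_intro _ _ Al) lbA).
  have s2s : s2 <= s by apply: ge_inf => //; split => //; rewrite s0' sl.
  have := lip _ _ s20 s2s sl; rewrite ler_norml => /andP[_].
  rewrite -/s2 in slt; lra.
pose B := [set s | 0 <= s <= s2 /\ f s <= al].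
have B0 : B 0 by split => //; rewrite lexx.
have ubB : has_ubound B by exists s2 => s [/andP[]].
pose s1 := sup B.
have s10 : 0 <= s1 by apply: ub_le_sup.
have s12 : s1 <= s2 by apply: ge_sup; [exists 0|move=> s [/andP[]]].
have fs1 : f s1 <= al.
  apply/ler_addgt0Pr => e e0.
  have [s [/andP[s0' sl] fs] slt] := sup_adherent e0 (conj (ex_intro _ _ B0) ubB).
  have ss1 : s <= s1 by apply: ub_le_sup => //; split => //; rewrite s0' sl.
  have := lip _ _ s0' ss1 (le_trans s12 s2l); rewrite ler_norml => /andP[_].
  rewrite -/s1 in slt; lra.
exists s1, s2; split => //.
  have := lip _ _ s10 s12 s2l; rewrite ler_norml => /andP[_]; lra.
move=> s /andP[s1s ss2]; apply/andP; split; [rewrite leNgt|rewrite ltNge]; apply/negP.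
  move=> fs; have : s <= s1 by apply: ub_le_sup => //; split; [apply/andP; split|]; lra.
  by rewrite leNgt s1s.
move=> fs; suff : s2 <= s by rewrite leNgt ss2.
by apply: ge_inf => //; split; [apply/andP; split; lra|].
Qed.

Lemma lipschitz_crossing_sym (R : realType) (f : R -> R) (ell al be : R) :
  0 <= ell -> al < be ->
  (forall s t, 0 <= s -> s <= t -> t <= ell -> `|f t - f s| <= t - s) ->
  (f 0 <= al /\ be <= f ell) \/ (f ell <= al /\ be <= f 0) ->
  exists s1 s2, [/\ 0 <= s1, s2 <= ell, s1 <= s2, be - al <= s2 - s1 &
    forall s, s1 < s < s2 -> al <= f s < be].
Proof.
move=> l0 ab lip [[f0 fl]|[fl f0]]; first exact: lipschitz_crossing.
have lip' s t : 0 <= s -> s <= t -> t <= ell ->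
    `|(f \o (fun x => ell - x)) t - (f \o (fun x => ell - x)) s| <= t - s.
  move=> s0 st tl /=; rewrite distrC; apply: le_trans (lip (ell - t) (ell - s) _ _ _) _; lra.
have [||s1 [s2 [h1 h2 h3 h4 h5]]] := lipschitz_crossing l0 ab lip'.
- by rewrite /= subr0.
- by rewrite /= subrr.
exists (ell - s2), (ell - s1); split; try lra.
move=> s hs; have := h5 (ell - s); rewrite /= opprB addrCA subrr addr0; apply.
by apply/andP; split; lra.
Qed.

(** * Borel sets of a metric space *)

Section BorelFunctions.
Context {R : realType} {T : Type}.
Variable d : T -> T -> R.

Lemma mborel_sigma_algebra : sigma_algebra setT (mborel d).
Proof.
split.
- by move=> S [].
- by move=> A mA S sS oS; case: (sS) => _ + _; apply; exact: mA.
- by move=> F mF S sS oS; case: (sS) => _ _; apply => n; exact: mF.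
Qed.

Lemma mborelC A : mborel d A -> mborel d (~` A).
Proof. by rewrite -setTD; case: mborel_sigma_algebra => _ + _; apply. Qed.

Lemma mborel_bigcup F : (forall n : nat, mborel d (F n)) -> mborel d (\bigcup_n F n).
Proof. by case: mborel_sigma_algebra => _ _; apply. Qed.

Lemma mborelI A B : mborel d A -> mborel d B -> mborel d (A `&` B).
Proof.
move=> mA mB; rewrite -(setCK A) -(setCK B) -setCU -bigcup2E.
apply: mborelC; apply: mborel_bigcup => -[|[|n]]/=; [exact: mborelC|exact: mborelC|by case: mborel_sigma_algebra].
Qed.

Lemma mopen_mborel A : mopen d A -> mborel d A.
Proof. by move=> oA S _; apply. Qed.

Lemma mborel_preimage (f : T -> R) (C : set R) :
  (forall c, mopen d [set x | f x < c]) -> (forall c, mopen d [set x | c < f x]) ->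
  measurable C -> mborel d (f @^-1` C).
Proof.
move=> ol og mC.
pose M := [set C : set R | mborel d (f @^-1` C)].
suff : M C by [].
apply: (smallest_sub _ _ mC).
  split.
  - by rewrite /M/= preimage_set0; case: mborel_sigma_algebra.
  - by move=> A MA; rewrite /M/= setTD preimage_setC; exact: mborelC.
  - by move=> F MF; rewrite /M/= preimage_bigcup; exact: mborel_bigcup.
move=> _ [[a b] /= _ <-]; rewrite /M/=.
have -> : f @^-1` `]a, b] = [set x | a < f x] `&` ~` [set x | b < f x].
  apply/seteqP; split => x /=; rewrite in_itv/=.
    by move=> /andP[ax xb]; split => //; apply/negP; rewrite -leNgt.
  by move=> [ax /negP]; rewrite -leNgt ax.
by apply: mborelI; [exact: mopen_mborel|by apply: mborelC; exact: mopen_mborel].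
Qed.

End BorelFunctions.

(** * Energy of a test function on dyadic annuli *)

Section ModulusUpperBound.
Context {R : realType} {T : Type}.
Variable d : T -> T -> R.
Hypothesis hd : is_metric d.

Let d_ge0 x y : 0 <= d x y. Proof. by case: hd. Qed.
Let d_sym x y : d x y = d y x. Proof. by case: hd => _ [_ []]. Qed.
Let d_tri x y z : d x z <= d x y + d y z. Proof. by case: hd => _ [_ []]. Qed.

Lemma dist_lipschitz x y z : `|d x y - d x z| <= d y z.
Proof.
have := d_tri x y z; have := d_tri x z y; rewrite (d_sym z y) ler_norml => h1 h2.
by apply/andP; split; lra.
Qed.

Lemma mopen_dist_lt x c : mopen d [set y | d x y < c].
Proof.
move=> y /= yc; exists (c - d x y); first by rewrite subr_gt0.
by move=> z; rewrite /mball/= => yz; have := d_tri x y z; lra.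
Qed.

Lemma mopen_dist_gt x c : mopen d [set y | c < d x y].
Proof.
move=> y /= yc; exists (d x y - c); first by rewrite subr_gt0.
by move=> z; rewrite /mball/= => yz; have := d_tri x z y; rewrite (d_sym z y); lra.
Qed.

Lemma H2_bigsetU n (F : nat -> set T) :
  (H2 d (\big[setU/set0]_(k < n) F k) <= \sum_(k < n) H2 d (F k))%E.
Proof.
elim: n => [|n IH]; first by rewrite !big_ord0 H2_set0.
rewrite !big_ord_recr/=; apply: (le_trans (outer_measureU2 _ _ _)).
by apply: leeD.
Qed.

Variables (L : R) (x0 : T) (r : R) (n : nat).
Hypothesis r0 : 0 < r.
Hypothesis n0 : (0 < n)%N.
Hypothesis hball : forall k : nat,
  (H2 d (mball d x0 (2 ^+ k * r)) <= (L * (2 ^+ k * r) ^+ 2)%:E)%E.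

(** [rho] equals [c k] on the [k]-th annulus, a step version of [1 / (n * d x0 y)]. Crossing that
    annulus contributes at least [2 ^ k * r * c k = 1 / n] to the line integral, and its energy is
    at most [c k ^ 2 * L * (2 ^ (k + 1) * r) ^ 2 = 4 * L / n ^ 2]. The sums over [n] annuli are [1]
    and [4 * L / n]. *)
Let c (k : nat) : R := (n%:R * (2 ^+ k * r))^-1.
Let J (k : nat) : set R := [set` `[2 ^+ k * r, 2 ^+ k.+1 * r[].
Let A (k : nat) : set T := d x0 @^-1` J k.
Let phi (t : R) : R := \sum_(k < n) c k * \1_(J k) t.
Let rho (y : T) : \bar R := (phi (d x0 y))%:E.

Let rk0 k : 0 < 2 ^+ k * r. Proof. by rewrite mulr_gt0// exprn_gt0. Qed.
Let nR0 : 0 < n%:R :> R. Proof. by rewrite ltr0n. Qed.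
Let c0 k : 0 < c k. Proof. by rewrite invr_gt0 mulr_gt0. Qed.

Let le_rk k l : (k <= l)%N -> 2 ^+ k * r <= 2 ^+ l * r.
Proof. by move=> kl; rewrite ler_pM2r// ler_weXn2l// ler1n. Qed.

Let rho_in k y : (k < n)%N -> A k y -> rho y = (c k)%:E.
Proof.
move=> kn Ay; rewrite /rho /phi (bigD1 (Ordinal kn))//= indicE mem_set// mulr1.
rewrite big1 ?addr0// => -[j jn] /= /eqP jk; rewrite indicE memNset ?mulr0// => Aj.
move: Ay Aj; rewrite /A /J/= !in_itv/= => /andP[h1 h2] /andP[h3 h4].
have [kj|jk'|kj] := ltngtP k j; last by apply: jk; apply/val_inj.
  by have := le_rk kj; lra.
by have := le_rk jk'; lra.
Qed.

Let rho_out y : (forall k, (k < n)%N -> ~ A k y) -> rho y = 0%E.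
Proof.
by move=> h; rewrite /rho /phi big1// => -[k kn] _ /=; rewrite indicE memNset ?mulr0//; exact: h.
Qed.

Let rho_ge0 y : (0 <= rho y)%E.
Proof. by rewrite lee_fin sumr_ge0// => k _; rewrite mulr_ge0// ltW. Qed.

Let rho_borel : mborel_fun d rho.
Proof.
move=> B mB.
have mphi : measurable_fun setT (EFin \o phi).
  apply/measurable_EFinP; apply: measurable_sum => k.
  by apply: measurable_funM; [exact: measurable_cst|by apply: measurable_indic; exact: measurable_itv].
have -> : rho @^-1` B = (d x0) @^-1` ((EFin \o phi) @^-1` B) by [].
apply: mborel_preimage; [exact: mopen_dist_lt|exact: mopen_dist_gt|].
by rewrite -[X in measurable X]setTI; exact: mphi.
Qed.

(** Each annulus provides one interval of length at least [2 ^ k * r] on which [f] stays in [J k];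
    the weighted indicators of these intervals lie below [phi (f s)] and can be integrated term by
    term. *)
Let crossing_integral (f : R -> R) (ell : R) : 0 <= ell ->
  (forall s t, 0 <= s -> s <= t -> t <= ell -> `|f t - f s| <= t - s) ->
  (f 0 <= r /\ 2 ^+ n * r <= f ell) \/ (f ell <= r /\ 2 ^+ n * r <= f 0) ->
  (1 <= \int[lebesgue_measure]_(s in [set s : R | (0 <= s <= ell)%R]) (phi (f s))%:E)%E.
Proof.
move=> l0 lip hf.
have /choice[I hI] : forall k, exists I : R * R, (k < n)%N ->
    [/\ 0 <= I.1, I.2 <= ell, I.1 <= I.2, 2 ^+ k * r <= I.2 - I.1 &
    forall s, I.1 < s < I.2 -> J k (f s)].
  move=> k; have [kn|nk] := pselect (k < n)%N; last by exists (0, 0).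
  have lek := le_rk (leq0n k); have lekn := le_rk kn; rewrite expr0 mul1r in lek.
  have dk : 2 ^+ k.+1 * r = 2 ^+ k * r + 2 ^+ k * r by rewrite exprS; ring.
  have [||s1 [s2 [h1 h2 h3 h4 h5]]] :=
    @lipschitz_crossing_sym _ f ell (2 ^+ k * r) (2 ^+ k.+1 * r) l0 _ lip.
  - by rewrite dk ltrDl.
  - by case: hf => -[h1 h2]; [left|right]; split; lra.
  exists (s1, s2) => _; split => //=; lra.
pose D := [set s : R | 0 <= s <= ell].
have DE : D = [set` `[0, ell]] by apply/seteqP; split => s; rewrite /D/= in_itv.
have mD : measurable D by rewrite DE.
pose h k (s : R) := ((c k)%:E * (\1_([set` `]((I k).1), ((I k).2)[]) s)%:E)%E.
apply: (@le_trans _ _ (\int[lebesgue_measure]_(s in D) (\sum_(k < n) h k s)%E)%E).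
  rewrite ge0_integral_sum//; last 2 first.
  - move=> k; apply: emeasurable_funM; first exact: measurable_cst.
    by apply/measurable_EFinP; by apply: measurable_indic; exact: measurable_itv.
  - by move=> k s _; rewrite /h mule_ge0// lee_fin// ltW.
  apply: (@le_trans _ _ (\sum_(k < n) (n%:R^-1)%:E)%E).
    rewrite sumEFin lee_fin big_const_ord iter_addr_0 -[leRHS]mulr_natr mulVf//.
    by rewrite gt_eqF.
  apply: lee_sum => k _; have [h1 h2 h3 h4 h5] := hI _ (ltn_ord k).
  rewrite /h ge0_integralZl//; last 2 first.
  - by apply/measurable_EFinP; by apply: measurable_indic; exact: measurable_itv.
  - by rewrite lee_fin ltW.
  rewrite integral_indic//.
  have -> : [set` `]((I k).1), ((I k).2)[] `&` D = [set` `]((I k).1), ((I k).2)[].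
    apply/setIidPl => s; rewrite /D/= in_itv/= => /andP[k1 k2]; apply/andP; split; lra.
  rewrite /= lebesgue_measure_itv/= lte_fin; have rk := rk0 k.
  have -> : (I k).1 < (I k).2 by lra.
  rewrite -EFinD -EFinM lee_fin /c (invfM n%:R) -mulrA ler_peMr ?invr_ge0 ?ler0n//.
  by rewrite [leRHS]mulrC ler_pdivlMr// mul1r.
apply: ge0_le_integral_nomeas => s _.
  by apply: sume_ge0 => k _; rewrite /h mule_ge0// lee_fin// ltW.
rewrite /h /phi -sumEFin; apply: lee_sum => k _.
rewrite EFinM lee_pmul2l ?fin_numE// ?lte_fin// lee_fin !indicE.
case: (boolP (s \in [set` _])) => [/set_mem/=|//]; rewrite in_itv/= => sI.
by rewrite mem_set//; have [_ _ _ _] := hI _ (ltn_ord k); apply.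
Qed.

Let line_int_ge1 (g : curve R T) (p q : R) : is_curve d g -> locally_rectifiable d g ->
  p \in cdom g -> q \in cdom g -> d x0 (cmap g p) < r -> 2 ^+ n * r <= d x0 (cmap g q) ->
  (1 <= line_int d rho g)%E.
Proof.
move=> cg lg pg qg dp dq.
suff [a [b [ab ag bg hab]]] : exists a b, [/\ a <= b, a \in cdom g, b \in cdom g &
   (d x0 (cmap g a) <= r /\ 2 ^+ n * r <= d x0 (cmap g b)) \/
   (d x0 (cmap g b) <= r /\ 2 ^+ n * r <= d x0 (cmap g a))].
  apply: le_ereal_sup_tmp; exists (cline_int d rho (cmap g) a b); first by exists (a, b).
  have gc := is_curve_continuous_on cg ag bg.
  have fl := lg _ _ ab ag bg.
  rewrite /cline_int; apply: (@crossing_integral (fun s => d x0 (arclength_param d (cmap g) a b s))).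
  - exact: fine_clength_ge0.
  - move=> s t s0 st tl; apply: le_trans (dist_lipschitz _ _ _) _.
    by rewrite d_sym; exact: arclength_param_lipschitz.
  - have -> : d x0 (arclength_param d (cmap g) a b (fine (clength d (cmap g) a b))) = d x0 (cmap g b).
      apply/eqP; rewrite -subr_eq0 -normr_le0.
      by rewrite -(arclength_param_end hd ab gc fl); exact: dist_lipschitz.
    by rewrite arclength_param0.
have [pq|qp] := leP p q.
  by exists p, q; split => //; left; split => //; exact: ltW.
by exists q, p; split => //; [exact: ltW|right; split => //; exact: ltW].
Qed.

(** On a piece with a point outside all annuli the infimum vanishes. Any other piece is covered by
    its traces on the annuli, and each nonempty trace bounds the infimum by [c k ^ 2]. *)
Let piece_le (E : set T) :
  (ereal_inf ((fun x => rho x * rho x) @` E) * H2 d E <=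
   \sum_(k < n) ((c k ^+ 2)%:E * H2 d (A k `&` E)))%E.
Proof.
set v := ereal_inf _.
have rr0 y : (0 <= rho y * rho y)%E by rewrite mule_ge0.
have v0 : (0 <= v)%E by apply: le_ereal_inf_tmp => _ [y _ <-].
have [[y [Ey hy]]|/forallNP hE] := pselect (exists y, E y /\ forall k, (k < n)%N -> ~ A k y).
  have -> : v = 0%E.
    apply/eqP; rewrite eq_le v0 andbT; apply: ereal_inf_lbound; exists y => //.
    by rewrite rho_out// mule0.
  rewrite mul0e sume_ge0// => k _; rewrite mule_ge0 ?H2_ge0// lee_fin sqr_ge0//.
have EA : E `<=` \big[setU/set0]_(k < n) (A k `&` E).
  move=> y Ey; rewrite -(bigcup_mkord _ (fun k => A k `&` E)).
  have /not_andP[//|/existsNP[k /not_implyP[kn /contrapT Ak]]] := hE y.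
  by exists k.
apply: (@le_trans _ _ (v * \sum_(k < n) H2 d (A k `&` E))%E).
  rewrite lee_pmul ?H2_ge0//; apply: le_trans (le_H2 d EA) _.
  exact: (H2_bigsetU n (fun k => A k `&` E)).
rewrite ge0_sume_distrr; last by move=> k _; exact: H2_ge0.
apply: lee_sum => k _.
have [[y [Ay Ey]]|/nonemptyPn ->] := pselect (A k `&` E !=set0); last first.
  by rewrite H2_set0 !mule0.
rewrite lee_pmul ?H2_ge0//; apply: ereal_inf_lbound; exists y => //.
by rewrite (rho_in (ltn_ord k) Ay) -EFinM expr2.
Qed.

Let int_rho2_le : (int_H2 d (fun x => rho x * rho x) <= (4 * L / n%:R)%:E)%E.
Proof.
apply: ge_ereal_sup => _ [m [E [mE tE ->]]].
apply: (@le_trans _ _ (\sum_(i < m) \sum_(k < n) ((c k ^+ 2)%:E * H2 d (A k `&` E i)))%E).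
  by apply: lee_sum => i _; exact: piece_le.
rewrite exchange_big/=.
apply: (@le_trans _ _ (\sum_(k < n) (4 * L / n%:R ^+ 2)%:E)%E); last first.
  rewrite sumEFin lee_fin big_const_ord iter_addr_0 -[leLHS]mulr_natr.
  by rewrite expr2 invfM -!mulrA mulVf ?mulr1// gt_eqF.
apply: lee_sum => k _; rewrite -ge0_sume_distrr; last by move=> i _; exact: H2_ge0.
apply: (@le_trans _ _ ((c k ^+ 2)%:E * (L * (2 ^+ k.+1 * r) ^+ 2)%:E)%E).
  rewrite lee_pmul2l ?fin_numE// ?lte_fin ?exprn_gt0//.
  apply: le_trans (H2_mborel_superadditive d_tri (A k) mE tE) _.
  apply: le_trans (hball k.+1); apply: le_H2 => y.
  by rewrite /A /J/= in_itv/= => /andP[].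
rewrite -EFinM lee_fin /c (exprS 2 k) le_eqVlt; apply/orP; left; apply/eqP.
have := rk0 k; move: (2 ^+ k) => w wr; field.
by rewrite !gt_eqF//=; move: wr; rewrite pmulr_lgt0.
Qed.

Lemma MOD_annulus_le (Gam : set (curve R T)) :
  (forall g, Gam g -> is_curve d g /\ exists p q, [/\ p \in cdom g, q \in cdom g,
     d x0 (cmap g p) < r & 2 ^+ n * r <= d x0 (cmap g q)]) ->
  (MOD d Gam <= (4 * L / n%:R)%:E)%E.
Proof.
move=> hG; apply: le_trans int_rho2_le; apply: ereal_inf_lbound; exists rho => //.
split => //; split => // g /hG[cg [p [q [pg qg dp dq]]]] lg.
exact: (line_int_ge1 cg lg pg qg dp dq).
Qed.

End ModulusUpperBound.

(** * Plane geometry *)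

Section Trigonometry.
Context {R : realType}.
Implicit Types a b c x y : R.

Lemma sin_mean_value x : 0 <= x -> exists2 c, 0 <= c <= x & sin x = cos c * x.
Proof.
move=> x0; have [|c] := @MVT_segment R sin cos 0 x x0 (fun y _ => is_derive_sin y).
- exact/continuous_subspaceT/continuous_sin.
- by rewrite in_itv/= => cx; rewrite sin0 !subr0 => ->; exists c.
Qed.

Lemma le_abs_sin x : `|sin x| <= `|x|.
Proof.
wlog x0 : x / 0 <= x => [hw|].
  have [|/ltW x0] := leP 0 x; first exact: hw.
  by rewrite -normrN -[leRHS]normrN -sinN; apply: hw; rewrite oppr_ge0.
have [c _ ->] := sin_mean_value x0; rewrite normrM ler_piMl//; exact: cos_max.
Qed.

Lemma ler_cos_0pi x y : 0 <= x -> x <= y -> y <= pi -> cos y <= cos x.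
Proof.
move=> x0 xy yp; have [->//|ne] := eqVneq x y.
apply/ltW; rewrite ltr_cos ?lt_neqAle ?ne// in_itv/=; apply/andP; split => //; lra.
Qed.

Lemma sin_ge_mul_cos x : 0 <= x <= pi -> cos x * x <= sin x.
Proof.
move=> /andP[x0 xp]; have [c /andP[c0 cx] ->] := sin_mean_value x0.
by rewrite ler_wpM2r// ler_cos_0pi.
Qed.

(** A weak Jordan inequality by halving the angle: [sin x = 2 sin (x / 2) cos (x / 2) >= x cos (x /
    2) ^ 2], and [2 cos (x / 2) ^ 2 = 1 + cos x >= 1] up to a right angle. *)
Lemma sin_ge_half x : 0 <= x <= pi / 2 -> x / 2 <= sin x.
Proof.
move=> /andP[x0 xp]; have p0 : 0 < pi :> R := pi_gt0 R.
have hx : x = (x / 2) *+ 2 by rewrite -mulr_natr divfK.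
have c0 : 0 <= cos (x / 2) by apply: cos_ge0_pihalf; apply/andP; split; lra.
have h1 : cos (x / 2) * (x / 2) <= sin (x / 2).
  by apply: sin_ge_mul_cos; apply/andP; split; lra.
have h2 : 1 <= cos (x / 2) ^+ 2 *+ 2.
  by rewrite -subr_ge0 -cos_mulr2n -hx; apply: cos_ge0_pihalf; apply/andP; split; lra.
rewrite [in leRHS]hx sin_mulr2n.
have h3 := ler_wpM2l c0 h1.
have h4 : 0 <= (cos (x / 2) ^+ 2 *+ 2 - 1) * (x / 2) by rewrite mulr_ge0//; lra.
suff gen (c s w : R) : c * (c * w) <= c * s -> 0 <= (c ^+ 2 *+ 2 - 1) * w -> w <= c * s *+ 2.
  exact: gen h3 h4.
by rewrite expr2 !mulr2n; nra.
Qed.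

(** Cosine decreases on [[0, pi]] and increases on [[pi, 2 pi]], so on an interval inside
    [[0, 2 pi]] it is largest at an endpoint. *)
Lemma cos_arc_le a b c : 0 <= a -> a <= b -> b <= c -> c <= pi *+ 2 ->
  cos b <= Num.max (cos a) (cos c).
Proof.
move=> a0 ab bc c2; rewrite le_max; rewrite mulr2n in c2.
have [bp|pb] := leP b pi; first by rewrite ler_cos_0pi.
have e t : cos (pi *+ 2 - t) = cos t :> R.
  by rewrite cosB cos2pi sin2pi mul1r mul0r addr0.
apply/orP; right; rewrite -(e b) -(e c) mulr2n; apply: ler_cos_0pi; lra.
Qed.

Lemma polar_angle a b : a ^+ 2 + b ^+ 2 = 1 ->
  exists2 t, 0 <= t <= pi *+ 2 & cos t = a /\ sin t = b.
Proof.
move=> ab1; have p0 : 0 < pi :> R := pi_gt0 R.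
have a1 : -1 <= a <= 1.
  by rewrite -ler_norml -(@expr_le1 _ 2)// real_normK ?num_real//; nra.
have [/andP[t0 tp] ct] := acos_def a1.
have st : sin (acos a) = `|b|.
  by rewrite sin_acos// -sqrtr_sqr; congr Num.sqrt; lra.
rewrite mulr2n; have [b0|b0] := leP 0 b.
  by exists (acos a); [apply/andP; split; lra|rewrite ct st ger0_norm].
exists (pi *+ 2 - acos a); first by rewrite mulr2n; apply/andP; split; lra.
rewrite cosB sinB cos2pi sin2pi ct st ltr0_norm//; split; lra.
Qed.

End Trigonometry.

(** * Euclidean distance in the plane *)

Section PlaneNorm.
Context {R : realType}.
Implicit Types p q z v : R * R.

Definition sqn p : R := p.1 ^+ 2 + p.2 ^+ 2.
Definition edist p q : R := Num.sqrt (sqn (p - q)).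

Lemma sqn_ge0 p : 0 <= sqn p. Proof. by rewrite addr_ge0// sqr_ge0. Qed.

Lemma edist_ge0 p q : 0 <= edist p q. Proof. exact: sqrtr_ge0. Qed.

Lemma sqr_edist p q : edist p q ^+ 2 = sqn (p - q).
Proof. by rewrite sqr_sqrtr// sqn_ge0. Qed.

Lemma edist_le p q r : 0 <= r -> (edist p q <= r) = (sqn (p - q) <= r ^+ 2).
Proof. by move=> r0; rewrite -sqr_edist ler_sqr ?nnegrE ?edist_ge0. Qed.

Lemma edist_eq p q r : 0 <= r -> sqn (p - q) = r ^+ 2 -> edist p q = r.
Proof. by move=> r0; rewrite /edist => ->; rewrite sqrtr_sqr ger0_norm. Qed.

Lemma sqnN p : sqn (- p) = sqn p. Proof. by rewrite /sqn/= !sqrrN. Qed.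

Lemma edistC p q : edist p q = edist q p.
Proof. by rewrite /edist -sqnN opprB. Qed.

Lemma edist_eq0 p q : edist p q = 0 -> p = q.
Proof.
move=> h; have : sqn (p - q) = 0 by rewrite -sqr_edist h expr0n.
case: p q {h} => [a b] [c e]; rewrite /sqn/= => /eqP.
rewrite paddr_eq0 ?sqr_ge0// !sqrf_eq0 !subr_eq0.
by move=> /andP[/eqP -> /eqP ->].
Qed.

Lemma edist_triangle p q s : edist p s <= edist p q + edist q s.
Proof.
rewrite edist_le ?addr_ge0 ?edist_ge0// sqrrD !sqr_edist.
have cs : sqn (p - q) * sqn (q - s) = (edist p q * edist q s) ^+ 2.
  by rewrite exprMn !sqr_edist.
have : (p.1 - q.1) * (q.1 - s.1) + (p.2 - q.2) * (q.2 - s.2) <= edist p q * edist q s.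
  rewrite -[leRHS]ger0_norm ?mulr_ge0 ?edist_ge0//.
  apply: le_trans (ler_norm _) _.
  rewrite -ler_sqr ?nnegrE// !real_normK ?num_real// -cs /sqn/=.
  move: (p.1 - q.1) (p.2 - q.2) (q.1 - s.1) (q.2 - s.2) => a b c e.
  (* Lagrange's identity reduces Cauchy-Schwarz to the nonnegativity of this square. *)
  by have := sqr_ge0 (a * e - b * c); nra.
by rewrite /sqn/= mulr2n; move: (edist p q * edist q s) => w; nra.
Qed.

End PlaneNorm.

(** * Points and segments of the disc *)

Section Disc.
Context {R : realType}.
Implicit Types p q : R * R.
Implicit Types z a b : cdisc R.

Lemma ddiscE z a : ddisc z a = edist (val z) (val a). Proof. by []. Qed.

Lemma ddisc_metric : is_metric (@ddisc R).
Proof.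
split; first by move=> x y; exact: sqrtr_ge0.
split; last by split => [x y|x y z]; rewrite !ddiscE; [exact: edistC|exact: edist_triangle].
move=> x y; rewrite ddiscE; split; first by move/edist_eq0/val_inj.
by move=> ->; rewrite /edist subrr /sqn/= expr0n addr0 sqrtr0.
Qed.

Lemma disc_origin_subproof : (0 : R) ^+ 2 + 0 ^+ 2 <= 1.
Proof. by rewrite !expr0n addr0 ler01. Qed.

Definition disc_origin : cdisc R :=
  @exist _ (fun p : R * R => p.1 ^+ 2 + p.2 ^+ 2 <= 1) (0, 0) disc_origin_subproof.

(** Points outside the disc are sent to the origin, so that plane formulas define total maps into
    the disc. *)
Definition dpt p : cdisc R := insubd disc_origin p.

Lemma dptK p : sqn p <= 1 -> val (dpt p) = p.
Proof. by move=> h; rewrite /dpt insubdK. Qed.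

Lemma disc_sqn z : sqn (val z) <= 1. Proof. exact: (valP z). Qed.

Lemma valKdpt z : dpt (val z) = z. Proof. by rewrite /dpt valKd. Qed.

Lemma sqn_convex p q (t : R) : 0 <= t <= 1 -> sqn p <= 1 -> sqn q <= 1 ->
  sqn (p + t *: (q - p)) <= 1.
Proof.
move=> /andP[t0 t1]; rewrite /sqn/= /GRing.scale/=.
case: p q => [a b] [c e] /= h1 h2.
have : 0 <= t * (1 - t) * ((a - c) ^+ 2 + (b - e) ^+ 2).
  by rewrite mulr_ge0 ?addr_ge0 ?sqr_ge0// mulr_ge0// subr_ge0.
have := ler_wpM2l t0 h2.
have : (1 - t) * (a ^+ 2 + b ^+ 2) <= (1 - t) * 1 by rewrite ler_wpM2l// subr_ge0.
nra.
Qed.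

Definition dseg z a (t : R) : cdisc R := dpt (val z + t *: (val a - val z)).

Lemma val_dseg z a t : 0 <= t <= 1 -> val (dseg z a t) = val z + t *: (val a - val z).
Proof. by move=> t01; rewrite dptK// sqn_convex// disc_sqn. Qed.

Lemma dseg0 z a : dseg z a 0 = z.
Proof. by rewrite /dseg scale0r addr0 valKdpt. Qed.

Lemma dseg1 z a : dseg z a 1 = a.
Proof. by rewrite /dseg scale1r addrC subrK valKdpt. Qed.

Lemma ddisc_dseg z a (s t : R) : 0 <= s <= 1 -> 0 <= t <= 1 ->
  ddisc (dseg z a s) (dseg z a t) = `|s - t| * ddisc z a.
Proof.
move=> s01 t01; rewrite !ddiscE !val_dseg//; apply: edist_eq.
  by rewrite mulr_ge0// edist_ge0.
rewrite exprMn sqr_edist real_normK ?num_real// /sqn/= /GRing.scale/=; ring.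
Qed.

End Disc.

(** * Circles around a point of the disc *)

Section CircleArcs.
Context {R : realType}.
Variables (z v : R * R) (zn : R).
Hypothesis v1 : sqn v = 1.
Hypothesis zn0 : 0 <= zn.
Hypothesis zE : z = zn *: v.

(** Polar coordinates about [z], with the angle measured from the outward direction [v] of [z]. The
    squared norm of the point then depends on [th] only through [cos th], with the nonnegative
    coefficient [2 * t * zn]. *)
Definition cpt (v z : R * R) (t th : R) : R * R :=
  (z.1 + t * (cos th * v.1 - sin th * v.2), z.2 + t * (cos th * v.2 + sin th * v.1)).

Lemma edist_cpt_center (t th : R) : 0 <= t -> edist z (cpt v z t th) = t.
Proof.
move=> t0; apply: edist_eq => //; have cs := cos2Dsin2 th.
move: v1; rewrite /sqn/= => h.
transitivity (t ^+ 2 * ((v.1 ^+ 2 + v.2 ^+ 2) * (cos th ^+ 2 + sin th ^+ 2))); first by ring.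
by rewrite h cs !mulr1.
Qed.

Lemma sqn_cpt (t th : R) : sqn (cpt v z t th) = zn ^+ 2 + 2 * t * zn * cos th + t ^+ 2.
Proof.
rewrite zE; have cs := cos2Dsin2 th; move: v1; rewrite /sqn/= /GRing.scale/= => h.
transitivity ((v.1 ^+ 2 + v.2 ^+ 2) * (zn ^+ 2 + 2 * t * zn * cos th +
  t ^+ 2 * (cos th ^+ 2 + sin th ^+ 2))); first by ring.
by rewrite h cs mul1r mulr1.
Qed.

(** Between two angles of [[0, 2 pi]] the arc has no interior point in the outward direction, and
    the squared norm is largest at one of its ends. *)
Lemma arc_in_disc (t a b c : R) : 0 <= t -> 0 <= a -> a <= b -> b <= c -> c <= pi *+ 2 ->
  sqn (cpt v z t a) <= 1 -> sqn (cpt v z t c) <= 1 -> sqn (cpt v z t b) <= 1.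
Proof.
move=> t0 a0 ab bc c2; rewrite !sqn_cpt => h1 h2.
have := cos_arc_le a0 ab bc c2; rewrite le_max => /orP[] hc.
  apply: le_trans h1; rewrite lerD2r lerD2l ler_wpM2l// !mulr_ge0//.
apply: le_trans h2; rewrite lerD2r lerD2l ler_wpM2l// !mulr_ge0//.
Qed.

Lemma circle_param (p : R * R) (t : R) : 0 < t -> edist z p = t ->
  exists2 th, 0 <= th <= pi *+ 2 & p = cpt v z t th.
Proof.
move=> t0 zp; have zp2 : (p.1 - z.1) ^+ 2 + (p.2 - z.2) ^+ 2 = t ^+ 2.
  by rewrite -zp edistC sqr_edist.
move: v1; rewrite /sqn => h1.
pose a := ((p.1 - z.1) * v.1 + (p.2 - z.2) * v.2) / t.
pose b := ((p.2 - z.2) * v.1 - (p.1 - z.1) * v.2) / t.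
have tn0 : t != 0 by rewrite gt_eqF.
have ab : a ^+ 2 + b ^+ 2 = 1.
  transitivity (((p.1 - z.1) ^+ 2 + (p.2 - z.2) ^+ 2) * (v.1 ^+ 2 + v.2 ^+ 2) / t ^+ 2).
    by rewrite /a /b; field.
  by rewrite zp2 h1 mulr1 mulfV// expf_neq0.
have [th th2 [ca sb]] := polar_angle ab; exists th => //.
rewrite /cpt ca sb /a /b; case: p zp zp2 @a @b ab ca sb => p1 p2 /= *.
congr pair.
  transitivity (z.1 + (p1 - z.1) * (v.1 ^+ 2 + v.2 ^+ 2)); last by field.
  by rewrite h1 mulr1 addrC subrK.
transitivity (z.2 + (p2 - z.2) * (v.1 ^+ 2 + v.2 ^+ 2)); last by field.
by rewrite h1 mulr1 addrC subrK.
Qed.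

Lemma edist_cpt (t a b : R) : 0 <= t ->
  edist (cpt v z t a) (cpt v z t b) = 2 * t * `|sin ((a - b) / 2)|.
Proof.
move=> t0; apply: edist_eq; first by rewrite !mulr_ge0.
have e1 : 2 * `|sin ((a - b) / 2)| ^+ 2 = 1 - cos (a - b).
  have := cos_mulr2n ((a - b) / 2); rewrite -[X in cos X = _]mulr_natr divfK// => ->.
  by rewrite real_normK ?num_real// sin2cos2 mulr2n; ring.
have ca := cos2Dsin2 a; have cb := cos2Dsin2 b.
move: v1; rewrite /sqn/= => h.
transitivity (t ^+ 2 * (v.1 ^+ 2 + v.2 ^+ 2) *
  ((cos a ^+ 2 + sin a ^+ 2) + (cos b ^+ 2 + sin b ^+ 2) - 2 * (cos a * cos b + sin a * sin b))).
  by ring.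
by rewrite -cosB h ca cb !exprMn; move: e1; nra.
Qed.

Lemma edist_cpt_radial (s t th : R) : edist (cpt v z s th) (cpt v z t th) = `|s - t|.
Proof.
apply: edist_eq => //; rewrite real_normK ?num_real//.
have cs := cos2Dsin2 th; move: v1; rewrite /sqn/= => hv.
transitivity ((s - t) ^+ 2 * ((v.1 ^+ 2 + v.2 ^+ 2) * (cos th ^+ 2 + sin th ^+ 2))); first by ring.
by rewrite hv cs !mulr1.
Qed.

Lemma edist_cpt_le (t a b : R) : 0 <= t -> edist (cpt v z t a) (cpt v z t b) <= t * `|a - b|.
Proof.
move=> t0; rewrite edist_cpt//.
have n2 : `|2^-1 : R| = 2^-1 by rewrite ger0_norm.
have := le_abs_sin ((a - b) / 2); rewrite normrM n2 => h.
by have := ler_wpM2l t0 h; lra.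
Qed.

Lemma edist_cpt_ge (t a b : R) : 0 <= t -> `|a - b| <= pi ->
  t * `|a - b| / 2 <= edist (cpt v z t a) (cpt v z t b).
Proof.
move=> t0 abp; rewrite edist_cpt//.
have h : `|a - b| / 2 / 2 <= `|sin ((a - b) / 2)|.
  wlog ab : a b abp / 0 <= a - b => [hw|].
    have [|/ltW ba] := leP 0 (a - b); first exact: hw.
    rewrite -normrN opprB -[in leRHS]normrN -sinN -mulNr opprB.
    by apply: hw; [rewrite -normrN opprB|lra].
  rewrite (ger0_norm ab) in abp *.
  apply: le_trans (ler_norm _); apply: sin_ge_half; apply/andP; split; lra.
by have := ler_wpM2l t0 h; lra.
Qed.

End CircleArcs.

Lemma unit_direction (R : realType) (z : R * R) :
  exists v (zn : R), [/\ sqn v = 1, 0 <= zn & z = zn *: v].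
Proof.
pose zn := Num.sqrt (sqn z).
have zn2 : zn ^+ 2 = sqn z by rewrite sqr_sqrtr// sqn_ge0.
have [z0|zn0] := eqVneq zn 0.
  exists (1, 0), 0; rewrite /sqn/= expr1n expr0n addr0; split => //.
  apply: edist_eq0; rewrite scale0r.
  by rewrite /edist subr0 -/zn.
exists (zn^-1 *: z), zn; split; [|exact: sqrtr_ge0|].
  have : sqn z = z.1 ^+ 2 + z.2 ^+ 2 by [].
  by rewrite -zn2 /sqn/= /GRing.scale/= => h; rewrite !exprMn -mulrDr -h exprVn mulVf// expf_neq0.
by rewrite scalerA mulfV// scale1r.
Qed.

(** * Lower bound for the modulus of curves joining two sets *)

Local Notation pushforward_measure :=
  measure_function_pushforward__canonical__measure_function_Measure.

(** * Affine change of variables *)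

Section AffineSubstitution.
Context {R : realType}.
Local Notation mu := (@lebesgue_measure R).

(** [1 / t] times the image of Lebesgue measure under [s |-> a + s / t] agrees with Lebesgue measure
    on half-open intervals, hence everywhere by uniqueness. *)
Lemma ge0_integral_affine (f : R -> \bar R) (a t : R) (D : set R) : 0 < t -> measurable D ->
  measurable_fun setT f -> (forall x, 0 <= f x)%E ->
  (\int[mu]_(s in (fun s => (a + s / t)%R) @^-1` D) f (a + s / t)%R = t%:E * \int[mu]_(x in D) f x)%E.
Proof.
move=> t0 mD mf f0; pose phi : measurableTypeR R -> measurableTypeR R := fun s => a + s / t.
have mphi : measurable_fun setT phi.
  by apply: measurable_funD => //; apply: measurable_funM.
pose ti := NngNum (ltW t0).
have tiE : ti%:num = t by [].
pose nu := mscale ti mu.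
have E A : measurable A -> pushforward mu phi A = nu A.
  have ti0 : 0 < t^-1 by rewrite invr_gt0.
  move=> mA; pose tinv : {nonneg R} := NngNum (ltW ti0).
  pose rho := mscale tinv (pushforward_measure mu mphi).
  have rhoE (B : set R) : rho B = ((t^-1)%:E * mu (phi @^-1` B))%E by [].
  have lr : mu A = rho A.
    apply: (@lebesgue_measure_unique R rho _ A mA) => _ [[x y]] _ <-.
    change (mu `]x, y] = (t^-1)%:E * mu (phi @^-1` `]x, y]))%E.
    have -> : phi @^-1` `]x, y] = [set` `](x - a) * t, (y - a) * t]].
      apply/seteqP; split => s; rewrite /phi/= !in_itv/= -ltrBlDl -lerBrDl ltr_pdivlMr// ler_pdivrMr//.
    rewrite !lebesgue_measure_itv/= !lte_fin ltr_pM2r// ltrD2r.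
    case: ifP => _; last by rewrite mule0.
    by rewrite -!EFinD -EFinM; congr EFin; field; rewrite gt_eqF.
  change (mu (phi @^-1` A) = t%:E * mu A)%E.
  by rewrite lr rhoE muleA -EFinM mulfV ?gt_eqF// mul1e.
rewrite -(ge0_integral_mscale mu mD ti)//; last exact: measurable_funS mf.
transitivity (\int[pushforward mu phi]_(x in D) f x)%E.
  by rewrite ge0_integral_pushforward//; exact: measurable_funS mf.
by apply: eq_measure_integral => A mA _; exact: E.
Qed.

End AffineSubstitution.

(** * Lebesgue integrals dominated by [int_H2] *)

Section IntegralBound.
Context {disp : measure_display} {W : measurableType disp} {R : realType} {T : pointedType}.
Variable d : T -> T -> R.
Local Open Scope ereal_scope.

Let Td := g_sigma_algebraType (mopen d).

Let measurable_mborel (A : set Td) : measurable A -> mborel d A.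
Proof. by move=> mA S sS oS; apply: (mA : <<s mopen d >> A); split. Qed.

Let mborel_measurable (A : set Td) : mborel d A -> measurable A.
Proof. by move=> mA; change (<<s mopen d >> A) => S [sS oS]; exact: mA. Qed.

Import HBNNSimple.

(** The level sets of a simple function below [f] are disjoint Borel sets on which the infimum of
    [f] is at least the level, so they compete in the supremum defining [int_H2]. *)
Let sintegral_le (nu : {measure set Td -> \bar R}) (K : R) (f : T -> \bar R) (h : {nnsfun Td >-> R}) :
  (0 <= K)%R ->
  (forall A, mborel d A -> nu A <= K%:E * H2 d A) -> (forall x, (h x)%:E <= f x) ->
  sintegral nu h <= K%:E * int_H2 d f.
Proof.
move=> K0 hK hf; rewrite sintegralE fsbig_finite//=.
set s := finmap.enum_fset _; pose v i : R := nth 0%R s i.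
have -> : \sum_(x <- s) x%:E * nu (h @^-1` [set x]) =
    \sum_(i < size s) (v i)%:E * nu (h @^-1` [set v i]).
  by rewrite (big_nth 0%R) big_mkord.
have v0 (i : 'I_(size s)) : (0 <= v i)%R.
  have : v i \in s by apply: mem_nth.
  by rewrite /s in_fset_set// => /set_mem[x _ <-].
have mh r : mborel d (h @^-1` [set r]) by apply: measurable_mborel; exact: measurable_sfunP.
apply: (@le_trans _ _ (\sum_(i < size s) K%:E *
    (ereal_inf (f @` (h @^-1` [set v i])) * H2 d (h @^-1` [set v i])))); last first.
  rewrite -ge0_sume_distrr; last first.
    move=> i _; rewrite mule_ge0 ?H2_ge0//; apply: le_ereal_inf_tmp => _ [x _ <-].
    by apply: le_trans (hf x); rewrite lee_fin.
  apply: lee_wpmul2l; first by rewrite lee_fin.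
  apply: ereal_sup_ubound; exists (size s), (fun i => h @^-1` [set v i]); split => //.
  move=> i j il jl ij; apply/seteqP; split => // x [/= hi hj]; apply: ij; apply/eqP.
  by rewrite -(nth_uniq 0%R il jl (finmap.fset_uniq _)) -/(v i) -/(v j) -hi -hj.
apply: lee_sum => i _; apply: (@le_trans _ _ ((v i)%:E * (K%:E * H2 d (h @^-1` [set v i])))).
  by apply: lee_wpmul2l; rewrite ?lee_fin//; exact: hK.
rewrite muleCA; apply: lee_wpmul2l; first by rewrite lee_fin.
apply: lee_wpmul2r; first exact: H2_ge0.
by apply: le_ereal_inf_tmp => _ [x /= <- <-]; exact: hf.
Qed.

(** A domination of measures on Borel sets becomes one of integrals: push [mu], restricted to [D],
    forward along [Phi] and compare simple functions. [Phi] will be polar coordinates. *)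
Lemma integral_comp_le_int_H2 (mu : {measure set W -> \bar R}) (D : set W) (Phi : W -> T)
    (K : R) (f : T -> \bar R) : measurable D -> (0 <= K)%R ->
  (forall A, mborel d A -> measurable (Phi @^-1` A)) ->
  (forall A, mborel d A -> mu (Phi @^-1` A `&` D) <= K%:E * H2 d A) ->
  (forall x, 0 <= f x) -> mborel_fun d f ->
  \int[mu]_(w in D) f (Phi w) <= K%:E * int_H2 d f.
Proof.
move=> mD K0 mPhi hK f0 mf.
have mPhi' : measurable_fun setT (Phi : W -> Td).
  by move=> _ A mA; rewrite setTI; apply: mPhi; exact: measurable_mborel.
have mf' : measurable_fun setT (f : Td -> \bar R).
  by move=> _ B mB; rewrite setTI; apply: mborel_measurable; exact: mf.
pose m := mrestr mu mD; pose nu := pushforward_measure m mPhi'.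
have mcomp : measurable_fun setT (fun w => f (Phi w)) := measurableT_comp mf' mPhi'.
apply: (@le_trans _ _ (\int[nu]_x f x)); last first.
  rewrite ge0_integralTE//; apply: ge_ereal_sup => _ [h hf <-].
  by apply: sintegral_le => // A mA; exact: hK.
have -> : \int[nu]_x f x = \int[m]_x f (Phi x).
  by rewrite (ge0_integral_pushforward mPhi').
apply: (@le_trans _ _ (\int[m]_(x in D) f (Phi x))).
  rewrite (eq_measure_integral m)// => A mA AD.
  by rewrite /m/= /mrestr (setIidl AD).
exact: ge0_subset_integral.
Qed.

End IntegralBound.

(** * Measurability of maps into the disc *)

Section DiscMeasurability.
Context {disp : measure_display} {W : measurableType disp} {R : realType}.
Variables X Y : W -> R.
Hypothesis mX : measurable_fun setT X.
Hypothesis mY : measurable_fun setT Y.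

Lemma measurable_fun_sqn (p : R * R) : measurable_fun setT (fun w => sqn ((X w, Y w) - p)).
Proof.
rewrite /sqn/=; apply: measurable_funD; apply: measurable_funX; exact: measurable_funB.
Qed.

Let mle c : measurable [set w | sqn (X w, Y w) <= c].
Proof.
have -> : [set w | sqn (X w, Y w) <= c] = (fun w => sqn ((X w, Y w) - 0)) @^-1` `]-oo, c].
  by apply/seteqP; split => w /=; rewrite in_itv/= subr0.
by rewrite -[X in measurable X]setTI; exact: measurable_fun_sqn.
Qed.

Let mlt p c : measurable [set w | sqn ((X w, Y w) - p) < c].
Proof.
have -> : [set w | sqn ((X w, Y w) - p) < c] = (fun w => sqn ((X w, Y w) - p)) @^-1` `]-oo, c[.
  by apply/seteqP; split => w /=; rewrite in_itv.
by rewrite -[X in measurable X]setTI; exact: measurable_fun_sqn.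
Qed.

Lemma rat_approx (x e : R) : 0 < e -> exists q : rat, `|ratr q - x| < e.
Proof.
move=> e0; have [|q] := @rat_in_itvoo R (x - e) (x + e); first by lra.
rewrite in_itv/= => /andP[h1 h2]; exists q.
by rewrite ltr_norml; apply/andP; split; lra.
Qed.

(* Open sets of the disc are countable unions of rational balls, whose preimages are measurable. *)
Let open_preimage (A : set (cdisc R)) : mopen (@ddisc R) A ->
  measurable ([set w | sqn (X w, Y w) <= 1] `&` [set w | A (dpt (X w, Y w))]).
Proof.
move=> oA.
pose P i j k := forall p : R * R, sqn p <= 1 ->
  edist (ratr i, ratr j) p < k.+1%:R^-1 -> A (dpt p).
pose F (i j : rat) (k : nat) := if pselect (P i j k) then
  [set w | sqn (X w, Y w) <= 1] `&`
  [set w | sqn ((X w, Y w) - (ratr i, ratr j)) < (k.+1%:R^-1) ^+ 2] else set0.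
suff -> : [set w | sqn (X w, Y w) <= 1] `&` [set w | A (dpt (X w, Y w))] =
    \bigcup_i \bigcup_j \bigcup_k F i j k.
  apply: bigcupT_measurable_rat => i; apply: bigcupT_measurable_rat => j.
  apply: bigcupT_measurable => k; rewrite /F; case: pselect => //= _.
  by apply: measurableI.
apply/seteqP; split => [w [/= w1 Aw]|w [i _ [j _ [k _]]]].
  have [r r0 hr] := oA _ Aw; have r20 : 0 < r / 2 by rewrite divr_gt0.
  have [k _ /(_ k (leqnn k))/= kr] := near_infty_natSinv_lt (PosNum r20).
  have k0 : 0 < k.+1%:R^-1 / 2 :> R by rewrite divr_gt0.
  have [i hi] := rat_approx (X w) k0; have [j hj] := rat_approx (Y w) k0.
  have sq : sqn ((X w, Y w) - (ratr i, ratr j)) < (k.+1%:R^-1) ^+ 2.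
    have sqlt (x y e : R) : `|x - y| < e -> (y - x) ^+ 2 < e ^+ 2.
      rewrite distrC => h; rewrite -real_normK ?num_real// ltr_sqr ?nnegrE//.
      by apply: le_trans (ltW h).
    have := sqlt _ _ _ hi; have := sqlt _ _ _ hj; rewrite /sqn/= !exprMn.
    move: (k.+1%:R^-1 ^+ 2) (sqr_ge0 (k.+1%:R^-1 : R)) => c c0; lra.
  exists i => //; exists j => //; exists k => //; rewrite /F; case: pselect => //= -[] p p1 hp.
  apply: hr; rewrite /mball/= ddiscE !dptK//.
  apply: le_lt_trans (edist_triangle _ (ratr i, ratr j) _) _.
  have : edist (X w, Y w) (ratr i, ratr j) < k.+1%:R^-1.
    by rewrite -ltr_sqr ?nnegrE ?edist_ge0// ?invr_ge0// sqr_edist.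
  move: (k.+1%:R^-1) kr hp => c; lra.
rewrite /F; case: pselect => //= Pk [w1 ww]; split => //; apply: Pk => //.
by rewrite edistC -ltr_sqr ?nnegrE ?edist_ge0 ?invr_ge0// sqr_edist.
Qed.

(** The sets with measurable preimage form a sigma-algebra. For an open set, the parameters outside
    the disc all go to the origin, so they count entirely or not at all. *)
Lemma measurable_dpt_preimage (A : set (cdisc R)) : mborel (@ddisc R) A ->
  measurable [set w | A (dpt (X w, Y w))].
Proof.
move=> mA; pose S : set (set (cdisc R)) := [set A | measurable [set w | A (dpt (X w, Y w))]].
apply: (mA S).
  split.
  - exact: measurable0.
  - by move=> B mB; rewrite setTD; exact: (measurableC mB).
  - by move=> F mF; exact: (bigcupT_measurable _ mF).
move=> U oU; rewrite /S/=.
have -> : [set w | U (dpt (X w, Y w))] =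
    ([set w | sqn (X w, Y w) <= 1] `&` [set w | U (dpt (X w, Y w))]) `|`
    [set w | ~ sqn (X w, Y w) <= 1 /\ U disc_origin].
  have out w : ~ sqn (X w, Y w) <= 1 -> dpt (X w, Y w) = disc_origin.
    by move=> /negP h; rewrite /dpt /insubd insubF//; apply/negbTE.
  apply/seteqP; split => w /=.
    have [w1 Uw|/[dup] w1 /out ->] := pselect (sqn (X w, Y w) <= 1); first by left.
    by move=> Uo; right.
  by case => [[]//|[/out ->]].
apply: measurableU; first exact: open_preimage.
have [Uo|nUo] := pselect (U disc_origin).
  have -> : [set w | ~ sqn (X w, Y w) <= 1 /\ U disc_origin] = ~` [set w | sqn (X w, Y w) <= 1].
    by apply/seteqP; split => w /=; [case|].
  exact: measurableC.
have -> : [set w | ~ sqn (X w, Y w) <= 1 /\ U disc_origin] = set0.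
  by apply/seteqP; split => w //= [].
exact: measurable0.
Qed.

Lemma measurable_in_disc : measurable [set w | sqn (X w, Y w) <= 1].
Proof. exact: mle. Qed.

End DiscMeasurability.

Lemma ler_dist_itv (R : realFieldType) (a l x y : R) :
  a <= x -> x <= a + l -> a <= y -> y <= a + l -> `|x - y| <= l.
Proof. by move=> *; rewrite ler_norml; apply/andP; split; lra. Qed.

(** * Polar coordinates and the Hausdorff measure of the disc *)

Section CircleMeasure.
Context {R : realType}.
Variables (z : cdisc R) (v : R * R) (zn : R).
Hypothesis v1 : sqn v = 1.
Hypothesis zn0 : 0 <= zn.
Hypothesis zE : val z = zn *: v.
Variables (rad al : R).
Hypothesis rad0 : 0 < rad.

Let W := (measurableTypeR R * measurableTypeR R)%type.
Let mu : {measure set W -> \bar R} := ((@lebesgue_measure R) \x (@lebesgue_measure R))%E.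
Let Psi (w : W) : R * R := cpt v (val z) w.1 w.2.

(** The angles span a half-turn because the chord bound [edist_cpt_ge] requires angles differing by
    at most [pi]; the values [al = 0] and [al = pi] together cover the circle. *)
Definition polar_dom (al : R) : set W :=
  ([set` `[rad, 2 * rad]] `*` [set` `[al, al + pi]]) `&` [set w | sqn (cpt v (val z) w.1 w.2) <= 1].

Lemma measurable_cpt1 : measurable_fun setT (fun w : W => (Psi w).1).
Proof.
apply: measurable_funD; first exact: measurable_cst.
apply: measurable_funM; first exact: measurable_fst.
apply: measurable_funB; apply: measurable_funM; try exact: measurable_cst.
  apply: measurableT_comp measurable_snd; apply: continuous_measurable_fun; exact: continuous_cos.
apply: measurableT_comp measurable_snd; apply: continuous_measurable_fun; exact: continuous_sin.
Qed.

Lemma measurable_cpt2 : measurable_fun setT (fun w : W => (Psi w).2).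
Proof.
apply: measurable_funD; first exact: measurable_cst.
apply: measurable_funM; first exact: measurable_fst.
apply: measurable_funD; apply: measurable_funM; try exact: measurable_cst.
  apply: measurableT_comp measurable_snd; apply: continuous_measurable_fun; exact: continuous_cos.
apply: measurableT_comp measurable_snd; apply: continuous_measurable_fun; exact: continuous_sin.
Qed.

Lemma measurable_polar_dom : measurable (polar_dom al).
Proof.
apply: measurableI; first by apply: measurableX.
exact: (measurable_in_disc measurable_cpt1 measurable_cpt2).
Qed.

(** The preimage of a set of diameter [dU] lies in a rectangle of sides [2 dU] and [8 dU / rad]. Its
    area [16 dU ^ 2 / rad] is [K] times the term [(pi / 4) dU ^ 2] of a Hausdorff sum. *)
Let K : R := 64 / (pi * rad).

Let K_gt0 : 0 < K. Proof. by rewrite divr_gt0// mulr_gt0// pi_gt0. Qed.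

Let lebesgue_centered (x e : R) : 0 <= e -> lebesgue_measure [set` `[x - e, x + e]] = (2 * e)%:E.
Proof.
move=> e0; rewrite lebesgue_measure_itv/= lte_fin; case: ifPn => h.
  by rewrite -EFinD; congr EFin; ring.
have -> : e = 0 by rewrite -leNgt in h; lra.
by rewrite mulr0.
Qed.

(* Two points of the polar domain at distance at most [dU] have radii differing by at most [dU] and angles differing by at most [4 dU / rad]. *)
Let cell (U : set (cdisc R)) (dU : R) : mdiam (@ddisc R) U = dU%:E ->
  exists V : set W, [/\ measurable V, (fun w => dpt (Psi w)) @^-1` U `&` polar_dom al `<=` V &
    (mu V <= K%:E * ((pi / 4)%:E * (mdiam (@ddisc R) U * mdiam (@ddisc R) U)))%E].
Proof.
move=> dUE; have dU0 : 0 <= dU by rewrite -lee_fin -dUE mdiam_ge0.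
have pi0 := pi_gt0 R.
have [[[t0 th0] [U0 [[/= t0r th0r] D0]]]|noW] :=
    pselect (exists w, U (dpt (Psi w)) /\ polar_dom al w); last first.
  exists set0; split; first exact: measurable0.
    by move=> w [Uw Dw]; apply: noW; exists w.
  rewrite measure0 dUE -!EFinM lee_fin !mulr_ge0// ?invr_ge0 ?mulr_ge0// ltW//.
pose c := 4 * dU / rad.
have c0 : 0 <= c by rewrite divr_ge0 ?mulr_ge0// ltW.
exists ([set` `[t0 - dU, t0 + dU]] `*` [set` `[th0 - c, th0 + c]]); split.
- by apply: measurableX.
- move=> [t th] [/= Ut [[/= tr thr] Dt]].
  move: t0r th0r tr thr; rewrite !in_itv/= => /andP[a1 a2] /andP[a3 a4] /andP[a5 a6] /andP[a7 a8].
  have t00 : 0 <= t0 by lra.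
  have tt0 : 0 <= t by lra.
  have dist : edist (Psi (t, th)) (Psi (t0, th0)) <= dU.
    have := mdiam_ub (@ddisc R) Ut U0; rewrite dUE lee_fin ddiscE !dptK//.
  have e1 := edist_cpt_center (val z) v1 th tt0.
  have e2 := edist_cpt_center (val z) v1 th0 t00.
  have h1 : `|t - t0| <= dU.
    rewrite ler_norml; apply/andP; split.
      have := edist_triangle (val z) (Psi (t, th)) (Psi (t0, th0)).
      by rewrite /Psi/= e1 e2 in dist *; lra.
    have := edist_triangle (val z) (Psi (t0, th0)) (Psi (t, th)).
    by rewrite edistC in dist; rewrite /Psi/= e1 e2 in dist *; lra.
  have e3 := edist_cpt_radial (val z) v1 t0 t th.
  have thp : `|th - th0| <= pi.
    exact: ler_dist_itv a7 a8 a3 a4.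
  have e4 := edist_cpt_ge (val z) v1 t00 thp.
  have e5 := edist_triangle (cpt v (val z) t0 th) (cpt v (val z) t th) (cpt v (val z) t0 th0).
  have h2 : rad * `|th - th0| / 2 <= 2 * dU.
    rewrite distrC in h1; rewrite /Psi/= in dist.
    have h3 : rad * `|th - th0| <= t0 * `|th - th0| by rewrite ler_wpM2r.
    move: e4 e5 h3 h1 dist; rewrite -e3.
    move: (`|th - th0|) (edist _ _) (edist _ _) (edist _ _) => *; lra.
  have h3 : `|th - th0| <= c.
    by rewrite /c ler_pdivlMr//; move: h2; move: (`|th - th0|) => x h2'; lra.
  by split; rewrite /= ?in_itv/= -ler_distlC distrC.
rewrite /mu product_measure1E//=.
rewrite !lebesgue_centered// dUE -!EFinM lee_fin /K /c le_eqVlt; apply/orP; left; apply/eqP.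
by move: (pi : R) pi0 => p p0; field; rewrite !gt_eqF.
Qed.

Lemma polar_measure_le (A : set (cdisc R)) : mborel (@ddisc R) A ->
  (mu ((fun w => dpt (Psi w)) @^-1` A `&` polar_dom al) <= K%:E * H2 (@ddisc R) A)%E.
Proof.
(* The scale [1] keeps the diameters of the covering sets finite, as [cell] requires. *)
move=> mA; apply: (@le_trans _ _ (K%:E * H2_delta (@ddisc R) 1 A)%E); last first.
  by apply: lee_wpmul2l; [rewrite lee_fin ltW|exact: H2_delta_le].
rewrite -lee_pdivrMl//; apply: le_ereal_inf_tmp => _ [U [AU Ud] <-].
rewrite lee_pdivrMl//.
have /choice[V hV] : forall i, exists V : set W, [/\ measurable V,
    (fun w => dpt (Psi w)) @^-1` (U i) `&` polar_dom al `<=` V &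
    (mu V <= K%:E * ((pi / 4)%:E * (mdiam (@ddisc R) (U i) * mdiam (@ddisc R) (U i))))%E].
  move=> i; apply: (@cell _ (fine (mdiam (@ddisc R) (U i)))).
  by rewrite fineK// ge0_fin_numE ?mdiam_ge0//; apply: le_lt_trans (Ud i) _; rewrite ltry.
apply: (@le_trans _ _ (\sum_(i <oo) mu (V i))%E).
  apply: measure_sigma_subadditive.
  - by move=> i; case: (hV i).
  - apply: measurableI; last exact: measurable_polar_dom.
    exact: (measurable_dpt_preimage measurable_cpt1 measurable_cpt2).
  - move=> w [Aw Dw]; have [i _ Ui] := AU _ Aw; exists i => //.
    by have [_ + _] := hV i; apply; split.
rewrite -nneseriesZl; last first.
  by move=> i _; rewrite mule_ge0 ?mule_ge0 ?mdiam_ge0// lee_fin divr_ge0// pi_ge0.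
by apply: lee_nneseries => i _; [move=> _; exact: measure_ge0|case: (hV i)].
Qed.

Lemma polar_integral_le (f : cdisc R -> \bar R) : (forall x, 0 <= f x)%E ->
  mborel_fun (@ddisc R) f ->
  (\int[mu]_(w in polar_dom al) f (dpt (Psi w)) <= K%:E * int_H2 (@ddisc R) f)%E.
Proof.
move=> f0 mf.
pose Tp : pointedType := HB.pack (cdisc R) (gen_eqMixin (cdisc R))
  (gen_choiceMixin (cdisc R)) (isPointed.Build (cdisc R) disc_origin).
apply: (@integral_comp_le_int_H2 _ _ _ Tp) => //.
- exact: measurable_polar_dom.
- exact: ltW.
- by move=> A mA; exact: (measurable_dpt_preimage measurable_cpt1 measurable_cpt2).
- exact: polar_measure_le.
Qed.

End CircleMeasure.

Lemma cos_ge_1B (R : realType) (x : R) : 0 <= x -> 1 - x <= cos x.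
Proof.
move=> x0; have hx : x = (x / 2) *+ 2 by rewrite -mulr_natr divfK.
rewrite [in leRHS]hx cos_mulr2n; have := le_abs_sin (x / 2).
rewrite (ger0_norm (_ : 0 <= x / 2)) ?divr_ge0// => h1; have h2 := sin_max (x / 2).
have := cos2Dsin2 (x / 2).
have h3 : sin (x / 2) ^+ 2 <= `|sin (x / 2)|.
  by rewrite -real_normK ?num_real// expr2 ler_piMl.
move: h1 h3; move: (`|sin _|) (sin (x / 2) ^+ 2) (cos (x / 2) ^+ 2) => p q s; lra.
Qed.

(** * Line integrals along circular arcs *)

Section ArcLength.
Context {R : realType}.
Variables (z : cdisc R) (v : R * R) (zn : R).
Hypothesis v1 : sqn v = 1.
Hypothesis zn0 : 0 <= zn.
Hypothesis zE : val z = zn *: v.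
Variable t : R.
Hypothesis t0 : 0 < t.

Definition arc_map (th : R) : cdisc R := dpt (cpt v (val z) t th).

Section Arc.
Variables a0 b0 : R.
Hypothesis a0_ge0 : 0 <= a0.
Hypothesis b0_le : b0 <= pi *+ 2.
Hypothesis arc_in : forall th, a0 <= th <= b0 -> sqn (cpt v (val z) t th) <= 1.

Lemma ddisc_arc_map x y : a0 <= x <= b0 -> a0 <= y <= b0 ->
  ddisc (arc_map x) (arc_map y) = edist (cpt v (val z) t x) (cpt v (val z) t y).
Proof. by move=> hx hy; rewrite ddiscE !dptK// arc_in. Qed.

Lemma ddisc_arc_map_le x y : a0 <= x <= b0 -> a0 <= y <= b0 ->
  ddisc (arc_map x) (arc_map y) <= t * `|x - y|.
Proof. by move=> hx hy; rewrite ddisc_arc_map// edist_cpt_le// ltW. Qed.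

(** Chords are at most [t] times the angle, and these bounds telescope. Conversely, with [n] equal
    steps of angle [h] each chord is at least [t * h * (1 - h)], so the sum loses at most
    [t * (b - a) * h]. *)
Lemma clength_arc a b : a0 <= a -> a <= b -> b <= b0 ->
  clength (@ddisc R) arc_map a b = (t * (b - a))%:E.
Proof.
move=> a0a ab bb0; apply/eqP; rewrite eq_le; apply/andP; split.
  apply: ge_ereal_sup => _ [n [tt [tt0 ttn ttm ->]]]; rewrite lee_fin.
  have ttup i j : (i <= j)%N -> (j <= n)%N -> tt i <= tt j.
    elim: j => [|j IH]; first by rewrite leqn0 => /eqP ->.
    rewrite leq_eqVlt => /orP[/eqP -> //|ij] jn.
    exact: le_trans (IH ij (ltnW jn)) (ttm _ jn).
  have ttin i : (i <= n)%N -> a0 <= tt i <= b0.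
    move=> i_n; apply/andP; split.
      by apply: le_trans a0a _; rewrite -tt0; exact: ttup.
    by apply: le_trans bb0; rewrite -ttn; exact: ttup.
  apply: (@le_trans _ _ (\sum_(i < n) (t * (tt i.+1 - tt i)))).
    apply: ler_sum => i _; apply: le_trans (ddisc_arc_map_le _ _) _.
    - exact: ttin (ltnW (ltn_ord i)).
    - exact: ttin (ltn_ord i).
    - by rewrite distrC ger0_norm// subr_ge0 ttm.
  rewrite -mulr_sumr -(big_mkord xpredT (fun i => tt i.+1 - tt i)) telescope_sumr//.
  by rewrite ttn tt0.
apply/lee_addgt0Pr => e e0.
pose l := b - a; have l0 : 0 <= l by rewrite subr_ge0.
have [n n0 hn] : exists2 n, (0 < n)%N & t * l * (l / n%:R) <= e.
  have q0 : 0 <= e^-1 * (t * l * l) by rewrite mulr_ge0 ?invr_ge0 ?mulr_ge0// ltW.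
  exists (Num.bound (e^-1 * (t * l * l))).+1 => //.
  rewrite mulrA ler_pdivrMr ?ltr0n// -ler_pdivrMl//.
  by apply: ltW; apply: lt_le_trans (archi_boundP q0) _; rewrite ler_nat.
have nR : 0 < n%:R :> R by rewrite ltr0n.
pose h := l / n%:R; have h0 : 0 <= h by rewrite divr_ge0// ltW.
have hl : h <= l by rewrite /h ler_pdivrMr// ler_peMr// ler1n.
have nh : n%:R * h = l by rewrite /h mulrC divfK// gt_eqF.
pose tt (i : nat) := a + i%:R * h.
have ttin i : (i <= n)%N -> a0 <= tt i <= b0.
  move=> i_n; have : i%:R * h <= l by rewrite -nh ler_wpM2r// ler_nat.
  have : 0 <= i%:R * h by rewrite mulr_ge0.
  by rewrite /tt /l => h1 h2; apply/andP; split; lra.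
have part : ((\sum_(i < n) ddisc (arc_map (tt i)) (arc_map (tt i.+1)))%:E <= clength (@ddisc R) arc_map a b)%E.
  apply: ereal_sup_ubound; exists n, tt; split => //.
  - by rewrite /tt mul0r addr0.
  - by rewrite /tt nh /l addrC subrK.
  - by move=> i _; rewrite /tt lerD2l ler_wpM2r// ler_nat.
apply: (@le_trans _ _ ((\sum_(i < n) ddisc (arc_map (tt i)) (arc_map (tt i.+1)))%:E + e%:E)%E);
  last by rewrite leeD2r.
rewrite -EFinD lee_fin.
apply: (@le_trans _ _ (\sum_(i < n) (t * h * (1 - h)) + e)); last first.
  rewrite lerD2r; apply: ler_sum => i _.
  have ti := ttin _ (ltnW (ltn_ord i)); have ti1 := ttin i.+1 (ltn_ord i).
  rewrite (ddisc_arc_map ti ti1).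
  rewrite (edist_cpt _ v1 _ _ (ltW t0)).
  have -> : (tt i - tt i.+1) / 2 = - (h / 2) by rewrite /tt -natr1; field.
  rewrite sinN normrN; have h20 : 0 <= h / 2 by rewrite divr_ge0.
  have h2p : 0 <= h / 2 <= pi.
    have := b0_le; rewrite mulr2n => b0_le'; have a0_ge0' := a0_ge0; have := pi_ge0 R; rewrite h20/=.
    have : h <= pi + pi by apply: (le_trans hl); rewrite /l; lra.
    lra.
  have s1 := sin_ge_mul_cos h2p; have s2 := cos_ge_1B h20.
  have s3 : (1 - h / 2) * (h / 2) <= cos (h / 2) * (h / 2) by rewrite ler_wpM2r.
  have s4 := ler_norm (sin (h / 2)).
  have s5 : h / 2 * (1 - h) <= `|sin (h / 2)|.
    apply: le_trans s4; apply: le_trans s1; apply: le_trans s3.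
    by rewrite mulrC ler_wpM2r//; lra.
  have := ler_wpM2l (ltW t0) s5; lra.
rewrite big_const_ord iter_addr_0 -mulr_natl -/l.
have -> : n%:R * (t * h * (1 - h)) = t * (n%:R * h) * (1 - h) by ring.
by rewrite nh; move: hn; rewrite -/h; lra.
Qed.

Lemma arclength_param_arc a b s : a0 <= a -> a <= b -> b <= b0 -> 0 <= s <= t * (b - a) ->
  arclength_param (@ddisc R) arc_map a b s = arc_map (a + s / t).
Proof.
move=> a0a ab bb0 /andP[s0 sl]; rewrite /arclength_param; congr arc_map.
have st0 : 0 <= s / t by rewrite divr_ge0// ltW.
have sb : s / t <= b - a by rewrite ler_pdivrMr// mulrC.
have mem x : a <= x <= b -> (s%:E <= clength (@ddisc R) arc_map a x)%E = (a + s / t <= x).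
  move=> /andP[ax xb]; rewrite clength_arc// ?(le_trans xb)// lee_fin.
  by rewrite -lerBrDl ler_pdivrMr// mulrC.
have ast : a <= a + s / t <= b by apply/andP; split; lra.
apply/eqP; rewrite eq_le; apply/andP; split.
  by apply: ge_inf; [exists a => x [/andP[]]|split => //; rewrite mem].
apply: lb_le_inf; first by exists (a + s / t); split => //; rewrite mem.
by move=> x [xab]; rewrite mem.
Qed.

End Arc.

Lemma measurable_arc_map_comp (rho : cdisc R -> \bar R) : mborel_fun (@ddisc R) rho ->
  measurable_fun setT (fun th => rho (arc_map th)).
Proof.
move=> mrho _ B mB; rewrite setTI.
apply: (@measurable_dpt_preimage _ _ _ (fun th : R => (cpt v (val z) t th).1) (fun th => (cpt v (val z) t th).2) _ _ (rho @^-1` B)).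
- apply: measurable_funD; first exact: measurable_cst.
  apply: measurable_funM; first exact: measurable_cst.
  by apply: measurable_funB; apply: measurable_funM; try exact: measurable_cst;
    apply: continuous_measurable_fun; [exact: continuous_cos|exact: continuous_sin].
- apply: measurable_funD; first exact: measurable_cst.
  apply: measurable_funM; first exact: measurable_cst.
  by apply: measurable_funD; apply: measurable_funM; try exact: measurable_cst;
    apply: continuous_measurable_fun; [exact: continuous_cos|exact: continuous_sin].
- exact: mrho.
Qed.

Definition arc_dom : set R := [set` `[0, pi *+ 2]] `&` [set th | sqn (cpt v (val z) t th) <= 1].

Lemma measurable_arc_dom : measurable arc_dom.
Proof.
apply: measurableI => //.
apply: (@measurable_in_disc _ _ _ (fun th : R => (cpt v (val z) t th).1) (fun th => (cpt v (val z) t th).2)).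
- apply: measurable_funD; first exact: measurable_cst.
  apply: measurable_funM; first exact: measurable_cst.
  by apply: measurable_funB; apply: measurable_funM; try exact: measurable_cst;
    apply: continuous_measurable_fun; [exact: continuous_cos|exact: continuous_sin].
- apply: measurable_funD; first exact: measurable_cst.
  apply: measurable_funM; first exact: measurable_cst.
  by apply: measurable_funD; apply: measurable_funM; try exact: measurable_cst;
    apply: continuous_measurable_fun; [exact: continuous_cos|exact: continuous_sin].
Qed.

Section ArcLineIntegral.
Variables a0 b0 : R.
Hypothesis a0_ge0 : 0 <= a0.
Hypothesis ab0 : a0 <= b0.
Hypothesis b0_le : b0 <= pi *+ 2.
Hypothesis end1 : sqn (cpt v (val z) t a0) <= 1.
Hypothesis end2 : sqn (cpt v (val z) t b0) <= 1.

Definition arc_curve : curve R (cdisc R) := Curve `[a0, b0] arc_map.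

Let arc_in th : a0 <= th <= b0 -> sqn (cpt v (val z) t th) <= 1.
Proof. by move=> /andP[h1 h2]; exact: (arc_in_disc v1 zn0 zE (ltW t0) a0_ge0 h1 h2 b0_le). Qed.

Lemma arc_curve_is_curve : is_curve (@ddisc R) arc_curve.
Proof.
split; first by exists a0; rewrite /= in_itv/= lexx.
move=> th /=; rewrite in_itv/= => hth e e0; exists (e / t); first by rewrite divr_gt0.
move=> s; rewrite in_itv/= => hs sth; apply: le_lt_trans (ddisc_arc_map_le arc_in hth hs) _.
by rewrite distrC mulrC -ltr_pdivlMr.
Qed.

Lemma arc_curve_rectifiable : locally_rectifiable (@ddisc R) arc_curve.
Proof.
move=> a b ab; rewrite /= !in_itv/= => /andP[h1 _] /andP[_ h2].
by rewrite (clength_arc a0_ge0 b0_le arc_in)// ltry.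
Qed.

(** Arc length is [t] times the angle. Integrating over all of [arc_dom] removes the endpoints of
    the arc from the bound, so they may be chosen arbitrarily for each radius. *)
Lemma line_int_arc_le (rho : cdisc R -> \bar R) : (forall x, 0 <= rho x)%E ->
  mborel_fun (@ddisc R) rho ->
  (line_int (@ddisc R) rho arc_curve <=
   t%:E * \int[lebesgue_measure]_(th in arc_dom) rho (arc_map th))%E.
Proof.
move=> rho0 mrho; have mf := measurable_arc_map_comp mrho.
apply: ge_ereal_sup => _ [[a b] [/= ab [ag bg]] <-].
move: ag bg; rewrite !in_itv/= => /andP[h1 _] /andP[_ h2].
rewrite /cline_int (clength_arc a0_ge0 b0_le arc_in)//=.
apply: (@le_trans _ _ (t%:E * \int[lebesgue_measure]_(th in [set` `[a, b]]) rho (arc_map th))%E).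
  rewrite -(ge0_integral_affine a t0 _ mf)//.
  have -> : (fun s => a + s / t) @^-1` [set` `[a, b]] = [set s | 0 <= s <= t * (b - a)].
    apply/seteqP; split => s /=; rewrite in_itv/= lerDl -lerBrDl ler_pdivrMr// [_ * t]mulrC;
    by rewrite pmulr_lge0// invr_gt0.
  rewrite le_eqVlt; apply/orP; left; apply/eqP; apply: eq_integral => s.
  by move=> /set_mem/= hs; rewrite (arclength_param_arc a0_ge0 b0_le arc_in).
apply: lee_wpmul2l; first by rewrite lee_fin ltW.
apply: ge0_subset_integral => //.
- exact: measurable_arc_dom.
- exact: measurable_funS mf.
- have l1 := a0_ge0; have l2 := b0_le.
  move=> th /=; rewrite in_itv/= => /andP[k1 k2]; split => /=; first by rewrite in_itv/=; apply/andP; split; lra.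
  by apply: arc_in; apply/andP; split; lra.
Qed.

End ArcLineIntegral.
End ArcLength.

Definition crossing_family (R : realType) (E F : set (cdisc R)) : set (curve R (cdisc R)) :=
  [set g | is_curve (@ddisc R) g /\ exists p q,
    [/\ p \in cdom g, q \in cdom g, E (cmap g p) & F (cmap g q)]].

(** * The length-area argument over concentric circles *)

Section ModulusLowerBound.
Context {R : realType}.
Variables (z : cdisc R) (rad : R) (E F : set (cdisc R)).
Hypothesis rad0 : 0 < rad.
Hypothesis meets : forall t, rad <= t <= 2 * rad ->
  exists p q, [/\ E p, F q, ddisc z p = t & ddisc z q = t].

Section Admissible.
Variables (v : R * R) (zn : R).
Hypothesis v1 : sqn v = 1.
Hypothesis zn0 : 0 <= zn.
Hypothesis zE : val z = zn *: v.
Variable rho : cdisc R -> \bar R.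
Hypothesis rho0 : forall x, (0 <= rho x)%E.
Hypothesis mrho : mborel_fun (@ddisc R) rho.
Hypothesis rho_adm : forall g, crossing_family E F g ->
  locally_rectifiable (@ddisc R) g -> (1 <= line_int (@ddisc R) rho g)%E.

Let pi0 : 0 < pi :> R := pi_gt0 R.
Let W := (measurableTypeR R * measurableTypeR R)%type.
Let lam : {measure set (measurableTypeR R) -> \bar R} := @lebesgue_measure R.
Let mu : {measure set W -> \bar R} := ((@lebesgue_measure R) \x (@lebesgue_measure R))%E.

(** [rho] is tested on the arc of radius [t] between a point of [E] and a point of [F], traversed in
    the direction of increasing angle. *)
Let arc_integral_ge1 t : rad <= t <= 2 * rad ->
  (1 <= t%:E * \int[lebesgue_measure]_(th in arc_dom z v t) rho (arc_map z v t th))%E.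
Proof.
move=> ht; have t0 : 0 < t by move: ht => /andP[h _]; apply: lt_le_trans h.
have [p [q [Ep Fq zp zq]]] := meets ht.
rewrite ddiscE in zp; rewrite ddiscE in zq.
have [a a2 pE] := circle_param v1 t0 zp.
have [b b2 qE] := circle_param v1 t0 zq.
have pa : arc_map z v t a = p by rewrite /arc_map -pE valKdpt.
have qb : arc_map z v t b = q by rewrite /arc_map -qE valKdpt.
have sa : sqn (cpt v (val z) t a) <= 1 by rewrite -pE disc_sqn.
have sb : sqn (cpt v (val z) t b) <= 1 by rewrite -qE disc_sqn.
move: a2 b2 => /andP[a0 a2] /andP[b0 b2].
have [ab|/ltW ba] := leP a b.
  apply: le_trans (line_int_arc_le v1 zn0 zE t0 a0 b2 sa sb rho0 mrho).
  apply: rho_adm; last exact: (arc_curve_rectifiable v1 zn0 zE t0 a0 b2 sa sb).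
  split; first exact: (arc_curve_is_curve v1 zn0 zE t0 a0 ab b2 sa sb).
  by exists a, b; rewrite /= !in_itv/= !lexx ab pa qb.
apply: le_trans (line_int_arc_le v1 zn0 zE t0 b0 a2 sb sa rho0 mrho).
apply: rho_adm; last exact: (arc_curve_rectifiable v1 zn0 zE t0 b0 a2 sb sa).
split; first exact: (arc_curve_is_curve v1 zn0 zE t0 b0 ba a2 sb sa).
by exists a, b; rewrite /= !in_itv/= !lexx ba pa qb.
Qed.

Let rho2 x := (rho x * rho x)%E.
Let rho2_ge0 x : (0 <= rho2 x)%E. Proof. by rewrite mule_ge0. Qed.

Let measurable_rho2 t : measurable_fun setT (fun th => rho2 (arc_map z v t th)).
Proof. by apply: emeasurable_funM; exact: measurable_arc_map_comp. Qed.

(* AM-GM: [rho <= k rho^2 + 1 / (4 k)] with [k = 2 pi rad] *)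
Let arc_integral_sqr t : rad <= t <= 2 * rad ->
  (((8 * pi * rad ^+ 2)^-1)%:E <=
   \int[lebesgue_measure]_(th in arc_dom z v t) rho2 (arc_map z v t th))%E.
Proof.
move=> ht; have t0 : 0 < t by move: ht => /andP[h _]; apply: lt_le_trans h.
set I := integral _ _ _.
pose k := 2 * pi * rad; have k0 : 0 < k by rewrite !mulr_gt0.
have mD := measurable_arc_dom z v t.
have amgm x : (rho x <= k%:E * rho2 x + ((4 * k)^-1)%:E)%E.
  have := rho0 x; rewrite /rho2; case: (rho x) => [r| |//].
    rewrite -!EFinM -EFinD !lee_fin => r0.
    have : 0 <= k * (r - (2 * k)^-1) ^+ 2 by rewrite mulr_ge0 ?sqr_ge0// ltW.
    have -> : k * (r - (2 * k)^-1) ^+ 2 = k * (r * r) + (4 * k)^-1 - r.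
      by field; rewrite gt_eqF.
    by rewrite subr_ge0.
  by move=> _; rewrite mulyy gt0_muley ?lte_fin// addye// ?leey.
have I0 : (0 <= I)%E by apply: integral_ge0.
have step : (\int[lebesgue_measure]_(th in arc_dom z v t) rho (arc_map z v t th) <=
    k%:E * I + ((4 * rad)^-1)%:E)%E.
  apply: (@le_trans _ _ (\int[lebesgue_measure]_(th in arc_dom z v t)
     (k%:E * rho2 (arc_map z v t th) + ((4 * k)^-1)%:E))%E).
    by apply: ge0_le_integral_nomeas => th _; [exact: rho0|exact: amgm].
  rewrite ge0_integralD//; last 3 first.
  - by move=> th _; rewrite mule_ge0// lee_fin ltW.
  - apply: emeasurable_funM; first exact: measurable_cst.
    exact: measurable_funS (measurable_rho2 t).
  - by move=> th _; rewrite lee_fin invr_ge0 mulr_ge0// ltW.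
  rewrite ge0_integralZl//; last 2 first.
  - exact: measurable_funS (measurable_rho2 t).
  - by rewrite lee_fin ltW.
  apply: leeD2l; rewrite integral_cst//=.
  apply: (@le_trans _ _ (((4 * k)^-1)%:E * (pi *+ 2)%:E)%E).
    apply: lee_wpmul2l; first by rewrite lee_fin invr_ge0 mulr_ge0// ltW.
    apply: (@le_trans _ _ (lebesgue_measure [set` `[0, pi *+ 2 : R]])).
      by apply: le_measure; rewrite ?inE//; exact: subIsetl.
    by rewrite lebesgue_measure_itv/= lte_fin pmulrn_lgt0// pi0 oppr0 addr0.
  rewrite -EFinM lee_fin /k mulr2n le_eqVlt; apply/orP; left; apply/eqP.
  by move: (pi : R) pi0 => w w0; field; rewrite !gt_eqF.
have ge1 := arc_integral_ge1 ht.
have : (1 <= (2 * rad)%:E * (k%:E * I + ((4 * rad)^-1)%:E))%E.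
  apply: le_trans ge1 _; apply: (@le_trans _ _ (t%:E * (k%:E * I + ((4 * rad)^-1)%:E))%E).
    by apply: lee_wpmul2l => //; rewrite lee_fin ltW.
  apply: lee_wpmul2r; last by rewrite lee_fin; case/andP: ht.
  by rewrite adde_ge0// ?mule_ge0// lee_fin ?invr_ge0 ?mulr_ge0// ltW.
clear step; clearbody I; move: I0; case: I => [i| |//]; last by move=> *; rewrite leey.
have -> : (k%:E * i%:E + ((4 * rad)^-1)%:E)%E = (k * i + (4 * rad)^-1)%:E by [].
rewrite -EFinM !lee_fin /k => i0.
have -> : 2 * rad * (2 * pi * rad * i + (4 * rad)^-1) = 4 * pi * rad ^+ 2 * i + 2^-1.
  by move: (pi : R) => w; field; rewrite gt_eqF.
move=> h; rewrite -div1r ler_pdivrMr ?mulr_gt0 ?exprn_gt0//; lra.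
Qed.

Let G (w : W) : \bar R := rho2 (dpt (cpt v (val z) w.1 w.2)).
Let box : set W := ([set` `[rad, 2 * rad]] `*` [set` `[0, pi *+ 2]]) `&`
  [set w | sqn (cpt v (val z) w.1 w.2) <= 1].

Let mG : measurable_fun setT G.
Proof.
apply: emeasurable_funM => _ B mB; rewrite setTI;
apply: (measurable_dpt_preimage (measurable_cpt1 z v) (measurable_cpt2 z v) (A := rho @^-1` B));
exact: mrho.
Qed.

Let mbox : measurable box.
Proof.
apply: measurableI; first by apply: measurableX.
exact: (measurable_in_disc (measurable_cpt1 z v) (measurable_cpt2 z v)).
Qed.

Let mGD D : measurable D -> measurable_fun setT (G \_ D).
Proof. by move=> mD; apply/(measurable_restrictT _ mD); exact: measurable_funS mG. Qed.

Let G0 w : (0 <= G w)%E. Proof. exact: rho2_ge0. Qed.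
Let GD0 D w : (0 <= (G \_ D) w)%E. Proof. by rewrite /patch; case: ifP. Qed.

Let rho2_borel : mborel_fun (@ddisc R) rho2.
Proof.
move=> B mB.
have -> : rho2 @^-1` B = rho @^-1` ((fun y : \bar R => y * y)%E @^-1` B) by [].
apply: mrho; rewrite -[X in measurable X]setTI.
by apply: (emeasurable_funM (f := idfun) (g := idfun)) => //; exact: measurable_id.
Qed.

(** The radii fill an interval of length [rad], which turns the bound [1 / (8 pi rad ^ 2)] on each
    circle into [1 / (8 pi rad)]. *)
Let fubini_ge : (((8 * pi * rad)^-1)%:E <= \int[mu]_w (G \_ box) w)%E.
Proof.
rewrite (fubini_tonelli1 _ (mGD mbox) (GD0 box)).
have h1 : (((8 * pi * rad)^-1)%:E <=
    \int[lebesgue_measure]_(t in [set` `[rad, (2 * rad)%R]]) ((8 * pi * rad ^+ 2)^-1)%:E)%E.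
  rewrite integral_cst//= lebesgue_measure_itv/= lte_fin.
  have -> : rad < 2 * rad by move: rad0; lra.
  rewrite -EFinD -EFinM lee_fin le_eqVlt; apply/orP; left; apply/eqP.
  by move: (pi : R) pi0 => w w0; field; rewrite !gt_eqF.
apply: le_trans h1 _.
rewrite integral_mkcond; apply: ge0_le_integral_nomeas => t _.
  by rewrite /patch; case: ifP => // _; rewrite lee_fin invr_ge0 !mulr_ge0 ?exprn_ge0// ltW.
rewrite /patch; case: ifPn => [/set_mem/= ht|_]; last first.
  by apply: integral_ge0 => th _; exact: GD0.
rewrite in_itv/= in ht; apply: le_trans (arc_integral_sqr ht) _.
rewrite integral_mkcond /fubini_F; apply: ge0_le_integral_nomeas => th _.
  by rewrite /patch; case: ifP.
rewrite /patch; case: ifPn => [/set_mem[/= h1 h2]|_]; last exact: GD0.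
rewrite mem_set// /box; by split.
Qed.

(** Two half-turns cover the box, so [1 / (8 pi rad) <= 2 * (64 / (pi rad)) * I]; the radius cancels
    and leaves [1 / 1024]. *)
Let int_ge : ((1024^-1)%:E <= int_H2 (@ddisc R) rho2)%E.
Proof.
pose D1 := polar_dom z v rad 0; pose D2 := polar_dom z v rad pi.
have mD1 : measurable D1 by exact: measurable_polar_dom.
have mD2 : measurable D2 by exact: measurable_polar_dom.
set I := int_H2 _ _.
have I0 : (0 <= I)%E.
  by apply: ereal_sup_ubound; exists 0%N, (fun=> set0); split => //; rewrite big_ord0.
pose K : R := 64 / (pi * rad); have K0 : 0 < K by rewrite divr_gt0// mulr_gt0.
have h1 : (\int[mu]_w (G \_ D1) w <= K%:E * I)%E.
  by rewrite -integral_mkcond; exact: (polar_integral_le z v1 _ rad0 rho2_ge0 rho2_borel).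
have h2 : (\int[mu]_w (G \_ D2) w <= K%:E * I)%E.
  by rewrite -integral_mkcond; exact: (polar_integral_le z v1 _ rad0 rho2_ge0 rho2_borel).
have : (\int[mu]_w (G \_ box) w <= K%:E * I + K%:E * I)%E.
  apply: (@le_trans _ _ (\int[mu]_w ((G \_ D1) w + (G \_ D2) w))%E); last first.
    by rewrite ge0_integralD//; [exact: leeD|exact: mGD|exact: mGD].
  apply: ge0_le_integral_nomeas => w _; first exact: GD0.
  rewrite {1}/patch; case: ifPn => [/set_mem[[/= w1 w2] w3]|_]; last by rewrite adde_ge0.
  have [wp|pw] := leP w.2 pi.
    rewrite {1}/patch mem_set ?leeDl//; split => //; split => //=.
    by move: w2; rewrite !in_itv/= add0r => /andP[-> _].
  rewrite addeC {1}/patch mem_set ?leeDl//; split => //; split => //=.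
  by move: w2; rewrite !in_itv/= -mulr2n (ltW pw) => /andP[_ ->].
move=> /(le_trans fubini_ge); clear h1 h2; clearbody I; move: I0; case: I => [i| |//]; last by move=> *; rewrite leey.
have -> : (K%:E * i%:E + K%:E * i%:E)%E = (K * i + K * i)%:E by [].
rewrite !lee_fin /K => i0 h.
have := ler_wpM2l (ltW (mulr_gt0 pi0 rad0)) h.
have -> : pi * rad * (8 * pi * rad)^-1 = 8^-1 :> R.
  by move: (pi : R) pi0 => w w0; field; rewrite !gt_eqF.
have -> : pi * rad * (64 / (pi * rad) * i + 64 / (pi * rad) * i) = 128 * i :> R.
  by move: (pi : R) pi0 => w w0; field; rewrite !gt_eqF.
lra.
Qed.

Lemma admissible_int_ge : ((1024^-1)%:E <= int_H2 (@ddisc R) (fun x => rho x * rho x)%E)%E.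
Proof. exact: int_ge. Qed.

End Admissible.

Lemma MOD_circles_ge : ((1024^-1)%:E <= MOD (@ddisc R) (crossing_family E F))%E.
Proof.
have [v [zn [v1 zn0 zE]]] := unit_direction (val z).
apply: le_ereal_inf_tmp => _ [rho [rho0 [mrho adm]] <-].
exact: (admissible_int_ge v1 zn0 zE).
Qed.

End ModulusLowerBound.

(** * Continua *)

(** The local hypothesis carries [P] across the supremum of the points up to [x] where it holds. The
    principle serves for compactness, connectedness and boundedness alike. *)
Lemma segment_induction (R : realType) (a b : R) (P : R -> Prop) : P a ->
  (forall t, a <= t <= b -> exists2 e, 0 < e &
     forall x y, a <= x <= b -> a <= y <= b -> `|x - t| < e -> `|y - t| < e -> P x -> P y) ->
  forall x, a <= x <= b -> P x.
Proof.
move=> Pa loc x /andP[ax xb].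
pose S := [set t | a <= t <= x /\ P t].
have Sa : S a by split => //; rewrite lexx.
have ubS : has_ubound S by exists x => t [/andP[]].
pose s := sup S.
have s1 : a <= s by apply: ub_le_sup.
have s2 : s <= x by apply: ge_sup; [exists a|move=> t [/andP[]]].
have sab : a <= s <= b by rewrite s1 (le_trans s2).
have [e e0 he] := loc s sab.
have [t [/andP[at1 tx] Pt] st] := sup_adherent e0 (conj (ex_intro _ _ Sa) ubS).
have ts : t <= s by apply: ub_le_sup => //; split => //; apply/andP.
rewrite -/s in st.
pose y := Num.min x (s + e / 2).
have ys : s <= y by rewrite le_min s2/=; lra.
have yx : y <= x by rewrite ge_min lexx.
have Py : P y.
  apply: (he t y) => //.
  - by rewrite at1 (le_trans tx).
  - by rewrite (le_trans s1)// (le_trans yx).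
  - by rewrite ler0_norm ?opprB; lra.
  - have : y <= s + e / 2 by rewrite ge_min lexx orbT.
    by rewrite ger0_norm ?subr_ge0//; lra.
have : y <= s by apply: ub_le_sup => //; split => //; rewrite (le_trans s1).
rewrite le_eqVlt ltNge ys orbF => /eqP ysE.
have : y = x by rewrite /y; case: (leP x (s + e / 2)) ysE; rewrite /y => // h; rewrite min_r ?(ltW h)//; lra.
by move=> <-.
Qed.

Section Continua.
Context {R : realType} {T : Type}.
Variable d : T -> T -> R.

Let fincover (F : set (set T)) (K : set T) := exists (n : nat) (V : 'I_n -> set T),
  (forall i, F (V i)) /\ K `<=` [set y | exists i, V i y].

Let fincoverU F K1 K2 : fincover F K1 -> fincover F K2 -> fincover F (K1 `|` K2).
Proof.
move=> [n1 [V1 [F1 h1]]] [n2 [V2 [F2 h2]]].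
exists (n1 + n2)%N, (fun i => match fintype.split i with inl j => V1 j | inr j => V2 j end); split.
  by move=> i; case: fintype.split.
move=> y [/h1[i Vi]|/h2[i Vi]].
  by exists (lshift n2 i); case: split_ordP => j; [move/lshift_inj => <-|move/eqP; rewrite eq_lrshift].
by exists (rshift n1 i); case: split_ordP => j; [move/eqP; rewrite eq_rlshift|move/rshift_inj => <-].
Qed.

Let fincover1 (F : set (set T)) (U : set T) : F U -> fincover F U.
Proof. by move=> FU; exists 1%N, (fun=> U); split => // y Uy; exists ord0. Qed.

Let fincoverS F K1 K2 : K1 `<=` K2 -> fincover F K2 -> fincover F K1.
Proof. by move=> K12 [n [V [FV h]]]; exists n, V; split => // y /K12/h. Qed.

(** Both halves are inductions along the segment: compactness propagates a finite subcover of the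
    path up to [x], and connectedness propagates the membership of [g x] in [U]. *)
Lemma continuum_path (g : R -> T) (a b : R) : a <= b -> continuous_on d g a b ->
  continuum d (g @` [set t | a <= t <= b]).
Proof.
move=> ab gc; have hom (U : set T) t : mopen d U -> a <= t <= b -> U (g t) ->
    exists2 e, 0 < e & forall x, a <= x <= b -> `|x - t| < e -> U (g x).
  move=> oU tab Ut; have [r r0 hr] := oU _ Ut; have [e e0 he] := gc _ tab _ r0.
  by exists e => // x xab xt; apply: hr; exact: he.
split; [|split].
- move=> F oF KF; rewrite -/(fincover F _).
  suff h x : a <= x <= b -> fincover F (g @` [set t | a <= t <= x]).
    by apply: h; rewrite ab lexx.
  move: x; apply: (segment_induction (P := fun x => fincover F (g @` [set t | a <= t <= x]))).
    have [|U FU Ua] := KF (g a); first by exists a; rewrite /= ?lexx.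
    apply: fincoverS (fincover1 FU) => _ [t /= /andP[at1 ta] <-].
    by have -> : t = a by apply/eqP; rewrite eq_le ta.
  move=> t tab; have [|U FU Ut] := KF (g t); first by exists t.
  have [e e0 he] := hom _ _ (oF _ FU) tab Ut; exists e => // x y xab yab xt yt Px.
  apply: fincoverS (fincoverU Px (fincover1 FU)) => _ [s /= /andP[as1 sy] <-].
  have [sx|xs] := leP s x; first by left; exists s => //; rewrite /= as1.
  right; apply: he; first by rewrite as1 (le_trans sy)//; case/andP: yab.
  by move: xt yt; rewrite !ltr_norml => /andP[? ?] /andP[? ?]; apply/andP; split; lra.
- have key U V : mopen d U -> mopen d V -> g @` [set t | a <= t <= b] `<=` U `|` V ->
      g @` [set t | a <= t <= b] `&` U `&` V = set0 -> U (g a) ->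
      g @` [set t | a <= t <= b] `&` V = set0.
    move=> oU oV KUV UV0 Ua.
    have Ux : forall x, a <= x <= b -> U (g x).
      apply: (segment_induction (P := fun x => U (g x))) => // t tab.
      have [Ut|Vt] := KUV (g t) (imageP g tab).
        by have [e e0 he] := hom _ _ oU tab Ut; exists e => // x y _ yab _ yt _; exact: he.
      have [e e0 he] := hom _ _ oV tab Vt; exists e => // x y xab _ xt _ Ux.
      exfalso; have : (g @` [set t | a <= t <= b] `&` U `&` V) (g x).
        by split; [split => //; exists x|exact: he].
      by rewrite UV0.
    apply/seteqP; split => // _ [[x xab <-] Vx]; rewrite -UV0.
    by split => //; split; [exists x|exact: Ux].
  move=> U V oU oV KUV UV0.
  have aab : a <= a <= b by rewrite lexx.
  have [Ua|Va] := KUV (g a) (imageP g aab).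
    by right; exact: (key U V).
  left; apply: (key V U) => //; first by rewrite (setUC V).
  by rewrite -setIA (setIC V) setIA.
- by exists (g a); exists a; rewrite /= ?lexx.
Qed.

Lemma continuumU (K1 K2 : set T) x : continuum d K1 -> continuum d K2 -> K1 x -> K2 x ->
  continuum d (K1 `|` K2).
Proof.
move=> [c1 [n1 _]] [c2 [n2 _]] K1x K2x; split; [|split]; last by exists x; left.
  move=> F oF KF; apply: fincoverU; [apply: c1 => //|apply: c2 => //].
    by move=> y K1y; apply: KF; left.
  by move=> y K2y; apply: KF; right.
have key U V : mopen d U -> mopen d V -> K1 `|` K2 `<=` U `|` V ->
    (K1 `|` K2) `&` U `&` V = set0 -> U x -> (K1 `|` K2) `&` V = set0.
  move=> oU oV KUV UV0 Ux.
  have one K : mconnected d K -> K x -> K `<=` K1 `|` K2 -> K `&` V = set0.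
    move=> nK Kx KK; have [||KU|//] := nK U V oU oV.
    - by move=> y /KK/KUV.
    - by apply/seteqP; split => // y [[/KK Ky Uy] Vy]; rewrite -UV0; split.
    - by have : (K `&` U) x by []; rewrite KU.
  have h1 : K1 `&` V = set0 by apply: one => // y; left.
  have h2 : K2 `&` V = set0 by apply: one => // y; right.
  by rewrite setIUl h1 h2 setU0.
move=> U V oU oV KUV UV0; have [Ux|Vx] := KUV x (or_introl K1x).
  by right; exact: (key U V).
left; apply: (key V U) => //; first by rewrite (setUC V).
by rewrite -setIA (setIC V) setIA.
Qed.

(** An intermediate value theorem: if the value [c] were omitted, the open sets [f < c] and [c < f]
    would disconnect [K]. *)
Lemma mconnected_crossing (K : set T) (f : T -> R) (c : R) y1 y2 : mconnected d K ->
  mopen d [set y | f y < c] -> mopen d [set y | c < f y] ->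
  K y1 -> K y2 -> f y1 <= c <= f y2 -> exists2 y, K y & f y = c.
Proof.
move=> nK ol og K1 K2 /andP[f1 f2]; apply: contrapT => /forall2NP no.
have ne y : K y -> f y != c by move=> Ky; apply/eqP; case: (no y).
have [||KU|KU] := nK _ _ ol og.
- by move=> y /ne; rewrite neq_lt => /orP[h|h]; [left|right].
- by apply/seteqP; split => // y [[_ /= h1] /= h2]; have := lt_trans h1 h2; rewrite ltxx.
- have : (K `&` [set y | f y < c]) y1 by split => //=; rewrite lt_neqAle f1 ne.
  by rewrite KU.
- have : (K `&` [set y | c < f y]) y2 by split => //=; rewrite lt_neqAle f2 eq_sym ne.
  by rewrite KU.
Qed.

End Continua.

Section ContinuousMaps.
Context {R : realType} {T1 T2 : Type}.
Variables (d1 : T1 -> T1 -> R) (d2 : T2 -> T2 -> R) (f : T1 -> T2).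
Hypothesis fc : mcontinuous d1 d2 f.

Lemma mopen_preimage (U : set T2) : mopen d2 U -> mopen d1 (f @^-1` U).
Proof.
move=> oU x Ux; have [r r0 hr] := oU _ Ux; have [e e0 he] := fc x r0.
by exists e => // y xy; apply: hr; exact: he.
Qed.

Lemma continuous_on_comp (g : R -> T1) a b : continuous_on d1 g a b ->
  continuous_on d2 (f \o g) a b.
Proof.
move=> gc t tab e e0; have [e' e'0 he'] := fc (g t) e0; have [del del0 h] := gc t tab e' e'0.
by exists del => // s sab st; apply: he'; exact: h.
Qed.

Lemma is_curve_comp (g : curve R T1) : is_curve d1 g -> is_curve d2 (Curve (cdom g) (f \o cmap g)).
Proof.
move=> [gn gc]; split => // t tg e e0; have [e' e'0 he'] := fc (cmap g t) e0.
have [del del0 h] := gc t tg e' e'0.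
by exists del => // s sg st; apply: he'; exact: h.
Qed.

End ContinuousMaps.

(** * Weak quasisymmetry *)

Section DiscBounds.
Context {R : realType}.

Let e1 : R * R := (1, 0).
Let e1_unit : sqn e1 = 1.
Proof. by rewrite /sqn/= expr1n expr0n addr0. Qed.

Let pol (s th : R) : cdisc R := dpt (cpt e1 (0, 0) s th).

Let sqn_pol s th : 0 <= s <= 1 -> sqn (cpt e1 (0, 0) s th) <= 1.
Proof.
move=> /andP[s0 s1]; have z0 : (0, 0) = 0 *: e1 :> R * R by rewrite scale0r.
rewrite (sqn_cpt e1_unit z0) expr0n mulr0 mul0r !add0r.
by rewrite expr_le1.
Qed.

Let ddisc_pol s th s' th' : 0 <= s <= 1 -> 0 <= s' <= 1 ->
  ddisc (pol s th) (pol s' th') <= `|s - s'| + `|th - th'|.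
Proof.
move=> hs hs'; rewrite ddiscE !dptK ?sqn_pol//.
apply: le_trans (edist_triangle _ (cpt e1 (0, 0) s' th) _) _.
rewrite (edist_cpt_radial _ e1_unit) lerD2l.
move: hs' => /andP[s0 s1]; apply: le_trans (edist_cpt_le _ e1_unit _ _ s0) _.
by rewrite ler_piMl.
Qed.

Let pol_surj (p : cdisc R) : exists s th,
  [/\ 0 <= s <= 1, 0 <= th <= pi *+ 2 & pol s th = p].
Proof.
pose s := edist (0, 0) (val p).
have s0 : 0 <= s := edist_ge0 _ _.
have s1 : s <= 1 by rewrite edist_le// expr1n add0r sqnN disc_sqn.
have [sE|sn] := eqVneq s 0.
  exists 0, 0; rewrite lexx ler01 mulrn_wge0 ?pi_ge0//; split => //.
  apply: val_inj; rewrite dptK ?sqn_pol ?lexx ?ler01//.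
  by rewrite /cpt !mul0r !addr0; exact: edist_eq0.
have sp : 0 < s by rewrite lt_neqAle eq_sym sn.
have [th hth pE] := circle_param e1_unit sp (erefl : edist (0, 0) (val p) = s).
by exists s, th; rewrite s0 s1 hth /pol -pE valKdpt.
Qed.

(** A tube argument in polar coordinates: induction on the radius at a fixed angle bounds a sector
    around that angle, and induction on the angle joins the sectors. *)
Lemma disc_image_bounded (T : Type) (d : T -> T -> R) (u : cdisc R -> T) (x0 : T) :
  is_metric d -> mcontinuous (@ddisc R) d u -> exists M, forall p, d x0 (u p) <= M.
Proof.
move=> [_ [_ [_ dtri]]] uc; pose f s th := d x0 (u (pol s th)).
have loc s0 th0 : 0 <= s0 <= 1 -> exists2 e, 0 < e & forall s th, 0 <= s <= 1 ->
    `|s - s0| < e -> `|th - th0| < e -> f s th <= f s0 th0 + 1.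
  move=> hs0; have [e e0 he] := uc (pol s0 th0) 1 ltr01.
  exists (e / 2); first by rewrite divr_gt0.
  move=> s th hs h1 h2; apply: le_trans (dtri _ (u (pol s0 th0)) _) _.
  rewrite lerD2l; apply/ltW/he; apply: le_lt_trans (ddisc_pol _ _ hs0 hs) _.
  by rewrite distrC (distrC th0); lra.
have tube th0 : exists2 e, 0 < e & exists M, forall s th, 0 <= s <= 1 ->
    `|th - th0| < e -> f s th <= M.
  pose P x := exists2 e, 0 < e & exists M, forall s th, 0 <= s <= x -> s <= 1 ->
    `|th - th0| < e -> f s th <= M.
  suff [e e0 [M hM]] : P 1.
    by exists e => //; exists M => s th hs; apply: hM => //; case/andP: hs.
  apply: (@segment_induction _ 0 1); last by rewrite ler01 lexx.
    have [|e e0 he] := loc 0 th0; first by rewrite lexx ler01.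
    exists e => //; exists (f 0 th0 + 1) => s th s00 s1 hth.
    have -> : s = 0 by apply/eqP; rewrite eq_le andbC.
    by apply: he; rewrite ?lexx ?ler01// subrr normr0.
  move=> s0 hs0; have [e e0 he] := loc s0 th0 hs0.
  exists e => // x y hx hy xs ys [e' e'0 [M hM]].
  exists (Num.min e e'); first by rewrite lt_min e0.
  exists (Num.max M (f s0 th0 + 1)) => s th /andP[s1 sy] sle1.
  rewrite lt_min => /andP[h1 h2]; rewrite le_max.
  have [sx|xs'] := leP s x; first by rewrite hM// s1.
  apply/orP; right; apply: he => //; first by rewrite s1.
  by move: xs ys; rewrite !ltr_norml => /andP[? ?] /andP[? ?]; apply/andP; split; lra.
have pi20 : 0 <= pi *+ 2 :> R by rewrite mulrn_wge0// pi_ge0.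
suff [M hM] : exists M, forall s th, 0 <= s <= 1 -> 0 <= th <= pi *+ 2 -> f s th <= M.
  by exists M => p; have [s [th [hs hth <-]]] := pol_surj p; exact: hM.
apply: (@segment_induction _ 0 (pi *+ 2)
  (fun y => exists M, forall s th, 0 <= s <= 1 -> 0 <= th <= y -> f s th <= M)).
- have [e e0 [M hM]] := tube 0; exists M => s th hs hth; apply: hM => //.
  have -> : th = 0 by apply/eqP; rewrite eq_le andbC.
  by rewrite subrr normr0.
- move=> th0 _; have [e e0 [M' hM']] := tube th0; exists e => // x y hx hy xt yt [M hM].
  exists (Num.max M M') => s th hs /andP[th1 thy]; rewrite le_max.
  have [thx|xth] := leP th x; first by rewrite hM// th1.
  rewrite hM' ?orbT//.
  by move: xt yt; rewrite !ltr_norml => /andP[? ?] /andP[? ?]; apply/andP; split; lra.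
- by rewrite pi20 lexx.
Qed.

Lemma ddisc_le2 (p q : cdisc R) : ddisc p q <= 2.
Proof.
have [_ [_ [dsym dtri]]] := @ddisc_metric R.
apply: le_trans (dtri p disc_origin q) _.
have le1 (x : cdisc R) : ddisc disc_origin x <= 1.
  by rewrite ddiscE edist_le// expr1n /= add0r sqnN disc_sqn.
by rewrite dsym; have := le1 p; have := le1 q; lra.
Qed.

(* Any point is far from two of (1,0), (-1,0), (0,1), and [u z] is far from the image of one of these two. *)
Lemma far_point (T : Type) (d : T -> T -> R) (u : cdisc R -> T) :
  is_metric d -> injective u -> exists2 del, 0 < del & forall z a : cdisc R,
    exists2 w, 7 / 10 <= ddisc a w & del <= d (u z) (u w).
Proof.
move=> [dge0 [d0 [dsym dtri]]] uinj.
have [ege0 [_ [esym etri]]] := @ddisc_metric R.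
have s1 : sqn (1, 0) <= 1 :> R by rewrite /sqn/= expr1n expr0n addr0.
have s2 : sqn (-1, 0) <= 1 :> R by rewrite /sqn/= sqrrN expr1n expr0n addr0.
have s3 : sqn (0, 1) <= 1 :> R by rewrite /sqn/= expr1n expr0n add0r.
pose P1 := dpt (1, 0) : cdisc R; pose P2 := dpt (-1, 0) : cdisc R.
pose P3 := dpt (0, 1) : cdisc R.
(* [7 / 5] is a rational lower bound for the square root of 2, the least distance between the three
   points; a point within [7 / 10] of one of them is at least [7 / 10] away from the others. *)
have far p q : sqn p <= 1 -> sqn q <= 1 -> 2 <= sqn (p - q) -> 7 / 5 <= ddisc (dpt p) (dpt q).
  move=> hp hq h; rewrite ddiscE !dptK// -ler_sqr ?nnegrE ?edist_ge0 ?sqr_edist//.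
  by apply: le_trans h; lra.
have f12 : 7 / 5 <= ddisc P1 P2 by apply: far => //; rewrite /sqn/=; lra.
have f13 : 7 / 5 <= ddisc P1 P3 by apply: far => //; rewrite /sqn/=; lra.
have f23 : 7 / 5 <= ddisc P2 P3 by apply: far => //; rewrite /sqn/=; lra.
have pos p q : 7 / 5 <= ddisc p q -> 0 < d (u p) (u q).
  move=> h; rewrite lt_neqAle dge0 andbT eq_sym; apply/eqP => /d0/uinj pq.
  by move: h; rewrite pq ddiscE /edist subrr /sqn/= expr0n addr0 sqrtr0; lra.
pose m := Num.min (d (u P1) (u P2)) (Num.min (d (u P1) (u P3)) (d (u P2) (u P3))).
have m0 : 0 < m by rewrite !lt_min !pos.
exists (m / 2); first by rewrite divr_gt0.
move=> z a.
have pick p q : m <= d (u p) (u q) -> 7 / 10 <= ddisc a p -> 7 / 10 <= ddisc a q ->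
    exists2 w, 7 / 10 <= ddisc a w & m / 2 <= d (u z) (u w).
  move=> mpq hp hq; have [h|h] := leP (m / 2) (d (u z) (u p)); first by exists p.
  exists q => //; have := dtri (u p) (u z) (u q); rewrite (dsym (u p) (u z)); lra.
have near p q : 7 / 5 <= ddisc p q -> ddisc a p < 7 / 10 -> 7 / 10 <= ddisc a q.
  by move=> pq ap; have := etri p a q; rewrite (esym p a); lra.
have m12 : m <= d (u P1) (u P2) by rewrite ge_min lexx.
have m13 : m <= d (u P1) (u P3) by rewrite /m !ge_min lexx orbT.
have m23 : m <= d (u P2) (u P3) by rewrite /m !ge_min lexx !orbT.
have [h1|h1] := leP (7 / 10) (ddisc a P1); last first.
  by apply: (pick P2 P3) => //; [exact: near f12 h1|exact: near f13 h1].
have [h2|h2] := leP (7 / 10) (ddisc a P2); first exact: (pick P1 P2).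
by apply: (pick P1 P3) => //; exact: near f23 h2.
Qed.

End DiscBounds.

Section WeakQuasisymmetry.
Context {R : realType} {X : Type}.
Variables (dX : X -> X -> R) (L Q : R) (u : cdisc R -> X).
Hypothesis hX : is_metric dX.
Hypothesis L0 : 0 < L.
Hypothesis hball : forall (x : X) (r : R), 0 < r -> (H2 dX (mball dX x r) <= (L * r ^+ 2)%:E)%E.
Hypothesis Q0 : 0 < Q.
Hypothesis hu : homeomorphism (@ddisc R) dX u.
Hypothesis hmod : forall Gam : set (curve R (cdisc R)),
  (forall g, Gam g -> is_curve (@ddisc R) g) ->
  (MOD (@ddisc R) Gam <= Q%:E * MOD dX (comp_family u Gam))%E.
Hypothesis hLLC : LLC dX.

Lemma weak_quasisymmetry : exists2 H, 1 <= H & forall z a b : cdisc R,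
  ddisc z a <= ddisc z b / 16 -> dX (u z) (u a) <= H * dX (u z) (u b).
Proof.
have [g [gu ug uc gc]] := hu; have [dge0 [d0 [dsym dtri]]] := hX.
have [ege0 [e0 [esym etri]]] := @ddisc_metric R.
have [del del0 hdel] := far_point hX (can_inj gu).
have [M0 hM0] := disc_image_bounded (u disc_origin) hX uc.
pose M := 2 * `|M0| + 1.
have M_gt0 : 0 < M by rewrite /M; have := normr_ge0 M0; lra.
have hM p q : dX (u p) (u q) <= M.
  apply: le_trans (dtri _ (u disc_origin) _) _; rewrite dsym /M.
  by have := hM0 p; have := hM0 q; have := ler_norm M0; lra.
have [lam lam1 hL] := hLLC; have lam0 : 0 < lam by lra.
have [k k0 kE] : exists2 k : R, 0 < k & k = 1024 by exists 1024; rewrite ?ltr0n.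
have QL0 : 0 < 4 * (Q * L) by rewrite mulr_gt0// mulr_gt0.
(* This [n] makes [Q * (4 * L / n)] smaller than [1 / 1024], so that the two modulus bounds
   contradict each other. *)
have [n nR] : exists n, 4 * (Q * L) * k < n%:R.
  exists (Num.bound (4 * (Q * L) * k)); apply: archi_boundP.
  by rewrite mulr_ge0// ltW.
have n0 : 0 < n%:R :> R.
  by apply: le_lt_trans nR; rewrite mulr_ge0// ltW.
(* Distances in the image are at most [M], so this [c] satisfies [c * m <= Num.min m del] for each
   such distance [m]. *)
pose c := Num.min 1 (del / M); have c0 : 0 < c by rewrite lt_min ltr01 divr_gt0.
pose H := 2 ^+ n * (2 * lam ^+ 2) / c.
have H0 : 0 < H by rewrite divr_gt0// mulr_gt0 ?exprn_gt0// mulr_gt0 ?exprn_gt0.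
exists (Num.max 1 H); first by rewrite le_max lexx.
move=> z a b zab.
have [->|za0] := eqVneq z a.
  have -> : dX (u a) (u a) = 0 by apply/d0.
  by rewrite mulr_ge0// le_max ler01.
have r0 : 0 < ddisc z a.
  by rewrite lt_neqAle ege0 andbT eq_sym; apply/eqP => /e0/eqP; exact/negP.
set r := ddisc z a in zab r0.
have r8 : r <= 1 / 8 by have := ddisc_le2 z b; lra.
set s := dX (u z) (u b).
have s0 : 0 < s.
  rewrite lt_neqAle dge0 andbT eq_sym; apply/eqP => /d0/(can_inj gu) zb.
  have zz : ddisc z z = 0 by apply/e0.
  by move: zab; rewrite -zb zz; lra.
rewrite leNgt; apply/negP => hm.
have {}hm : H * s < dX (u z) (u a).
  by apply: le_lt_trans hm; rewrite ler_pM2r// le_max lexx orbT.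
have [w aw zw] := hdel z a.
set m := dX (u z) (u a) in hm.
(* Both [u a] and [u w] must lie outside the ball, and [del] is the guaranteed distance from [u z]
   to [u w]. *)
pose m' := Num.min m del.
have cm : c * m <= m'.
  have mM : m <= M := hM z a; have m0 : 0 <= m := dge0 _ _.
  rewrite /m' le_min; apply/andP; split; first by rewrite ler_piMl// /c ge_min lexx.
  have cd : c <= del / M by rewrite /c ge_min lexx orbT.
  have : c * m <= del / M * M by rewrite ler_pM// ltW.
  by rewrite divfK// gt_eqF.
have m'0 : 0 < m' by apply: lt_le_trans cm; rewrite mulr_gt0//; apply: lt_trans hm; rewrite mulr_gt0.
(* Balls are open and [u b] is at distance exactly [s], hence the radius [2 * s]. *)
have s20 : 0 < 2 * s by rewrite mulr_gt0.
have [in1 _] := hL (u z) _ s20; have [_ out1] := hL (u z) _ m'0.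
have uzz : dX (u z) (u z) = 0 by apply/d0.
have [E [[cE [nE _]] subE Ez Eb]] : exists K, [/\ continuum dX K,
    K `<=` mball dX (u z) (lam * (2 * s)), K (u z) & K (u b)].
  by apply: in1; rewrite /mball/= ?uzz// -/s; lra.
have [F [[cF [nF _]] subF Fa Fw]] : exists K, [/\ continuum dX K,
    K `<=` ~` mball dX (u z) (m' / lam), K (u a) & K (u w)].
  apply: out1; rewrite /mball/=; apply/negP; rewrite -leNgt /m' ge_min; first by rewrite -/m lexx.
  by rewrite zw orbT.
pose f y := ddisc z (g y).
have fo1 t : mopen dX [set y | f y < t].
  by change (mopen dX (g @^-1` [set x | ddisc z x < t])); apply: (mopen_preimage gc); exact: mopen_dist_lt (@ddisc_metric R) z t.
have fo2 t : mopen dX [set y | t < f y].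
  by change (mopen dX (g @^-1` [set x | t < ddisc z x])); apply: (mopen_preimage gc); exact: mopen_dist_gt (@ddisc_metric R) z t.
have zw2 : 2 * r <= ddisc z w.
  by have := etri a z w; rewrite (esym a z) -/r; lra.
(* Seen from [z] in the disc, [E] joins distance 0 to at least [16 * r] and [F] joins [r] to at
   least [2 * r]; by connectedness both meet every circle in between. *)
have meets t : r <= t <= 2 * r -> exists p q,
    [/\ (u @^-1` E) p, (u @^-1` F) q, ddisc z p = t & ddisc z q = t].
  move=> /andP[rt t2].
  have [|y1 Ey1 fy1] := mconnected_crossing (c := t) nE (fo1 t) (fo2 t) Ez Eb.
    rewrite /f !gu; have -> : ddisc z z = 0 by apply/e0.
    by apply/andP; split; lra.
  have [|y2 Fy2 fy2] := mconnected_crossing (c := t) nF (fo1 t) (fo2 t) Fa Fw.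
    by rewrite /f !gu -/r rt (le_trans t2).
  by exists (g y1), (g y2); rewrite /= !ug; split.
have lower := MOD_circles_ge r0 meets; rewrite -kE in lower.
have upper : (MOD dX (comp_family u (crossing_family (u @^-1` E) (u @^-1` F))) <=
    (4 * L / n%:R)%:E)%E.
  apply: (@MOD_annulus_le _ _ _ hX L (u z) (lam * (2 * s)) n) => //.
  - by rewrite mulr_gt0.
  - by rewrite -(ltr0n R).
  - by move=> j; apply: hball; rewrite mulr_gt0 ?exprn_gt0// mulr_gt0.
  move=> _ [h [ch [p [q [ph qh Ep Fq]]]] <-]; split; first exact (is_curve_comp uc ch).
  exists p, q; split => //; first exact: subE.
  have /negP := subF _ Fq; rewrite /mball/= -leNgt; apply: le_trans.
  rewrite ler_pdivlMr//; apply: le_trans cm.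
  have -> : 2 ^+ n * (lam * (2 * s)) * lam = c * (H * s).
    by rewrite /H; field; rewrite gt_eqF.
  by rewrite ler_pM2l// ltW.
have : ((k^-1)%:E <= Q%:E * (4 * L / n%:R)%:E)%E.
  apply: le_trans lower _; apply: le_trans (hmod _) _; first by move=> h [].
  by apply: lee_wpmul2l => //; rewrite lee_fin ltW.
rewrite -EFinM lee_fin leNgt => /negP; apply.
rewrite mulrA (mulrCA Q) ltr_pdivrMr// [ltRHS]mulrC ltr_pdivlMr//.
Qed.

End WeakQuasisymmetry.

(** * From weak quasisymmetry to quasisymmetry *)

Section PowerHomeomorphism.
Context {R : realType}.

(** A monotone bijection of the half-line has no jumps: the preimages of [f t - e / 2] and
    [f t + e / 2] bound a neighbourhood of [t]. When [f t < e] the lower bound follows from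
    nonnegativity. *)
Let mono_continuous (f g : R -> R) :
  (forall t, 0 <= t -> [/\ 0 <= f t, 0 <= g t, g (f t) = t & f (g t) = t]) ->
  (forall s t, 0 <= s -> s <= t -> f s <= f t) ->
  forall t, 0 <= t -> forall e, 0 < e -> exists2 del, 0 < del &
    forall s, 0 <= s -> `|s - t| < del -> `|f s - f t| < e.
Proof.
move=> fg mf t t0 e e0; have [ft0 _ _ _] := fg t t0.
have up0 : 0 <= f t + e / 2 by rewrite addr_ge0// divr_ge0// ltW.
have [_ t20 _ ft2] := fg _ up0; set t2 := g (f t + e / 2) in t20 ft2.
have tt2 : t < t2.
  rewrite ltNge; apply/negP => /(mf _ _ t20); rewrite ft2; lra.
have [t1 t1t ht1] : exists2 t1, t1 < t & forall s, 0 <= s -> t1 < s -> f t - e < f s.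
  have [lo|lo] := ltP (f t) e.
    by exists (t - 1); [lra|move=> s s0 _; have [fs0 _ _ _] := fg s s0; lra].
  have lo0 : 0 <= f t - e / 2 by lra.
  have [_ t10 _ ft1] := fg _ lo0; exists (g (f t - e / 2)).
    by rewrite ltNge; apply/negP => /(mf _ _ t0); rewrite ft1; lra.
  by move=> s s0 /ltW/(mf _ _ t10); rewrite ft1; lra.
exists (Num.min (t2 - t) (t - t1)); first by rewrite lt_min !subr_gt0 tt2.
move=> s s0; rewrite lt_min !ltr_norml => /andP[/andP[h1 h2] /andP[h3 h4]].
have s2 : f s <= f t2 by apply: mf => //; lra.
have s1 : f t - e < f s by apply: ht1 => //; lra.
by rewrite ft2 in s2; apply/andP; split; lra.
Qed.

Lemma homeo_halfline_mono (f g : R -> R) :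
  (forall t, 0 <= t -> [/\ 0 <= f t, 0 <= g t, g (f t) = t & f (g t) = t]) ->
  (forall s t, 0 <= s -> s <= t -> f s <= f t) ->
  (forall s t, 0 <= s -> s <= t -> g s <= g t) -> homeo_halfline f.
Proof.
move=> fg mf mg; exists g; split => //; split; first exact: (mono_continuous fg mf).
by apply: (mono_continuous (g := f)) => // t /fg[].
Qed.

Lemma nth_root_exists (n : nat) : (0 < n)%N ->
  exists nu : R -> R, forall x, 0 <= x -> 0 <= nu x /\ nu x ^+ n = x.
Proof.
move=> n0; exists (fun x => x `^ (n%:R^-1)) => x x0; split; first exact: powR_ge0.
rewrite -powR_mulrn ?powR_ge0// -powRrM mulVf ?powRr1// pnatr_eq0.
by rewrite -lt0n.
Qed.

(* [eta t = c t^(1/n)] for [t <= 1] and [eta t = c t^n] for [t >= 1] *)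
Lemma power_homeo (n : nat) (c : R) : (0 < n)%N -> 0 < c -> exists eta : R -> R,
  [/\ homeo_halfline eta,
   forall t x, 0 <= x -> t <= 1 -> x ^+ n <= t -> c * x <= eta t &
   forall t, 1 <= t -> c * t ^+ n <= eta t].
Proof.
move=> n0 c0; have [nu hnu] := nth_root_exists n0.
have nu0 x : 0 <= x -> 0 <= nu x by move=> /hnu[].
have nuK x : 0 <= x -> nu x ^+ n = x by move=> /hnu[].
have le_nu x y : 0 <= x -> x <= y -> nu x <= nu y.
  move=> x0 xy; have y0 := le_trans x0 xy.
  by rewrite -(ler_pXn2r n0) ?nnegrE ?nu0// !nuK.
have Knu x : 0 <= x -> nu (x ^+ n) = x.
  move=> x0; apply/eqP; rewrite -(eqrXn2 n0) ?nu0 ?exprn_ge0//.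
  by rewrite nuK ?exprn_ge0.
have nu1 : nu 1 = 1 by rewrite -[X in nu X](expr1n R n) Knu.
pose f t := c * (if t <= 1 then nu t else t ^+ n).
pose g y := if y / c <= 1 then (y / c) ^+ n else nu (y / c).
have big x : 1 < x -> 1 < x ^+ n.
  by move=> x1; rewrite exprn_egt1// -lt0n.
have bign x : 1 < x -> 1 < nu x.
  move=> x1; rewrite ltNge; apply/negP => h.
  have x0 : 0 <= x by lra.
  have : nu x ^+ n <= 1 by rewrite expr_le1// nu0.
  by rewrite nuK// leNgt x1.
exists f; split.
  apply: (@homeo_halfline_mono f g).
  - move=> t t0; rewrite /f /g; split.
    + by rewrite mulr_ge0 ?(ltW c0)//; case: ifP => _; [exact: nu0|exact: exprn_ge0].
    + have tc : 0 <= t / c by rewrite divr_ge0// ltW.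
      by case: ifP => _; [exact: exprn_ge0|exact: nu0].
    + rewrite mulrC mulKf ?gt_eqF//; case: (leP t 1) => [t1|t1].
        by rewrite -nu1 le_nu// nuK.
      by rewrite leNgt big//= Knu.
    + have tc : 0 <= t / c by rewrite divr_ge0// ltW.
      case: (leP (t / c) 1) => [t1|t1].
        by rewrite expr_le1// t1 Knu// mulrC divfK// gt_eqF.
      by rewrite leNgt bign//= nuK// mulrC divfK// gt_eqF.
  - move=> s t s0 st; rewrite /f ler_pM2l//.
    case: (leP s 1) => [s1|s1]; case: (leP t 1) => [t1|t1].
    + exact: le_nu.
    + by apply: (@le_trans _ _ 1); [rewrite -nu1; exact: le_nu|exact/ltW/big].
    + by have := lt_le_trans s1 st; rewrite ltNge t1.
    + by rewrite ler_pXn2r// nnegrE// (le_trans s0).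
  - move=> s t s0 st; rewrite /g.
    have sc : 0 <= s / c by rewrite divr_ge0// ltW.
    have stc : s / c <= t / c by rewrite ler_pM2r// invr_gt0.
    case: (leP (s / c) 1) => [s1|s1]; case: (leP (t / c) 1) => [t1|t1].
    + by rewrite ler_pXn2r// nnegrE// (le_trans sc).
    + by apply: (@le_trans _ _ 1); [rewrite expr_le1|exact/ltW/bign].
    + by have := lt_le_trans s1 stc; rewrite ltNge t1.
    + exact: le_nu.
  move=> t x x0 t1 xt; rewrite /f t1 ler_pM2l// -(Knu x)//.
  by apply: le_nu => //; exact: exprn_ge0.
move=> t t1; rewrite /f ler_pM2l//; case: (leP t 1) => // t1'.
have -> : t = 1 by apply/eqP; rewrite eq_le t1' t1.
by rewrite expr1n nu1.
Qed.

End PowerHomeomorphism.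

(** * Chaining and power-type distortion *)

Section Upgrade.
Context {R : realType} {X : Type}.
Variables (dX : X -> X -> R) (u : cdisc R -> X) (H : R).
Hypothesis hX : is_metric dX.
Hypothesis uinj : injective u.
Hypothesis H1 : 1 <= H.
Hypothesis weak : forall z a b : cdisc R,
  ddisc z a <= ddisc z b / 16 -> dX (u z) (u a) <= H * dX (u z) (u b).
Hypothesis dbl : doubling dX.

Let dge0 x y : 0 <= dX x y. Proof. by case: hX. Qed.
Let dxx x : dX x x = 0. Proof. by case: hX => _ [/(_ x x)[_ ->]]. Qed.
Let dsym x y : dX x y = dX y x. Proof. by case: hX => _ [_ []]. Qed.
Let dtri x y z : dX x z <= dX x y + dX y z. Proof. by case: hX => _ [_ []]. Qed.
Let ege0 (x y : cdisc R) : 0 <= ddisc x y. Proof. by case: (@ddisc_metric R). Qed.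
Let esym (x y : cdisc R) : ddisc x y = ddisc y x.
Proof. by case: (@ddisc_metric R) => _ [_ []]. Qed.
Let etri (x y z : cdisc R) : ddisc x z <= ddisc x y + ddisc y z.
Proof. by case: (@ddisc_metric R) => _ [_ []]. Qed.
Let eeq0 (x y : cdisc R) : ddisc x y = 0 -> x = y.
Proof. by case: (@ddisc_metric R) => _ [/(_ x y)[h _] _]. Qed.

(* Walk from [z] to [a] in steps of length at most [|z - b| / 512]: away from [b] each step is compared
   with the distance to [b], and points within [|z - b| / 16] of [b] are compared with [z] directly. *)
Lemma weak_factor2 : exists2 K, 1 <= K & forall z a b : cdisc R,
  ddisc z a <= 2 * ddisc z b -> dX (u z) (u a) <= K * dX (u z) (u b).
Proof.
have H0 : 0 <= H := le_trans ler01 H1.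
(* A segment of length at most [2 * r] cut into at least 1024 steps has steps of at most [r / 512],
   one sixteenth of the threshold [r / 32] below. *)
have [N hN] : exists N : nat, (1024 : R) <= N%:R by exists 1024%N.
have N0 : 0 < N%:R :> R by apply: lt_le_trans hN; rewrite ltr0n.
have H12 : 1 <= 1 + H by lra.
exists ((1 + H) ^+ N * (2 + H)).
  by rewrite mulr_ege1 ?exprn_ege1//; lra.
move=> z a b zab; set r := ddisc z b in zab *; set D := dX (u z) (u b).
have r0 : 0 <= r := ege0 _ _; have D0 : 0 <= D := dge0 _ _.
pose x (i : nat) := dseg z a (i%:R / N%:R).
have frac i : (i <= N)%N -> 0 <= (i%:R / N%:R : R) <= 1.
  by move=> iN; rewrite divr_ge0//= ler_pdivrMr// mul1r ler_nat.
have step i : (i < N)%N -> ddisc (x i) (x i.+1) <= r / 512.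
  move=> iN; rewrite /x ddisc_dseg ?frac// ?(ltnW iN)//.
  have -> : `|i%:R / N%:R - i.+1%:R / N%:R| = N%:R^-1 :> R.
    have -> : i%:R / N%:R - i.+1%:R / N%:R = - N%:R^-1 :> R.
      by rewrite -natr1; field; rewrite gt_eqF.
    by rewrite normrN gtr0_norm// invr_gt0.
  rewrite mulrC ler_pdivrMr//.
  have r512 : 0 <= r / 512 by rewrite divr_ge0 ?ler0n.
  have := ler_wpM2l r512 hN.
  by move: zab; set w := _ * N%:R; lra.
(* Adding [D] on the left makes the recursion multiplicative, since [dX (u (x i)) (u b) <= dX (u z)
   (u (x i)) + D]. *)
have main i : (i <= N)%N -> dX (u z) (u (x i)) + D <= (1 + H) ^+ i * (2 + H) * D.
  elim: i => [_|i IH iN].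
    by rewrite /x mul0r dseg0 dxx expr0 mul1r add0r ler_peMl//; lra.
  have {IH} := IH (ltnW iN); have st := step i iN.
  have [nr|fr] := leP (ddisc (x i) b) (r / 32).
    move=> _; have hb : ddisc b (x i.+1) <= ddisc b z / 16.
      rewrite (esym b z) -/r; apply: le_trans (etri _ (x i) _) _; rewrite (esym b); lra.
    have := weak hb; rewrite (dsym _ (u z)) -/D => h.
    have t := dtri (u z) (u b) (u (x i.+1)); rewrite -/D in t.
    apply: (@le_trans _ _ ((2 + H) * D)); first by lra.
    rewrite ler_wpM2r// ler_peMl//; first by lra.
    by rewrite exprn_ege1.
  move=> IH; have hb : ddisc (x i) (x i.+1) <= ddisc (x i) b / 16 by lra.
  have h := weak hb.
  have t1 := dtri (u z) (u (x i)) (u (x i.+1)).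
  have t2 := dtri (u (x i)) (u z) (u b); rewrite (dsym _ (u z)) -/D in t2.
  have h2 := ler_wpM2l H0 t2.
  have h3 := ler_wpM2l (le_trans ler01 H12) IH.
  rewrite exprS -!mulrA; rewrite -!mulrA in h3; apply: le_trans h3; lra.
have := main N (leqnn N); rewrite /x divff ?gt_eqF// dseg1; lra.
Qed.

Let cover_iter (N : nat) : (forall (x : X) (r : R), 0 < r ->
    exists c : 'I_N -> X, mball dX x (2 * r) `<=` [set y | exists i, mball dX (c i) r y]) ->
  forall k (x : X) (r : R), 0 < r -> exists (I : finType) (c : I -> X),
    (#|I| <= N ^ k)%N /\ mball dX x (2 ^+ k * r) `<=` [set y | exists i, mball dX (c i) r y].
Proof.
move=> hN; elim=> [|k IH] x r r0.
  exists 'I_1, (fun=> x); rewrite card_ord; split => // y; rewrite expr0 mul1r.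
  by exists ord0.
have r20 : 0 < 2 * r by rewrite mulr_gt0.
have [I [c [cI hI]]] := IH x _ r20.
have /choice[e he] : forall i, exists e : 'I_N -> X,
    mball dX (c i) (2 * r) `<=` [set y | exists j, mball dX (e j) r y].
  by move=> i; exact: hN.
exists (I * 'I_N)%type, (fun ij => e ij.1 ij.2); split.
  by rewrite card_prod card_ord expnSr leq_mul2r cI orbT.
move=> y; rewrite exprS (mulrC 2) -mulrA => /hI[i /he[j hj]].
by exists (i, j).
Qed.

(* The images of the points [z + 4^-i (b - z)] are separated by a multiple of [d (u z) (u a)] and lie in a
   ball of radius comparable to [d (u z) (u b)]; doubling bounds their number. *)
Lemma weak_contraction (K : R) : 1 <= K ->
  (forall z a b : cdisc R, ddisc z a <= 2 * ddisc z b -> dX (u z) (u a) <= K * dX (u z) (u b)) ->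
  exists2 t0, 0 < t0 & forall z a b : cdisc R,
    ddisc z a <= t0 * ddisc z b -> dX (u z) (u a) <= dX (u z) (u b) / 2.
Proof.
move=> K1 hK; have K0 : 0 < K by lra.
have [N hN] := dbl.
(* With [rho = D / (4 * K ^ 2)] below, this gives [K * D < 2 ^ k * rho], so all the image points lie
   in a ball covered by [N ^ k] balls of radius [rho]. *)
have [k hk] : exists k : nat, 4 * K ^+ 3 < 2 ^+ k.
  exists (Num.bound (4 * K ^+ 3)); apply: lt_trans (archi_boundP _) _.
    by rewrite mulr_ge0 ?exprn_ge0// ltW.
  by rewrite -natrX ltr_nat ltn_expl.
pose M := (N ^ k)%N; pose q : R := 4^-1.
have q0 : 0 < q by rewrite invr_gt0.
have q1 : q < 1 by rewrite /q invf_lt1// ltr1n.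
have qM0 i : 0 < q ^+ i by rewrite exprn_gt0.
have qM1 i : q ^+ i <= 1 by rewrite exprn_ile1// ltW.
(* The exponent [M] is the bound on the number of balls: the [M + 1] points [p 0, ..., p M] are too
   many for them, and all are at least as far from [z] as [a]. *)
exists (q ^+ M) => // z a b zab; rewrite leNgt; apply/negP => hm.
set D := dX (u z) (u b) in hm; set r := ddisc z b in zab.
have r0 : 0 <= r := ege0 _ _.
have D0 : 0 < D.
  rewrite lt_neqAle dge0 andbT eq_sym; apply/eqP => DE.
  have zb : z = b by apply: uinj; case: hX => _ [/(_ (u z) (u b))[h _] _]; exact: h.
  have rE : r = 0 by rewrite /r zb; case: (@ddisc_metric R) => _ [/(_ b b)[_ ->]].
  have za : z = a by apply: eeq0; apply/eqP; rewrite eq_le ege0 andbT; rewrite rE mulr0 in zab.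
  by move: hm; rewrite -za dxx DE mul0r ltxx.
pose rho := D / (4 * K ^+ 2).
have rho0 : 0 < rho by rewrite divr_gt0// mulr_gt0// exprn_gt0.
have [I [c [cI hI]]] := cover_iter hN k (u z) rho0.
pose p (i : nat) := dseg z b (q ^+ i).
have p01 i : 0 <= q ^+ i <= 1 by rewrite ltW// qM1.
have zp i : ddisc z (p i) = q ^+ i * r.
  rewrite -{1}(dseg0 z b) /p ddisc_dseg ?lexx ?ler01//.
  by rewrite sub0r normrN ger0_norm// ltW.
have inball (i : 'I_M.+1) : mball dX (u z) (2 ^+ k * rho) (u (p i)).
  rewrite /mball/=; apply: (@le_lt_trans _ _ (K * D)).
    by apply: hK; rewrite zp; have := ler_wpM2r r0 (qM1 i); rewrite -/r; lra.
  have : 4 * K ^+ 3 * rho < 2 ^+ k * rho by rewrite ltr_pM2r.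
  by apply: le_lt_trans; rewrite /rho le_eqVlt; apply/orP; left; apply/eqP; field; rewrite gt_eqF.
have /choice[s hs] : forall i : 'I_M.+1, exists j, mball dX (c j) rho (u (p i)).
  by move=> i; exact: (hI _ (inball i)).
(* From [D / 2 < dX (u z) (u a) <= K * dX (u z) (u (p j)) <= K ^ 2 * dX (u (p j)) (u (p i))]: two
   image points in one ball of radius [rho] would be closer. *)
have sep (i j : nat) : (i < j)%N -> (j <= M)%N -> 2 * rho < dX (u (p j)) (u (p i)).
  move=> ij jM.
  have za : dX (u z) (u a) <= K * dX (u z) (u (p j)).
    apply: hK; rewrite zp; apply: le_trans zab _.
    have : q ^+ M <= q ^+ j by rewrite ler_wiXn2l// ltW.
    move=> /(ler_wpM2r r0); have := mulr_ge0 (ltW (qM0 j)) r0; lra.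
  have qij : q ^+ j <= q ^+ i / 4.
    have : q ^+ j <= q ^+ i.+1 by rewrite ler_wiXn2l// ltW.
    by rewrite exprSr.
  have zj : dX (u (p j)) (u z) <= K * dX (u (p j)) (u (p i)).
    apply: hK; rewrite (esym _ z) zp /p ddisc_dseg// -/r.
    rewrite mulrA ler_wpM2r//; have := qM0 j; have := qM0 i.
    by rewrite distrC => ? ?; have := ler_norm (q ^+ i - q ^+ j); lra.
  rewrite dsym in zj.
  have h := ler_wpM2l (ltW K0) zj.
  have h2 : D / 2 < K ^+ 2 * dX (u (p j)) (u (p i)).
    by rewrite expr2 -mulrA; apply: lt_le_trans hm _; exact: le_trans za h.
  rewrite -(ltr_pM2l (exprn_gt0 2 K0)); apply: le_lt_trans h2.
  by rewrite /rho le_eqVlt; apply/orP; left; apply/eqP; field; rewrite gt_eqF.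
have sinj : injective s.
  move=> i j sij; apply/eqP; apply: contrapT => /negP ne.
  have close : dX (u (p i)) (u (p j)) < 2 * rho.
    apply: le_lt_trans (dtri _ (c (s i)) _) _; rewrite dsym.
    by have := hs i; have := hs j; rewrite -sij /mball/=; lra.
  move: ne; rewrite neq_ltn => /orP[ij|ji].
    have := sep i j ij (ltn_ord j); rewrite dsym; lra.
  have := sep j i ji (ltn_ord i); lra.
have := leq_card s sinj; rewrite card_ord => /leq_trans/(_ cI).
by rewrite ltnn.
Qed.

Lemma weak_to_quasisymmetric : exists eta : R -> R, homeo_halfline eta /\
  forall z a b (t : R), 0 <= t -> ddisc z a <= t * ddisc z b ->
    dX (u z) (u a) <= eta t * dX (u z) (u b).
Proof.
have [K K1 hK] := weak_factor2; have [t0 t00 ht0] := weak_contraction K1 hK.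
(* One exponent serves both ranges of [t]: [K <= 2 ^ n] bounds the growth for each doubling, and
   [2 ^ -n <= t0] yields a factor one half for each contraction by [2 ^ -n]. *)
have [n n0 [hn1 hn2]] : exists2 n, (0 < n)%N & K <= 2 ^+ n /\ (2 ^+ n)^-1 <= Num.min t0 2^-1.
  exists (Num.bound (K + t0^-1)).+1 => //.
  have h : K + t0^-1 < 2 ^+ (Num.bound (K + t0^-1)).+1.
    have p0 : 0 <= K + t0^-1 by rewrite addr_ge0 ?invr_ge0 ?(ltW t00)//; lra.
    apply: lt_trans (archi_boundP p0) _.
    by rewrite -natrX ltr_nat (ltn_trans (ltnSn _))// ltn_expl.
  have ti0 : 0 < t0^-1 by rewrite invr_gt0.
  split; first by lra.
  rewrite le_min; apply/andP; split.
    by rewrite -[leRHS]invrK lef_pV2 ?posrE ?exprn_gt0//; lra.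
  by rewrite lef_pV2 ?posrE ?exprn_gt0// exprS ler_peMr// exprn_ege1// ler1n.
(* For [t > 1] and [2 ^ k <= 2 * t], one has [K ^ (k + 1) <= (2 ^ (k + 1)) ^ n <= (4 * t) ^ n = c *
   t ^ n]; for [t <= 1], [c] absorbs the factor [2 * K]. *)
pose c : R := 2 ^+ n * 2 ^+ n.
have p2 m : 0 < 2 ^+ m :> R by rewrite exprn_gt0.
have c0 : 0 < c by rewrite mulr_gt0.
have c2K : 2 * K <= c.
  rewrite /c ler_pM//; first by lra.
  by rewrite -[leLHS]expr1 ler_weXn2l// ler1n.
have [eta [eh e1 e2]] := power_homeo n0 c0.
exists eta; split => // z a b t t_ge0 zab.
pose t1 : R := (2 ^+ n)^-1.
have t1_gt0 : 0 < t1 by rewrite invr_gt0.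
have t1_half : t1 <= 2^-1 by apply: le_trans hn2 _; rewrite ge_min lexx orbT.
have t1t0 : t1 <= t0 by apply: le_trans hn2 _; rewrite ge_min lexx.
have small k : forall b, ddisc z a <= t1 ^+ k * ddisc z b ->
    dX (u z) (u a) <= 2^-1 ^+ k * (K * dX (u z) (u b)).
  elim: k => [|k IH] b' hab.
    by rewrite !expr0 !mul1r in hab *; apply: hK; have := ege0 z b'; lra.
  pose b1 := dseg z b' t1.
  have t101 : 0 <= t1 <= 1 by rewrite ltW//=; lra.
  have zb1 : ddisc z b1 = t1 * ddisc z b'.
    rewrite -{1}(dseg0 z b') /b1 ddisc_dseg ?lexx ?ler01//.
    by rewrite sub0r normrN ger0_norm// ltW.
  have h1 : dX (u z) (u b1) <= dX (u z) (u b') / 2.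
    by apply: ht0; rewrite zb1 ler_wpM2r.
  have h2 := IH b1 _; apply: le_trans (h2 _) _; first by rewrite zb1 mulrA -exprSr.
  rewrite [in leRHS]exprSr -mulrA ler_pM2l ?exprn_gt0 ?invr_gt0//.
  by have := ler_wpM2l (le_trans ler01 K1) h1; lra.
have large k : forall a, ddisc z a <= 2 ^+ k * ddisc z b ->
    dX (u z) (u a) <= K ^+ k * (K * dX (u z) (u b)).
  elim: k => [|k IH] a' hab.
    by rewrite !expr0 !mul1r in hab *; apply: hK; have := ege0 z b; lra.
  have h01 : 0 <= (2^-1 : R) <= 1 by rewrite invr_ge0 invf_le1 ?ler1n ?ler0n.
  pose a1 := dseg z a' 2^-1.
  have za1 : ddisc z a1 = 2^-1 * ddisc z a'.
    rewrite -{1}(dseg0 z a') /a1 ddisc_dseg ?lexx ?ler01//.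
    by rewrite sub0r normrN ger0_norm// invr_ge0.
  have h1 : dX (u z) (u a') <= K * dX (u z) (u a1) by apply: hK; rewrite za1 mulrA mulfV// mul1r.
  apply: le_trans h1 _; rewrite exprS -mulrA ler_pM2l; last by lra.
  by apply: IH; rewrite za1; move: hab; rewrite exprS; lra.
have [t_le1|t_gt1] := leP t 1; last first.
  have [k /andP[tk kt]] : exists k, t <= 2 ^+ k <= 2 * t.
    have ex : exists k, t <= 2 ^+ k.
      exists (Num.bound t); apply/ltW/(lt_trans (archi_boundP t_ge0)).
      by rewrite -natrX ltr_nat ltn_expl.
    have [[|k] hk mink] := ex_minnP ex; first by exists 0%N; rewrite hk/= expr0; lra.
    exists k.+1; rewrite hk/= exprS ler_pM2l//; apply: ltW; rewrite ltNge; apply/negP => h.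
    by have := mink k h; rewrite ltnn.
  have h1 := large k a (le_trans zab (ler_wpM2r (ege0 _ _) tk)).
  apply: le_trans h1 _; rewrite mulrA -exprSr ler_wpM2r//.
  apply: le_trans (e2 t (ltW t_gt1)).
  apply: (@le_trans _ _ ((2 ^+ n) ^+ k.+1)).
    by rewrite ler_pXn2r ?nnegrE ?(ltW (p2 _))//; lra.
  rewrite -exprM mulnC exprM exprS.
  have -> : c * t ^+ n = (2 * (2 * t)) ^+ n by rewrite /c !exprMn mulrA.
  rewrite ler_pXn2r ?nnegrE ?mulr_ge0 ?(ltW (p2 _))//.
  by rewrite ler_pM2l.
have [t_eq0|t_neq0] := eqVneq t 0.
  have <- : z = a by apply: eeq0; apply/eqP; rewrite eq_le ege0 andbT; rewrite t_eq0 mul0r in zab.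
  by rewrite dxx mulr_ge0//; case: eh => ? [/(_ t t_ge0)[]].
have t_gt0 : 0 < t by rewrite lt_neqAle eq_sym t_neq0.
have [k /andP[k1 k2]] : exists k, t1 ^+ k.+1 <= t <= t1 ^+ k.
  have ex : exists k, t1 ^+ k.+1 <= t.
    exists (Num.bound t^-1); apply: (@le_trans _ _ (2^-1 ^+ (Num.bound t^-1).+1)).
      by rewrite ler_pXn2r ?nnegrE ?invr_ge0 ?(ltW t1_gt0).
    rewrite exprVn -[leRHS]invrK lef_pV2 ?posrE ?invr_gt0//.
    have ti0 : 0 <= t^-1 by rewrite invr_ge0.
    apply/ltW/(lt_trans (archi_boundP ti0)).
    by rewrite -natrX ltr_nat (ltn_trans (ltnSn _))// ltn_expl.
  have [[|k] hk mink] := ex_minnP ex; first by exists 0%N; rewrite hk/= expr0.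
  exists k.+1; rewrite hk/=; apply: ltW; rewrite ltNge; apply/negP => h.
  by have := mink k h; rewrite ltnn.
have h1 := small k b (le_trans zab (ler_wpM2r (ege0 _ _) k2)).
apply: le_trans h1 _; rewrite mulrA ler_wpM2r//.
have h2 : c * 2^-1 ^+ k.+1 <= eta t.
  apply: e1 => //.
  by apply: le_trans k1; rewrite /t1 -exprVn -!exprM mulnC.
apply: le_trans h2; rewrite exprS.
have w0 : 0 <= 2^-1 ^+ k :> R by rewrite exprn_ge0// invr_ge0.
by have := ler_wpM2r w0 c2K; lra.
Qed.

End Upgrade.

(** * Quasisymmetric images of the disc *)

Section DiscPaths.
Context {R : realType} {T : Type}.
Variables (d : T -> T -> R) (u : cdisc R -> T).
Hypothesis uc : mcontinuous (@ddisc R) d u.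

Lemma dseg_continuous_on (z a : cdisc R) (s t : R) : 0 <= s -> t <= 1 ->
  continuous_on (@ddisc R) (dseg z a) s t.
Proof.
move=> s0 t1 x /andP[sx xt] e e0; exists (e / 2); first by rewrite divr_gt0.
move=> y /andP[sy yt] yx; rewrite ddisc_dseg; last 2 first.
- by apply/andP; split; lra.
- by apply/andP; split; lra.
have h := ler_wpM2l (normr_ge0 (x - y)) (ddisc_le2 z a).
by rewrite distrC in yx; lra.
Qed.

Lemma segment_image_continuum (z a : cdisc R) (s : R) : 0 <= s -> s <= 1 ->
  continuum d ((u \o dseg z a) @` [set t | s <= t <= 1]).
Proof.
move=> s0 s1; apply: continuum_path => //; apply: (continuous_on_comp uc).
exact: dseg_continuous_on.
Qed.

Let ege0 (x y : cdisc R) : 0 <= ddisc x y. Proof. by case: (@ddisc_metric R). Qed.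

Lemma ddisc_dseg_start (z a : cdisc R) t : 0 <= t <= 1 -> ddisc z (dseg z a t) = t * ddisc z a.
Proof.
move=> t01; rewrite -{1}(dseg0 z a) ddisc_dseg ?lexx ?ler01//.
by rewrite sub0r normrN ger0_norm//; case/andP: t01.
Qed.

(* Go from [q] straight towards [o] down to the circle through [p], then along that circle to [p]. *)
Lemma join_outside (o p q : cdisc R) : 0 < ddisc o p -> ddisc o p <= ddisc o q ->
  exists K, [/\ continuum d K, K (u p), K (u q) &
    forall y, K y -> exists2 m, y = u m & ddisc o p <= ddisc o m].
Proof.
move=> op0 opq; set t := ddisc o p in op0 opq *.
have oq0 : 0 < ddisc o q := lt_le_trans op0 opq.
pose s := t / ddisc o q.
have s0 : 0 <= s by rewrite divr_ge0// ltW.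
have s1 : s <= 1 by rewrite /s ler_pdivrMr// mul1r.
have s01 : 0 <= s <= 1 by rewrite s0.
pose q' := dseg o q s.
have oq' : ddisc o q' = t by rewrite ddisc_dseg_start// /s divfK// gt_eqF.
have [v [zn [v1 zn0 zE]]] := unit_direction (val o).
have [a /andP[a0 a2] pE] := circle_param v1 op0 (erefl : edist (val o) (val p) = t).
have [b /andP[b0 b2] qE] := circle_param v1 op0 (oq' : edist (val o) (val q') = t).
have pa : arc_map o v t a = p by rewrite /arc_map -pE valKdpt.
have qb : arc_map o v t b = q' by rewrite /arc_map -qE valKdpt.
have sa : sqn (cpt v (val o) t a) <= 1 by rewrite -pE disc_sqn.
have sb : sqn (cpt v (val o) t b) <= 1 by rewrite -qE disc_sqn.
have [K1 [c1 K1p K1q h1]] : exists K, [/\ continuum d K, K (u p), K (u q') &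
    forall y, K y -> exists2 m, y = u m & t <= ddisc o m].
  have arc x y : 0 <= x -> x <= y -> y <= pi *+ 2 -> sqn (cpt v (val o) t x) <= 1 ->
      sqn (cpt v (val o) t y) <= 1 -> exists K, [/\ continuum d K, K (u (arc_map o v t x)),
        K (u (arc_map o v t y)) & forall w, K w -> exists2 m, w = u m & t <= ddisc o m].
    move=> x0 xy y2 hx hy; exists ((u \o arc_map o v t) @` [set th | x <= th <= y]); split.
    - apply: continuum_path => //; apply: (continuous_on_comp uc).
      apply: (is_curve_continuous_on (arc_curve_is_curve v1 zn0 zE op0 x0 xy y2 hx hy));
        by rewrite /= in_itv/= lexx xy.
    - by exists x; rewrite /= ?lexx.
    - by exists y; rewrite /= ?lexx ?xy.
    - move=> _ [th /= /andP[h1 h2] <-]; exists (arc_map o v t th) => //.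
      rewrite ddiscE dptK ?edist_cpt_center// ?(ltW op0)//.
      exact: (arc_in_disc v1 zn0 zE (ltW op0) x0 h1 h2 y2 hx hy).
  have [ab|/ltW ba] := leP a b.
    by have [K [cK Ka Kb hK]] := arc a b a0 ab b2 sa sb; exists K; rewrite -pa -qb; split.
  by have [K [cK Kb Ka hK]] := arc b a b0 ba a2 sb sa; exists K; rewrite -pa -qb; split.
exists (K1 `|` ((u \o dseg o q) @` [set x | s <= x <= 1])); split.
- apply: (continuumU c1 (segment_image_continuum _ _ s0 s1) K1q).
  by exists s; rewrite /= ?lexx.
- by left.
- by right; exists 1; rewrite /= ?lexx ?s1// dseg1.
- move=> y [/h1//|[x /= /andP[sx x1] <-]]; exists (dseg o q x) => //.
  rewrite ddisc_dseg_start; last by rewrite (le_trans s0).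
  by rewrite -ler_pdivrMr.
Qed.

End DiscPaths.

Lemma sum_lt_square (R : realFieldType) (A B w : R) :
  A < w -> B < w -> 0 <= w -> A + B < 2 ^+ 2 * w.
Proof. lra. Qed.

(** * Linear local connectivity and doubling of the image *)

Section QuasisymmetricImage.
Context {R : realType} {X : Type}.
Variables (dX : X -> X -> R) (u : cdisc R -> X) (eta : R -> R).
Hypothesis hX : is_metric dX.
Hypothesis hu : homeomorphism (@ddisc R) dX u.
Hypothesis heta : homeo_halfline eta.
Hypothesis qs : forall z a b (t : R), 0 <= t -> ddisc z a <= t * ddisc z b ->
  dX (u z) (u a) <= eta t * dX (u z) (u b).

Let dge0 x y : 0 <= dX x y. Proof. by case: hX. Qed.
Let dxx x : dX x x = 0. Proof. by case: hX => _ [/(_ x x)[_ ->]]. Qed.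
Let dsym x y : dX x y = dX y x. Proof. by case: hX => _ [_ []]. Qed.
Let dtri x y z : dX x z <= dX x y + dX y z. Proof. by case: hX => _ [_ []]. Qed.
Let ege0 (x y : cdisc R) : 0 <= ddisc x y. Proof. by case: (@ddisc_metric R). Qed.
Let esym (x y : cdisc R) : ddisc x y = ddisc y x.
Proof. by case: (@ddisc_metric R) => _ [_ []]. Qed.
Let etri (x y z : cdisc R) : ddisc x z <= ddisc x y + ddisc y z.
Proof. by case: (@ddisc_metric R) => _ [_ []]. Qed.
Let eeq0 (x y : cdisc R) : ddisc x y = 0 -> x = y.
Proof. by case: (@ddisc_metric R) => _ [/(_ x y)[h _] _]. Qed.

(** [eta 1] bounds how far [u] can distort the order of distances from a point. Hence images of
    segments from the centre stay in the enlarged ball, and images of the paths of [join_outside]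
    stay out of the reduced one. *)
Lemma quasisymmetric_LLC : LLC dX.
Proof.
have [g [gu ug uc gc]] := hu.
pose lam := Num.max 1 (eta 1); have lam1 : 1 <= lam by rewrite le_max lexx.
have lam0 : 0 < lam by lra.
have mon z a b : ddisc z a <= ddisc z b -> dX (u z) (u a) <= lam * dX (u z) (u b).
  move=> h; apply: le_trans (qs ler01 _) _; first by rewrite mul1r; exact: h.
  by rewrite ler_wpM2r// le_max lexx orbT.
exists lam => // x r r0; rewrite -(ug x); move: (g x) => o; split => y w.
  rewrite -(ug y) -(ug w); move: (g y) (g w) => p q.
  rewrite /mball/= => hp hq.
  exists (((u \o dseg o p) @` [set t | 0 <= t <= 1]) `|` ((u \o dseg o q) @` [set t | 0 <= t <= 1])).
  have sub p' : dX (u o) (u p') < r -> (u \o dseg o p') @` [set t | 0 <= t <= 1] `<=` mball dX (u o) (lam * r).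
    move=> hp' _ [t /= t01 <-]; rewrite /mball/=.
    apply: (@le_lt_trans _ _ (lam * dX (u o) (u p'))); last by rewrite ltr_pM2l.
    apply: mon; rewrite ddisc_dseg_start// ler_piMl//; by case/andP: t01.
  split.
  - apply: (continuumU (x := u o)); try exact: segment_image_continuum.
      by exists 0; rewrite /= ?lexx ?ler01// dseg0.
    by exists 0; rewrite /= ?lexx ?ler01// dseg0.
  - by move=> m [/sub|/sub]; apply.
  - by left; exists 1; rewrite /= ?lexx ?ler01// dseg1.
  - by right; exists 1; rewrite /= ?lexx ?ler01// dseg1.
rewrite -(ug y) -(ug w); move: (g y) (g w) => p q.
have far p' : ~ mball dX (u o) r (u p') -> r <= dX (u o) (u p') /\ 0 < ddisc o p'.
  move=> /negP; rewrite /mball/= -leNgt => h; split => //.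
  rewrite lt_neqAle ege0 andbT eq_sym; apply/eqP => /eeq0 op.
  by move: h; rewrite op dxx leNgt r0.
have join p' q' : r <= dX (u o) (u p') -> 0 < ddisc o p' -> ddisc o p' <= ddisc o q' ->
    exists K, [/\ continuum dX K, K `<=` ~` mball dX (u o) (r / lam), K (u p') & K (u q')].
  move=> hr op opq; have [K [cK Kp Kq hK]] := join_outside uc op opq.
  exists K; split => // _ /hK[m -> om]; rewrite /mball/=; apply/negP; rewrite -leNgt.
  rewrite ler_pdivrMr// mulrC; apply: le_trans hr _; exact: mon.
move=> /far[hp op] /far[hq oq]; have [pq|/ltW qp] := leP (ddisc o p) (ddisc o q).
  exact: join.
by have [K [? ? ? ?]] := join q p hq oq qp; exists K.
Qed.

(* Grid cells of side [s rho / 2]: two points at distance at least [s rho] lie in different cells. *)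
Lemma disc_packing (s : R) : 0 < s -> exists M : nat, forall (z : cdisc R) (rho : R) (n : nat)
  (p : 'I_n -> cdisc R), 0 < rho -> (forall i, ddisc z (p i) <= rho) ->
  (forall i j, i != j -> s * rho <= ddisc (p i) (p j)) -> (n <= M)%N.
Proof.
(* The grid covers a square of side [2 * rho], which has [4 / s] cells of side [s * rho / 2] in each
   direction. *)
move=> s0; pose N := (Num.truncn (4 / s)).+1; exists (N * N)%N => z rho n p rho0 hp sep.
pose c := s * rho / 2; have c0 : 0 < c by rewrite divr_gt0// mulr_gt0.
pose cx i := ((val (p i)).1 - (val z).1 + rho) / c.
pose cy i := ((val (p i)).2 - (val z).2 + rho) / c.
have coord i : `|(val (p i)).1 - (val z).1| <= rho /\ `|(val (p i)).2 - (val z).2| <= rho.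
  have := hp i; rewrite ddiscE edistC edist_le ?(ltW rho0)// /sqn/= => h.
  by split; rewrite -ler_sqr ?nnegrE ?(ltW rho0)// real_normK ?num_real//; apply: le_trans h;
    rewrite ?lerDl ?lerDr sqr_ge0.
have bnd (x : R) : `|x| <= rho -> 0 <= (x + rho) / c /\ (Num.truncn ((x + rho) / c) < N)%N.
  rewrite ler_norml => /andP[h1 h2].
  have x0 : 0 <= x + rho by lra.
  split; first by rewrite divr_ge0// ltW.
  rewrite ltnS; apply: le_truncn; rewrite ler_pdivrMr// /c.
  have -> : 4 / s * (s * rho / 2) = 2 * rho by field; rewrite gt_eqF.
  lra.
have trunc_close (x y : R) : 0 <= x -> 0 <= y -> Num.truncn x = Num.truncn y -> `|x - y| < 1.
  move=> x0 y0 xy; have := truncn_itv x0; have := truncn_itv y0.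
  rewrite xy -natr1; move: (_%:R) => w /andP[h1 h2] /andP[h3 h4].
  by rewrite ltr_norml; apply/andP; split; lra.
pose f (i : 'I_n) : 'I_N * 'I_N :=
  (Ordinal (bnd _ (coord i).1).2, Ordinal (bnd _ (coord i).2).2).
suff finj : injective f.
  by have := leq_card f finj; rewrite card_prod !card_ord.
move=> i j [fx fy]; apply/eqP; apply: contrapT => /negP ij.
have close (x y : R) : `|(x + rho) / c - (y + rho) / c| < 1 -> (x - y) ^+ 2 < c ^+ 2.
  have -> : (x + rho) / c - (y + rho) / c = (x - y) / c by field; rewrite gt_eqF.
  rewrite normrM normfV (gtr0_norm c0) ltr_pdivrMr// mul1r => h.
  by rewrite -real_normK ?num_real// ltr_sqr ?nnegrE// ltW.
have hx := close _ _ (trunc_close _ _ (bnd _ (coord i).1).1 (bnd _ (coord j).1).1 fx).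
have hy := close _ _ (trunc_close _ _ (bnd _ (coord i).2).1 (bnd _ (coord j).2).1 fy).
have := sep i j ij; rewrite leNgt => /negP; apply.
rewrite ddiscE -ltr_sqr ?nnegrE ?edist_ge0 ?sqr_edist//; last by rewrite mulr_ge0// ltW.
have -> : s * rho = 2 * c by rewrite /c; field.
have shift (x y w : R) : x - y = x - w - (y - w) by ring.
rewrite /sqn/= exprMn (shift _ _ (val z).1) [X in _ + X ^+ 2](shift _ _ (val z).2).
move: hx hy (sqr_ge0 c); move: (_ ^+ 2) ((_ - _ - (_ - (val z).2)) ^+ 2) (c ^+ 2).
exact: sum_lt_square.
Qed.

(** A maximal [r]-separated family in a ball of radius [2 * r] provides the centres, and
    [disc_packing] bounds its size: if two preimages were too close relative to the largest distance
    from [o], the distortion [eta s <= 1 / 8] would bring their images within [4 * r / 8]. *)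
Lemma quasisymmetric_doubling : doubling dX.
Proof.
have [g [gu ug uc gc]] := hu.
(* At most one of the distinct values [1 / 8] and [1 / 16] has preimage 0 under [eta], so one of the
   two preimages is a positive [s]. *)
have [s s0 hs] : exists2 s, 0 < s & eta s <= 8^-1.
  have [ei [he _]] := heta.
  have [h1 h2] : 0 <= 8^-1 :> R /\ 0 <= 16^-1 :> R by split; rewrite invr_ge0 ler0n.
  have [_ e8 _ E8] := he _ h1; have [_ e16 _ E16] := he _ h2.
  have [z8|n8] := eqVneq (ei 8^-1) 0; last first.
    by exists (ei 8^-1); rewrite ?E8// lt_neqAle eq_sym n8.
  exists (ei 16^-1); last by rewrite E16; lra.
  rewrite lt_neqAle eq_sym e16 andbT; apply/eqP => z16.
  by move: E16; rewrite z16 -z8 E8; lra.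
have s20 : 0 < s / 2 by rewrite divr_gt0.
have [M hM] := disc_packing s20.
(* A family of one point may consist of the centre, where the largest distance vanishes; the maximum
   with 1 allows for it. *)
have sepM (x : X) (r : R) (n : nat) (y : 'I_n -> X) : 0 < r ->
    (forall i, mball dX x (2 * r) (y i)) -> (forall i j, i != j -> r <= dX (y i) (y j)) ->
    (n <= maxn M 1)%N.
  move=> r0 yB ysep; rewrite leq_max; have [n1|n1] := leqP n 1; first by rewrite orbT.
  rewrite orbF.
  pose o := g x; pose p i := g (y i).
  have up i : u (p i) = y i by rewrite ug.
  have i0 : 'I_n := Ordinal (ltnW n1).
  pose k := [arg max_(i > i0) ddisc o (p i)]%O.
  have hk i : ddisc o (p i) <= ddisc o (p k).
    by rewrite /k; case: arg_maxP => // j _; apply.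
  have rho0 : 0 < ddisc o (p k).
    rewrite lt_neqAle ege0 andbT eq_sym; apply/eqP => k0.
    have po i : p i = o.
      by apply: eeq0; rewrite esym; apply/eqP; rewrite eq_le ege0 andbT -k0 hk.
    have := ysep (Ordinal (ltnW n1)) (Ordinal n1) isT.
    by rewrite -!up !po dxx leNgt r0.
  apply: (hM o (ddisc o (p k)) n p rho0 hk) => i j ij.
  rewrite leNgt; apply/negP => lt.
  (* By the triangle inequality [o] or the farthest point [p k] lies at distance at least half of
     [ddisc o (p k)] from [p i]. *)
  have [q hq dq] : exists2 q, ddisc o (p k) / 2 <= ddisc (p i) q & dX (y i) (u q) < 4 * r.
    have yo i' : dX (u o) (y i') < 2 * r by have := yB i'; rewrite /mball/= /o ug.
    have [h|h] := leP (ddisc o (p k) / 2) (ddisc (p i) o).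
      by exists o => //; rewrite dsym; have := yo i; lra.
    exists (p k).
      by have := etri o (p i) (p k); rewrite (esym o (p i)); lra.
    rewrite up; apply: le_lt_trans (dtri _ (u o) _) _; rewrite dsym.
    by have := yo i; have := yo k; lra.
  have h1 : ddisc (p i) (p j) <= s * ddisc (p i) q.
    by have := ler_wpM2l (ltW s0) hq; lra.
  have h2 := qs (ltW s0) h1; rewrite !up in h2.
  have h3 := ysep i j ij.
  have h4 : eta s * dX (y i) (u q) <= 8^-1 * dX (y i) (u q) by rewrite ler_wpM2r.
  lra.
exists (maxn M 1).+1 => x r r0.
pose P n := `[< exists y : 'I_n -> X, (forall i, mball dX x (2 * r) (y i)) /\
  forall i j, i != j -> r <= dX (y i) (y j) >].
have P0 : exists n, P n.
  exists 0%N; apply/asboolP; exists (fun=> x); split; first by case.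
  by case.
have Pub n : P n -> (n <= maxn M 1)%N by move=> /asboolP[y [h1 h2]]; exact: sepM h1 h2.
have [n /asboolP[y [yB ysep]] nmax] := ex_maxnP P0 Pub.
have nM : (n <= maxn M 1)%N := sepM x r n y r0 yB ysep.
(* Surplus indices repeat the centre [x]. *)
exists (fun i => if insub (val i) is Some j then y j else x).
move=> w wB; apply: contrapT => /forallNP now.
have {}now (j : 'I_n) : r <= dX (y j) w.
  rewrite leNgt; apply/negP => jw.
  have jM : (j < (maxn M 1).+1)%N by rewrite ltnS (leq_trans (ltnW (ltn_ord j))).
  by apply: (now (Ordinal jM)); rewrite /= valK.
(* An uncovered [w] would extend the separated family, against its maximality. *)
suff /nmax : P n.+1 by rewrite ltnn.
apply/asboolP; exists (fun i => if unlift ord_max i is Some j then y j else w); split.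
  by move=> i; case: unliftP => [j _|_].
move=> i j; case: unliftP => [i' ->|->]; case: unliftP => [j' ->|->].
- by move=> h; apply: ysep; apply: contraNneq h => ->.
- by move=> _; exact: now.
- by move=> _; rewrite dsym; exact: now.
- by rewrite eqxx.
Qed.

End QuasisymmetricImage.

Theorem theorem2p5 (R : realType) (X : Type) (dX : X -> X -> R)
  (hX : is_metric dX)
  (hhom : exists h : cdisc R -> X, homeomorphism (@ddisc R) dX h)
  (L : R) (hL : 0 < L)
  (hball : forall (x : X) (r : R), 0 < r -> (H2 dX (mball dX x r) <= (L * r ^+ 2)%:E)%E)
  (Q : R) (hQ : 1 <= Q)
  (u : cdisc R -> X) (hu : homeomorphism (@ddisc R) dX u)
  (hmod : forall Gam : set (curve R (cdisc R)),
     (forall g, Gam g -> is_curve (@ddisc R) g) ->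
     (MOD (@ddisc R) Gam <= Q%:E * MOD dX (comp_family u Gam))%E) :
  quasisymmetric (@ddisc R) dX u <-> doubling dX /\ LLC dX.
Proof.
have [g [gu ug uc gc]] := hu; have uinj := can_inj gu.
split => [[_ [eta [heta qs]]]|[hdbl hLLC]].
  split; first exact: (quasisymmetric_doubling hX hu heta qs).
  exact: (quasisymmetric_LLC hX hu qs).
have Q0 : 0 < Q by exact: lt_le_trans hQ.
have [H H1 hH] := weak_quasisymmetry hX hL hball Q0 hu hmod hLLC.
split => //; exact: (weak_to_quasisymmetric hX uinj H1 hH hdbl).
Qed.
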